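(* Let $W^J$ and $(W')^{J'}$ be Hermitian symmetric pairs from the list in the context, let $u\le v$ in $W^J$ and $u'\le v'$ in $(W')^{J'}$. If the Bruhat intervals $[u,v]\subseteq W^J$ and $[u',v']\subseteq (W')^{J'}$ are isomorphic as posets, then the relative Kazhdan–Lusztig polynomials agree: $$P^{J}_{u,v}(q)=P^{J'}_{u',v'}(q).$$
   Context: **Coxeter conventions.** $W$ is a Weyl group with simple reflections $S=\{s_1,\dots,s_n\}$ in Bourbaki numbering and length function $\ell$. For $J\subset S$, $W_J=\langle J\rangle$ and $W^J=\{w\in W:\ell(ws)>\ell(w)\text{ for all }s\in J\}$. $D_L(w)=\{s\in S:\ell(sw)<\ell(w)\}$. $\le$ is the Bruhat order restricted to $W^J$, and $[u,v]=\{w\in W^J:u\le w\le v\}$. **Hermitian symmetric pairs.** $W^J=W/W_J$ is one of: $A_n/(A_{p-1}\times A_{n-p})$ with $J=S\setminus\{s_p\}$; $C_n/A_{n-1}$ with $J=S\setminus\{s_n\}$; $B_n/B_{n-1}$ with $J=S\setminus\{s_1\}$; $D_n/A_{n-1}$ with $J=S\setminus\{s_n\}$; $D_n/D_{n-1}$ with $J=S\setminus\{s_1\}$; $E_6/D_5$ with $J=S\setminus\{s_1\}$; $E_7/E_6$ with $J=S\setminus\{s_7\}$. **Relative $R$-polynomials.** $R^J_{u,v}(q)$ denotes Deodhar's relative $R$-polynomial of type $x=-1$: the unique family $\{R^J_{u,v}\}_{u,v\in W^J}\subset\mathbb Z[q]$ with $R^J_{u,v}=0$ if $u\not\le v$;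 $R^J_{u,u}=1$; and for $u<v$, $s\in D_L(v)$: $R^J_{u,v}=R^J_{su,sv}$ if $su<u$; $R^J_{u,v}=q\,R^J_{u,sv}$ if $u<su\notin W^J$; $R^J_{u,v}=(q-1)R^J_{u,sv}+q\,R^J_{su,sv}$ if $u<su\in W^J$. **Relative Kazhdan–Lusztig polynomials.** $P^J_{u,v}(q)$ denotes Deodhar's relative Kazhdan–Lusztig polynomial of type $x=-1$: the unique family $\{P^J_{u,v}\}_{u,v\in W^J}\subset\mathbb Z[q]$ with $P^J_{u,v}=0$ if $u\not\le v$; $P^J_{u,u}=1$; $\deg P^J_{u,v}\le\frac12(\ell(v)-\ell(u)-1)$ if $u<v$; and $$q^{\ell(v)-\ell(u)}P^J_{u,v}(q^{-1})=\sum_{z\in[u,v]}R^J_{u,z}(q)\,P^J_{z,v}(q)\qquad\text{for }u\le v.$$ *)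

(* Defs.v *)
From HB Require Import structures.
From mathcomp Require Import all_boot all_order all_algebra all_fingroup.

Set Implicit Arguments.
Unset Strict Implicit.
Unset Printing Implicit Defensive.

Import GRing.Theory.

Variant cartan_type : Type :=
  TypeA of nat | TypeB of nat | TypeC of nat | TypeD of nat | TypeE6 | TypeE7.

Definition rank (X : cartan_type) : nat :=
  match X with
  | TypeA n | TypeB n | TypeC n | TypeD n => n
  | TypeE6 => 6
  | TypeE7 => 7
  end.

(** [bond X i j] is the order of [s_i * s_j] for Bourbaki labels
    [1 <= i < j <= rank X].  The two labels [n-1] and [n] carry the double bond
    in types B and C, which have the same Weyl group as a Coxeter group. *)
Definition bond (X : cartan_type) (i j : nat) : nat :=
  match X with
  | TypeA _ => if j == i.+1 then 3 else 2
  | TypeB n | TypeC n => if j == i.+1 then (if j == n then 4 else 3) else 2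
  | TypeD n =>
      if (j == i.+1) && (j < n) || (j == i.+2) && (j == n) then 3 else 2
  | TypeE6 | TypeE7 =>
      if (i, j) \in [:: (1, 3); (3, 4); (2, 4); (4, 5); (5, 6); (6, 7)]
      then 3 else 2
  end.

(** The ordinal [i : 'I_(rank X)] stands for the Bourbaki label [i.+1]. *)
Definition coxeter_matrix (X : cartan_type) (i j : 'I_(rank X)) : nat :=
  if i == j then 1 else bond X (minn i j).+1 (maxn i j).+1.

(** A finite group [W] with generators [simple i] forming a Coxeter system of
    type [X]: the last two fields say that [W] is presented by the relations
    [(s_i s_j)^m(i,j) = 1], including [s_i^2 = 1].  They determine the pair
    [(W, S)] up to unique isomorphism. *)
Record weyl_group (X : cartan_type) := WeylGroup {
  weyl_sort :> finGroupType;
  simple : 'I_(rank X) -> weyl_sort;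
  simple_gen : <<[set simple i | i : 'I_(rank X)]>>%g = [set: weyl_sort];
  simple_rel : forall i j, ((simple i * simple j) ^+ coxeter_matrix i j = 1)%g;
  simple_univ : forall (hT : groupType) (t : 'I_(rank X) -> hT),
    (forall i j, ((t i * t j) ^+ coxeter_matrix i j = 1)%g) ->
    exists2 f : weyl_sort -> hT,
      {morph f : x y / (x * y)%g} & forall i, f (simple i) = t i
}.

Section Coxeter.
Variables (X : cartan_type) (W : weyl_group X).
Implicit Types (u v w : W) (i : 'I_(rank X)) (J : {set 'I_(rank X)}).

Definition has_word w (k : nat) : bool :=
  [exists t : k.-tuple 'I_(rank X), w == (\prod_(i <- t) simple W i)%g].

Lemma has_word_ex w : exists k, has_word w k.
Proof.
have: w \in <<[set simple W i | i : 'I_(rank X)]>>%g by rewrite simple_gen inE.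
case/gen_prodgP=> k [c cS ->].
have ex_j (l : 'I_k) : exists j, c l == simple W j.
  by have /imsetP[j _ ->] := cS l; exists j.
exists k; apply/existsP; exists [tuple xchoose (ex_j l) | l < k].
rewrite big_tuple; apply/eqP/eq_bigr => l _.
by rewrite tnth_mktuple; apply/eqP/(xchooseP (ex_j l)).
Qed.

Definition len w : nat := ex_minn (has_word_ex w).

Definition reflections : {set W} :=
  [set (simple W i ^ w)%g | i : 'I_(rank X), w : W].

(** Bruhat order: reflexive transitive closure of [u -> u t] with [t] a
    reflection and [len u < len (u t)]. *)
Definition bruhat : rel W :=
  connect (fun u v => ((u^-1 * v)%g \in reflections) && (len u < len v)).

Definition bruhat_lt : rel W := fun u v => (u != v) && bruhat u v.

Definition left_descents w : {set 'I_(rank X)} :=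
  [set i | len (simple W i * w)%g < len w].

(** The set W^J of minimal representatives of the cosets in [W / W_J]. *)
Definition quot J : {set W} :=
  [set w | [forall i in J, len w < len (w * simple W i)%g]].

Definition interval J u v : {set W} :=
  [set w in quot J | bruhat u w && bruhat w v].

Local Open Scope ring_scope.

(** [R] restricted to [quot J] is the family of relative R-polynomials of type
    [x = -1]; its values off [quot J] are irrelevant. *)
Definition relative_R J (R : W -> W -> {poly int}) : Prop :=
  {in quot J &, forall u v,
    [/\ ~~ bruhat u v -> R u v = 0,
        R u u = 1 &
        forall i, bruhat_lt u v -> i \in left_descents v ->
          let su := (simple W i * u)%g in
          let sv := (simple W i * v)%g in
          [/\ bruhat_lt su u -> R u v = R su sv,
              bruhat_lt u su -> su \notin quot J -> R u v = 'X * R u sv &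
              bruhat_lt u su -> su \in quot J ->
                R u v = ('X - 1) * R u sv + 'X * R su sv]]}.

(** The polynomial [q^d p(q^-1)], for [p] of degree at most [d]. *)
Definition reciprocal (d : nat) (p : {poly int}) : {poly int} :=
  \poly_(k < d.+1) p`_(d - k).

(** [P] restricted to [quot J] is the family of relative Kazhdan-Lusztig
    polynomials of type [x = -1] attached to [R].  The degree bound
    [2 deg P <= len v - len u - 1] is written with a strict inequality; it
    always holds for [P = 0], as it should. *)
Definition relative_KL J (R P : W -> W -> {poly int}) : Prop :=
  {in quot J &, forall u v,
    [/\ ~~ bruhat u v -> P u v = 0,
        P u u = 1,
        bruhat_lt u v -> ((size (P u v)).-1.*2 < len v - len u)%N &
        bruhat u v ->
          reciprocal (len v - len u) (P u v)
            = \sum_(z in interval J u v) R u z * P z v]}.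

End Coxeter.

(** The classical ranks are those for which Bourbaki's plates define the root
    system; the pairs of type D_3 repeat pairs of type A_3. *)
Variant hermitian_pair : Type :=
  | PairA (n p : nat) of 1 <= p <= n   (* A_n / (A_{p-1} x A_{n-p}) *)
  | PairC (n : nat) of 2 <= n          (* C_n / A_{n-1} *)
  | PairB (n : nat) of 2 <= n          (* B_n / B_{n-1} *)
  | PairDA (n : nat) of 3 <= n         (* D_n / A_{n-1} *)
  | PairDD (n : nat) of 3 <= n         (* D_n / D_{n-1} *)
  | PairE6                             (* E_6 / D_5 *)
  | PairE7.                            (* E_7 / E_6 *)

Definition pair_type (H : hermitian_pair) : cartan_type :=
  match H with
  | PairA n _ _ => TypeA n
  | PairC n _ => TypeC n
  | PairB n _ => TypeB n
  | PairDA n _ | PairDD n _ => TypeD n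
  | PairE6 => TypeE6
  | PairE7 => TypeE7
  end.

(** Bourbaki label of the simple reflection not in [J]. *)
Definition pair_node (H : hermitian_pair) : nat :=
  match H with
  | PairA _ p _ => p
  | PairC n _ => n
  | PairB _ _ => 1
  | PairDA n _ => n
  | PairDD _ _ => 1
  | PairE6 => 1
  | PairE7 => 7
  end.

Definition pair_J (H : hermitian_pair) : {set 'I_(rank (pair_type H))} :=
  [set i : 'I_(rank (pair_type H)) | i.+1 != pair_node H].

Definition interval_iso (X X' : cartan_type)
    (W : weyl_group X) (J : {set 'I_(rank X)}) (u v : W)
    (W' : weyl_group X') (J' : {set 'I_(rank X')}) (u' v' : W') : Prop :=
  exists f : W -> W',
    [/\ {in interval J u v &, injective f},
        f @: interval J u v = interval J' u' v' &
        {in interval J u v &, {mono f : x y / bruhat x y}}].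

(* Main.v *)
(** A quotient W^J of the list is the W-orbit of a minuscule weight lambda, with
    u < v if and only if u.lambda - v.lambda is a sum of simple roots, and the
    three cases of the recursion for R_{u,v} at a descent s_i of v are read off
    the pairing u_i of u.lambda with the i-th simple coroot, which is -1, 0 or 1.

    Suppose first that the Cartan matrix A is simply laced.  Then R_{u,v} also
    satisfies the dual recursion, at the atoms of [u, v].  If an interval has a
    single atom, with label i, and a single coatom, with label j, then the three
    possible values of A_ij lead to disjoint sets of values for the pairings of
    the atom with j and of the coatom with i.  By induction, an isomorphism of
    intervals preserves the entries A_ij, hence the pairings u_j for the coatoms
    s_j v and v_i for the atoms s_i u.  Since u.lambda - v.lambda has positive
    norm, some label has u_i > v_i, and the recursion or its dual applies there:
    R_{u,v} depends only on the poset [u, v], and so does P_{u,v}.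

    The orbits for C_n/A_{n-1} and B_n/B_{n-1} are, as posets with their
    R-polynomials, those for D_{n+1}/A_n and for the projective space of
    dimension 2n - 1. *)

(* The group comes as a presentation without a root system, so the orbit is built from the Cartan
   matrix: a weight is the vector of its coefficients below the top, and the orbit is what lowering
   steps reach. The universal property makes W act on it. Braid relations show that the stabiliser
   of the top is W_J; the exchange condition, obtained from the presentation by counting inversions
   modulo 2, then identifies minimal representatives with lowering words and the Bruhat order with
   the comparison of coefficients.

   An isomorphism of intervals does not see labels, only atoms and coatoms. Pairings are sums of
   Cartan entries along chains, and entries are read from pairings at the ends of an interval, so
   both are recovered in one induction on its length.

   The positive norm is used through a weaker integral statement, [sign_nonreversing], which linear
   arithmetic can check on each diagram.

   Reading entries this way needs a symmetric matrix, and at the last label of C_n the pairing never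
   vanishes. Types C and B are therefore relabelled first: same weights and order, with the labels
   and the action of a simply laced matrix. *)
From mathcomp Require Import all_boot all_order all_algebra all_fingroup.
From mathcomp Require Import zify ring.
Require Import Defs.

Set Implicit Arguments.
Unset Strict Implicit.
Unset Printing Implicit Defensive.

Import Order.TTheory GRing.Theory Num.Theory.
Local Open Scope ring_scope.

(** * Minuscule systems *)

(* For a Cartan matrix this is a consequence of positive definiteness. *)
Definition sign_nonreversing (I : finType) (A : I -> I -> int) : Prop :=
  forall d : I -> int, (exists i, d i != 0) ->
  exists i, 0 < d i * \sum_j d j * A j i.

(* A minuscule weight orbit: [wt x i] is the pairing of the weight [x] with the
   simple coroot [i], and [dep x i] is the coefficient of the simple root [i] in
   [top - x], so that [act i x = x - wt x i * alpha_i]. *)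
Record minuscule (I : finType) (A : I -> I -> int) := Minuscule {
  weight :> finType;
  wt : weight -> I -> int;
  act : I -> weight -> weight;
  dep : weight -> I -> nat;
  top : weight;
  cartan_diag : forall i, A i i = 2;
  cartan_offdiag : forall i j, i != j -> A i j <= 0;
  cartan_eq0 : forall i j, A i j = 0 -> A j i = 0;
  cartan_pos : sign_nonreversing A;
  wt_bound : forall x i, -1 <= wt x i <= 1;
  wt_act : forall i x j, wt (act i x) j = wt x j - wt x i * A i j;
  dep_act : forall i x j,
    (dep (act i x) j)%:Z = (dep x j)%:Z + (if i == j then wt x i else 0);
  dep_inj : forall x y, (forall i, dep x i = dep y i) -> x = y;
  dep_top : forall i, dep top i = 0%N;
  wt_descent : forall x, x != top -> exists i, wt x i = -1
}.

Section Minuscule.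
Variables (I : finType) (A : I -> I -> int) (M : minuscule A).
Implicit Types (x y z u v w : M) (i j k : I).

(** No chain of reflections is asked for; [wle_corner] supplies the chains, and [bruhatE] identifies
    this order with the Bruhat order on minimal representatives. *)
Definition wle x y : bool := [forall i, (dep x i <= dep y i)%N].
Definition height x : nat := (\sum_i dep x i)%N.

Lemma wleP x y : reflect (forall i, (dep x i <= dep y i)%N) (wle x y).
Proof. exact: forallP. Qed.

Lemma wle_refl x : wle x x.
Proof. exact/wleP. Qed.

Lemma wle_trans y x z : wle x y -> wle y z -> wle x z.
Proof. by move=> /wleP xy /wleP yz; apply/wleP=> i; apply: leq_trans (yz i). Qed.

Lemma wle_anti x y : wle x y -> wle y x -> x = y.
Proof.
move=> /wleP xy /wleP yx; apply: dep_inj => i.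
by apply/eqP; rewrite eqn_leq xy yx.
Qed.

Lemma actK i : involutive (@act I A M i).
Proof.
move=> x; apply: dep_inj => j.
have := dep_act i (act i x) j; have := dep_act i x j.
by rewrite wt_act (cartan_diag M); case: (i == j); lia.
Qed.

Lemma act_fix i x : wt x i = 0 -> act i x = x.
Proof.
move=> x0; apply: dep_inj => j; have := dep_act i x j.
rewrite x0; case: (i == j); lia.
Qed.

Lemma act_comm i j x : A i j = 0 -> act i (act j x) = act j (act i x).
Proof.
move=> Aij; have Aji := cartan_eq0 M Aij; apply: dep_inj => k.
have := dep_act i (act j x) k; have := dep_act j (act i x) k.
have := dep_act i x k; have := dep_act j x k.
rewrite !wt_act Aij Aji !mulr0 !subr0.
by case: (i == k); case: (j == k); lia.
Qed.

Lemma wt_actK i x : wt (act i x) i = - wt x i.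
Proof. rewrite wt_act (cartan_diag M); lia. Qed.

Lemma wt_act0 i j x : A i j = 0 -> wt (act i x) j = wt x j.
Proof. by move=> Aij; rewrite wt_act Aij mulr0 subr0. Qed.

Lemma height_act i x : (height (act i x))%:Z = (height x)%:Z + wt x i.
Proof.
rewrite /height (bigD1 i) //= [in RHS](bigD1 i) //=.
have := dep_act i x i; rewrite eqxx.
rewrite (eq_bigr (dep x)); first lia.
by move=> j ji; have := dep_act i x j; rewrite eq_sym (negbTE ji); lia.
Qed.

Lemma wle_height x y : wle x y -> (height x <= height y)%N.
Proof. by move=> /wleP xy; apply: leq_sum. Qed.

Lemma wle_height_eq x y : wle x y -> (height y <= height x)%N -> x = y.
Proof.
move=> xy yx; apply: wle_anti => //; apply/wleP => i.
move: yx; rewrite /height (bigD1 i) //= [leqRHS](bigD1 i) //=.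
move/wleP: xy => xy.
have: (\sum_(j | j != i) dep x j <= \sum_(j | j != i) dep y j)%N.
  exact: leq_sum.
lia.
Qed.

Lemma height_top : height (top M) = 0%N.
Proof. by rewrite /height big1 // => i _; apply: dep_top. Qed.

Lemma height_eq0 x : height x = 0%N -> x = top M.
Proof.
move=> x0; apply/esym/wle_height_eq; last by rewrite x0.
by apply/wleP=> i; rewrite dep_top.
Qed.

Lemma wle_top x : wle (top M) x.
Proof. by apply/wleP => i; rewrite dep_top. Qed.

Lemma minuscule_ind (P : M -> Prop) :
  P (top M) -> (forall x i, wt x i = -1 -> P (act i x) -> P x) ->
  forall x, P x.
Proof.
move=> Ptop Pact x; have [n] := ubnP (height x).
elim: n x => // n IHn x lt_xn.
have [-> //|/wt_descent[i xi]] := eqVneq x (top M).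
apply: (Pact _ i) => //; apply: IHn.
by have := height_act i x; rewrite xi; lia.
Qed.

Lemma wt_dep x j : wt x j + \sum_i (dep x i)%:Z * A i j = wt (top M) j.
Proof.
elim/minuscule_ind: x => [|x i xi <-].
  by rewrite big1 ?addr0 // => i _; rewrite dep_top mul0r.
rewrite (bigD1 i) //= [in RHS](bigD1 i) //= wt_act dep_act eqxx xi.
under [in RHS]eq_bigr => k ki do rewrite dep_act eq_sym (negbTE ki) addr0.
by ring.
Qed.

Lemma wt_sub u v j :
  wt u j - wt v j = \sum_i ((dep v i)%:Z - (dep u i)%:Z) * A i j.
Proof.
under eq_bigr => i _ do rewrite mulrBl.
have E w : wt w j = wt (top M) j - \sum_i (dep w i)%:Z * A i j.
  by rewrite -(wt_dep w j) addrK.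
by rewrite (E u) (E v) sumrB; ring.
Qed.

Lemma wtP x i : [\/ wt x i = -1, wt x i = 0 | wt x i = 1].
Proof.
have := wt_bound x i; case: (wt x i) => [[|[|n]]|[|n]]; try lia.
- by constructor 2.
- by constructor 3.
- by constructor 1.
Qed.

(* The weight u - v has positive norm, hence pairs positively with a simple
   coroot in its support. *)
Lemma wle_corner u v : wle u v -> u != v -> exists2 i,
  (dep u i < dep v i)%N &
  (wt u i = 1 /\ wt v i <= 0) \/ (wt v i = -1 /\ 0 <= wt u i).
Proof.
move=> /wleP uv neq_uv.
have [|i] := @cartan_pos _ _ M (fun i => (dep v i)%:Z - (dep u i)%:Z).
  apply/existsP; apply: contraR neq_uv => /existsPn dE.
  by apply/eqP/dep_inj => i; have /negPn/eqP /= := dE i; lia.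
rewrite -wt_sub => di; have := uv i => uvi; exists i.
  by rewrite ltn_neqAle uvi andbT; apply/eqP=> E; move: di; rewrite E; lia.
have [] := wtP u i; have [] := wtP v i; nia.
Qed.

Lemma wle_actl u v i : wle u v -> wt u i = 1 -> (dep u i < dep v i)%N ->
  wle (act i u) v.
Proof.
move=> /wleP uv ui di; apply/wleP => j; have := dep_act i u j; have := uv j.
by rewrite ui; case: eqP => [<-|]; lia.
Qed.

Lemma wle_actr u v i : wle u v -> wt v i = -1 -> (dep u i < dep v i)%N ->
  wle u (act i v).
Proof.
move=> /wleP uv ui di; apply/wleP => j; have := dep_act i v j; have := uv j.
by rewrite ui; case: eqP => [<-|]; lia.
Qed.

Lemma wle_act_up x i : wt x i = 1 -> wle x (act i x).
Proof.
move=> xi; apply/wleP => j; have := dep_act i x j; rewrite xi.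
by case: eqP; lia.
Qed.

Lemma wle_act_down x i : wt x i = -1 -> wle (act i x) x.
Proof.
move=> xi; apply/wleP => j; have := dep_act i x j; rewrite xi.
by case: eqP; lia.
Qed.

Lemma lt_height u v : wle u v -> u != v -> (height u < height v)%N.
Proof.
by move=> uv; apply: contraNT; rewrite -leqNgt => /(wle_height_eq uv) ->.
Qed.

Lemma act_neq i x : wt x i != 0 -> act i x != x.
Proof.
apply: contraNneq => /(congr1 height) E; have := height_act i x.
by rewrite E; lia.
Qed.

(** The corner given by [wle_corner] may sit at v instead of u. That coatom is then removed and the
    search goes on in the smaller interval, whose atoms are atoms of [u, v]. *)
Lemma atom_exists u v : wle u v -> u != v ->
  exists2 i, wt u i = 1 & (dep u i < dep v i)%N.
Proof.
have [n] := ubnP (height v); elim: n v => // n IHn v lt_vn uv neq_uv.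
have [i di [[ui _]|[vi _]]] := wle_corner uv neq_uv; first by exists i.
have uv' := wle_actr uv vi di; have := height_act i v; rewrite vi => hv.
have [uE|neq_uv'] := eqVneq u (act i v).
  by exists i => //; rewrite uE wt_actK vi.
have [|k uk dk] := IHn (act i v) _ uv' neq_uv'; first by lia.
exists k => //; apply: leq_trans dk _.
by have /wleP := wle_act_down vi.
Qed.

Lemma coatom_exists u v : wle u v -> u != v ->
  exists2 i, wt v i = -1 & (dep u i < dep v i)%N.
Proof.
have [n] := ubnP (height v - height u).
elim: n u => // n IHn u lt_vn uv neq_uv.
have [i di [[ui _]|[vi _]]] := wle_corner uv neq_uv; last by exists i.
have uv' := wle_actl uv ui di; have := height_act i u; rewrite ui => hu.
have hle := wle_height uv'.
have [uE|neq_uv'] := eqVneq (act i u) v.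
  by exists i => //; rewrite -uE wt_actK ui.
have [|k uk dk] := IHn (act i u) _ uv' neq_uv'; first by lia.
exists k => //; apply: leq_trans dk; rewrite ltnS.
by have /wleP := wle_act_up ui.
Qed.

(** A negative entry would give [act i x] a pairing of at least 2 with [j]. *)
Lemma wt1_A0 x i j : i != j -> wt x i = 1 -> wt x j = 1 -> A i j = 0.
Proof.
move=> ij xi xj; have := wt_bound (act i x) j; rewrite wt_act xi xj.
by have := cartan_offdiag M ij; lia.
Qed.

Lemma wtN1_A0 x i j : i != j -> wt x i = -1 -> wt x j = -1 -> A i j = 0.
Proof.
move=> ij xi xj; have := wt_bound (act i x) j; rewrite wt_act xi xj.
by have := cartan_offdiag M ij; lia.
Qed.

End Minuscule.

(** * Relative R-polynomials of simply laced systems *)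

(** The pairings -1, 0, 1 of u with [i] encode su < u, su outside W^J (the weight is fixed), and u <
    su in W^J. The rules hold for every u, so that they apply without first comparing u and v;
    [R_system_section] treats the pairs left out by the group recursion. *)
Definition R_system (I : finType) (A : I -> I -> int) (M : minuscule A)
    (R : M -> M -> {poly int}) : Prop :=
  [/\ forall u v, ~~ wle u v -> R u v = 0,
      forall u, R u u = 1 &
      forall u v i, wt v i = -1 ->
        [/\ wt u i = -1 -> R u v = R (act i u) (act i v),
            wt u i = 0 -> R u v = 'X * R u (act i v) &
            wt u i = 1 -> R u v =
              ('X - 1) * R u (act i v) + 'X * R (act i u) (act i v)]].

Definition simply_laced (I : finType) (A : I -> I -> int) : Prop :=
  forall i j, i != j -> (A i j = 0 /\ A j i = 0) \/ (A i j = -1 /\ A j i = -1).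

Section DualRecursion.
Variables (I : finType) (A : I -> I -> int) (M : minuscule A).
Variables (R : M -> M -> {poly int}) (RP : R_system R).
Implicit Types (u v : M) (i j k : I).

Let RN1 u v i (vi : wt v i = -1) (ui : wt u i = -1) :
  R u v = R (act i u) (act i v).
Proof. by have [_ _ /(_ u v i vi)[-> //]] := RP. Qed.
Let R0 u v i (vi : wt v i = -1) (ui : wt u i = 0) :
  R u v = 'X * R u (act i v).
Proof. by have [_ _ /(_ u v i vi)[_ -> //]] := RP. Qed.
Let R1 u v i (vi : wt v i = -1) (ui : wt u i = 1) :
  R u v = ('X - 1) * R u (act i v) + 'X * R (act i u) (act i v).
Proof. by have [_ _ /(_ u v i vi)[_ _ -> //]] := RP. Qed.

(* One step of the dual recursion, which removes an atom of the interval. *)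
Lemma R_bottom_step u v j k : wt v j = -1 -> wt u k = 1 -> wt v k = 0 ->
  (A j k = 0 /\ A k j = 0) \/ (A j k = -1 /\ A k j = -1) ->
  (forall u' v' l, (height v' < height v)%N -> (l == j) || (l == k) ->
     wt u' l = 1 -> wt v' l = 0 -> R u' v' = 'X * R (act l u') v') ->
  R u v = 'X * R (act k u) v.
Proof.
move=> vj uk vk Ajk IH.
have hjv := height_act j v; rewrite vj in hjv.
case: Ajk => -[Ajk Akj].
  have jvk : wt (act j v) k = 0 by rewrite wt_act0.
  have uj' : wt (act k u) j = wt u j by rewrite wt_act0.
  have IHk u' : wt u' k = 1 -> R u' (act j v) = 'X * R (act k u') (act j v).
    by move=> u'k; apply: IH; rewrite ?eqxx ?orbT //; lia.
  case: (wtP u j) => uj.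
  - rewrite !(RN1 vj) ?uj' // (act_comm _ Ajk); apply: IHk.
    by rewrite wt_act0.
  - by rewrite !(R0 vj) ?uj' // IHk.
  - rewrite !(R1 vj) ?uj' // (act_comm _ Ajk) (IHk u) // (IHk (act j u)).
      by ring.
    by rewrite wt_act0.
(* The labels j and k span an A_2: v descends by j, then by k, to a weight that pairs to 0 with j,
   where the induction hypothesis is used at the label j. *)
have jvk : wt (act j v) k = -1 by rewrite wt_act; lia.
have hkjv := height_act k (act j v); rewrite jvk in hkjv.
have kjvj : wt (act k (act j v)) j = 0 by rewrite !wt_act (cartan_diag M); lia.
have kuk : wt (act k u) k = -1 by rewrite wt_actK uk.
have IHj u' : wt u' j = 1 ->
    R u' (act k (act j v)) = 'X * R (act j u') (act k (act j v)).
  by move=> u'j; apply: IH; rewrite ?eqxx //; lia.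
case: (wtP u j) => uj.
- have juk : wt (act j u) k = 0 by rewrite wt_act; lia.
  have kuj : wt (act k u) j = 0 by rewrite wt_act; lia.
  rewrite (RN1 vj uj) (R0 jvk juk) (IHj (act j u)) ?wt_actK ?uj // actK.
  by rewrite (R0 vj kuj) (RN1 jvk kuk) actK.
- have kuj : wt (act k u) j = 1 by rewrite wt_act; lia.
  have jkuk : wt (act j (act k u)) k = 0 by rewrite wt_act kuj kuk; lia.
  rewrite (R0 vj uj) (R1 jvk uk) (R1 vj kuj) (RN1 jvk kuk) actK.
  by rewrite (R0 jvk jkuk) (IHj (act k u)) //; ring.
- have jk : j != k by apply/eqP=> E; move: vk; rewrite -E vj.
  have := wt1_A0 jk uj uk; lia.
Qed.

(** Induction on [height v]. A descent j of v differs from k, since v pairs to -1 and 0 with them,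
    and both sides are expanded along j. At the top both sides vanish. *)
Lemma R_bottom u v k : simply_laced A -> wt u k = 1 -> wt v k = 0 ->
  R u v = 'X * R (act k u) v.
Proof.
move=> slA; have [n] := ubnP (height v).
elim: n u v k => // n IHn u v k lt_vn uk vk.
have [vE|/wt_descent[j vj]] := eqVneq v (top M).
  have [Rle _ _] := RP.
  have nle w : w != v -> ~~ wle w v.
    by apply: contra => wv; apply/eqP/wle_anti; rewrite // vE wle_top.
  rewrite (Rle u) ?(Rle (act k u)) ?mulr0 // nle //; apply/eqP => E.
    by move: vk; rewrite -E wt_actK uk.
  by move: vk; rewrite -E uk.
have jk : j != k by apply/eqP=> E; move: vk; rewrite -E vj.
apply: (R_bottom_step vj) => // [|u' v' l lt_v' _]; first exact: slA.
by apply: IHn; lia.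
Qed.
End DualRecursion.

(** * Isomorphisms of intervals *)

Section Iso.
Variables (I I' : finType) (A : I -> I -> int) (A' : I' -> I' -> int).
Variables (M : minuscule A) (M' : minuscule A') (g : M -> M').
Implicit Types (u v x y z : M) (i j k : I).

(** The map [g] is total and constrained only on [u, v]. Subintervals inherit the property with the
    same [g], so the inductions shrink the interval without building new maps. *)
Definition iso_on u v : Prop :=
  (forall x y, wle u x -> wle x v -> wle u y -> wle y v ->
     wle (g x) (g y) = wle x y) /\
  (forall z' : M', wle (g u) z' -> wle z' (g v) ->
     exists z, [/\ wle u z, wle z v & g z = z']).

Lemma iso_on_sub u v x y : iso_on u v ->
  wle u x -> wle x y -> wle y v -> iso_on x y.
Proof.
move=> [gle gsurj] ux xy yv.
have xv := wle_trans xy yv; have uy := wle_trans ux xy; have uv := wle_trans ux xv.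
split=> [a b xa ay xb yb|z' xz' z'y].
  by apply: gle; [apply: wle_trans xa|apply: wle_trans yv
                 |apply: wle_trans xb|apply: wle_trans yv].
have [||z [uz zv zE]] := gsurj z'.
- by apply: wle_trans xz'; rewrite gle ?wle_refl.
- by apply: wle_trans z'y _; rewrite gle ?wle_refl.
by exists z; rewrite -zE !gle // in xz' z'y; split.
Qed.

Lemma iso_on_inj u v x y : iso_on u v -> wle u x -> wle x v -> wle u y -> wle y v ->
  g x = g y -> x = y.
Proof.
move=> [gle _] ux xv uy yv E; apply: wle_anti; first by rewrite -gle ?E ?wle_refl.
by rewrite -gle ?E ?wle_refl.
Qed.

(** An atom of [g u, g (act k u)] pulls back to some z above u and below [act k u]; counting heights
    leaves only z = [act k u]. *)
Lemma iso_on_atom u v k : iso_on u v -> wt u k = 1 -> wle (act k u) v ->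
  exists2 k', wt (g u) k' = 1 & g (act k u) = act k' (g u).
Proof.
move=> giso uk kuv; have uku := wle_act_up uk; have uv := wle_trans uku kuv.
have [gle gsurj] := giso.
have le1 : wle (g u) (g (act k u)) by rewrite gle ?wle_refl.
have neq_ku : u != act k u by rewrite eq_sym act_neq ?uk.
have neq1 : g u != g (act k u).
  apply: contra neq_ku => /eqP E0; have E := iso_on_inj giso _ _ _ _ E0.
  by apply/eqP; apply: E; rewrite ?wle_refl.
have [k' uk' dk'] := atom_exists le1 neq1; exists k' => //.
have le2 := wle_actl le1 uk' dk'.
have [||z [uz zv zE]] := gsurj (act k' (g u)).
- exact: wle_act_up.
- by apply: wle_trans le2 _; rewrite gle ?wle_refl.
rewrite -zE; congr g; apply/esym.
have zku : wle z (act k u) by rewrite -gle // zE.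
have neq_zu : u != z.
  apply/eqP => E; have := act_neq (x := g u) (i := k').
  by rewrite uk' -zE -E eqxx => /(_ isT).
apply: (wle_height_eq zku).
by have := lt_height uz neq_zu; have := height_act k u; rewrite uk; lia.
Qed.

Lemma iso_on_coatom u v k : iso_on u v -> wt v k = -1 -> wle u (act k v) ->
  exists2 k', wt (g v) k' = -1 & g (act k v) = act k' (g v).
Proof.
move=> giso vk ukv; have kvv := wle_act_down vk.
have [||k' kvk' E] := iso_on_atom (k := k) (iso_on_sub giso ukv kvv (wle_refl v)).
- by rewrite wt_actK vk.
- by rewrite actK wle_refl.
by rewrite actK in E; exists k'; rewrite E ?actK // wt_actK kvk'.
Qed.

Lemma iso_on_height u v : iso_on u v -> wle u v ->
  (height (g v) + height u = height (g u) + height v)%N.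
Proof.
have [n] := ubnP (height v - height u).
elim: n u => // n IHn u lt_vn giso uv.
have [->|neq_uv] := eqVneq u v; first by rewrite addnC.
have [i ui di] := atom_exists uv neq_uv; have iuv := wle_actl uv ui di.
have [i' ui' gE] := iso_on_atom giso ui iuv.
have := wle_height iuv.
have := height_act i u; have := height_act i' (g u); rewrite ui ui'.
have := IHn (act i u) _ (iso_on_sub giso (wle_act_up ui) iuv (wle_refl v)) iuv.
by rewrite gE; lia.
Qed.

End Iso.

Section Labels.
Variables (I : finType) (A : I -> I -> int) (M : minuscule A).
Implicit Types (u v x y z : M) (i j k : I).

Lemma act_label_inj x i j : wt x i != 0 -> act i x = act j x -> i = j.
Proof.
move=> xi E; apply/eqP; apply: contraNT xi => ij.
have := dep_act i x i; have := dep_act j x i.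
by rewrite E eqxx eq_sym (negbTE ij); lia.
Qed.

(** Opposite edges of a square carry the same label: the path through [act i x] raises the
    coefficient at [i], so the path through [act k x] must raise it too. *)
Lemma act_square x i k a b : wt x i = 1 -> wt x k = 1 ->
  wt (act i x) a = 1 -> wt (act k x) b = 1 -> i != k ->
  act a (act i x) = act b (act k x) -> b = i.
Proof.
move=> xi xk xa xb ik E; apply/eqP; apply: contraNT ik => bi; apply/eqP.
have := dep_act a (act i x) i; have := dep_act b (act k x) i.
have := dep_act i x i; have := dep_act k x i.
rewrite E xi xk xa xb (negbTE bi) eqxx; case: eqP => [->//|_].
by case: eqP; lia.
Qed.

End Labels.

(** * Transport of pairings and Cartan entries *)

Section Invariance.
Variables (I I' : finType) (A : I -> I -> int) (A' : I' -> I' -> int).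
Variables (M : minuscule A) (M' : minuscule A') (g : M -> M').
Implicit Types (u v x y z : M) (i j k : I).

(** At [act j v] the pairing with [j] is 1 on both sides, and every step [act k] of a chain from z
    changes it by the entry [A k j]. Equality of the entries is a hypothesis because the lemma is
    used inside the induction proving [cartan_iso], where only shorter intervals are available. *)
Lemma wt_iso_down u v x j (j' : I') : iso_on g u v -> wle u x -> wle x (act j v) ->
  wt v j = -1 -> wt (g v) j' = -1 -> g (act j v) = act j' (g v) ->
  (forall z k (k' : I'), wle x z -> wt z k = 1 -> wle (act k z) (act j v) ->
     wt (g z) k' = 1 -> g (act k z) = act k' (g z) -> A k j = A' k' j') ->
  forall z, wle x z -> wle z (act j v) -> wt z j = wt (g z) j'.
Proof.
move=> giso ux xjv vj vj' gjv H z; have [n] := ubnP (height v - height z).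
elim: n z => // n IHn z lt_n xz zjv.
have [->|neq_z] := eqVneq z (act j v).
  by rewrite gjv !wt_actK vj vj'.
have [k zk dk] := atom_exists zjv neq_z; have kzjv := wle_actl zjv zk dk.
have jvv := wle_act_down vj; have zkz := wle_act_up zk.
have [k' gzk gkz] := iso_on_atom
  (iso_on_sub giso (wle_trans ux xz) zjv jvv) zk kzjv.
have Akj := H z k k' xz zk kzjv gzk gkz.
have := height_act k z; have := wle_height kzjv; have := wle_height jvv.
rewrite zk => h1 h2 h3.
have := IHn (act k z); rewrite gkz !wt_act zk gzk Akj => E.
have : wt z j - 1 * A' k' j' = wt (g z) j' - 1 * A' k' j'.
  by apply: E => //; [lia | apply: wle_trans zkz].
by lia.
Qed.

Lemma wt_iso_up u v y i (i' : I') : iso_on g u v -> wle (act i u) y -> wle y v ->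
  wt u i = 1 -> wt (g u) i' = 1 -> g (act i u) = act i' (g u) ->
  (forall z k (k' : I'), wle z y -> wt z k = -1 -> wle (act i u) (act k z) ->
     wt (g z) k' = -1 -> g (act k z) = act k' (g z) -> A k i = A' k' i') ->
  forall z, wle (act i u) z -> wle z y -> wt z i = wt (g z) i'.
Proof.
move=> giso iuy yv ui ui' giu H z; have [n] := ubnP (height z).
elim: n z => // n IHn z lt_n iuz zy.
have [<-|neq_z] := eqVneq (act i u) z.
  by rewrite giu !wt_actK ui ui'.
have [k zk dk] := coatom_exists iuz neq_z; have iukz := wle_actr iuz zk dk.
have uiu := wle_act_up ui; have kzz := wle_act_down zk.
have [k' gzk gkz] := iso_on_coatom
  (iso_on_sub giso uiu iuz (wle_trans zy yv)) zk iukz.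
have Aki := H z k k' zy zk iukz gzk gkz.
have := height_act k z; rewrite zk => h1.
have := IHn (act k z); rewrite gkz !wt_act zk gzk Aki => E.
have : wt z i - -1 * A' k' i' = wt (g z) i' - -1 * A' k' i'.
  by apply: E => //; [lia | apply: wle_trans zy].
by lia.
Qed.

End Invariance.

Section Cartan.
Variables (I : finType) (A : I -> I -> int) (M : minuscule A).
Hypothesis slA : simply_laced A.
Implicit Types (u v x y z : M) (i j k : I).

(* An interval with a single atom i and a single coatom j: the three values of
   A i j lead to disjoint sets of pairs (wt (act i u) j, wt (act j v) i). *)
Definition cartan_of_ends (a b : int) : int :=
  if (a == -1) && (b == 1) then 2
  else if (a == 1) || (b == -1) then -1 else 0.

Lemma cartan_of_endsE u v i j : wt u i = 1 -> wt v j = -1 ->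
  wle (act i u) (act j v) ->
  (forall k, wt u k = 1 -> (dep u k < dep v k)%N -> k = i) ->
  (forall k, wt v k = -1 -> (dep u k < dep v k)%N -> k = j) ->
  A i j = cartan_of_ends (wt (act i u) j) (wt (act j v) i).
Proof.
move=> ui vj iujv uatom vatom.
have uiu := wle_act_up ui; have jvv := wle_act_down vj.
have uv := wle_trans uiu (wle_trans iujv jvv).
have dj : (dep u j < dep v j)%N.
  have /wleP /(_ j) := iujv; have := dep_act j v j; rewrite eqxx vj.
  by have := dep_act i u j; rewrite ui; case: eqP; lia.
have di : (dep u i < dep v i)%N.
  have /wleP /(_ i) := iujv; have := dep_act i u i; rewrite eqxx ui.
  by have := dep_act j v i; rewrite vj; case: eqP; lia.
have neq_uv : u != v by apply/eqP => E; rewrite E ltnn in di.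
rewrite !wt_act ui vj.
have [E|ij] := eqVneq i j.
  by move: vj ui; rewrite -E => vi ui; rewrite ui vi (cartan_diag M).
have uj : wt u j <> 1 by move=> uj; case/eqP: ij; apply/esym/uatom.
have vi : wt v i <> -1 by move=> vi; case/eqP: ij; apply/vatom.
(* With one atom and one coatom the corner has label i or j, which excludes [wt u j = -1] together
   with [wt v i = 1]. That combination would show the end values of the entry 2 when [A i j] is 0,
   and those of the entry 0 when it is -1. *)
have [k dk kP] := wle_corner uv neq_uv.
have {k dk kP} corner : ~ (wt u j = -1 /\ wt v i = 1).
  case=> uj1 vi1; case: kP => -[k1 k2].
    by have E := uatom k k1 dk; rewrite E vi1 in k2.
  by have E := vatom k k1 dk; rewrite E uj1 in k2.
rewrite /cartan_of_ends; case: (slA ij) => -[-> Aji]; rewrite Aji.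
  by case: (wtP u j) uj corner => -> // uj corner;
    case: (wtP v i) vi corner => -> // vi corner; case: corner.
have uj' : wt u j <= 0.
  by case: (wtP u j) uj => ->.
by case: (wtP u j) uj corner => -> // uj corner;
    case: (wtP v i) vi corner => -> // vi corner; case: corner.
Qed.

End Cartan.

Section Cosquare.
Variables (I : finType) (A : I -> I -> int) (M : minuscule A).
Implicit Types (u v x y z : M) (i j k : I).

Lemma act_cosquare x i k a b : wt x i = -1 -> wt x k = -1 ->
  wt (act i x) a = -1 -> wt (act k x) b = -1 -> i != k ->
  act a (act i x) = act b (act k x) -> b = i.
Proof.
move=> xi xk xa xb ik E; apply/eqP; apply: contraNT ik => bi; apply/eqP.
have := dep_act a (act i x) i; have := dep_act b (act k x) i.
have := dep_act i x i; have := dep_act k x i.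
rewrite E xi xk xa xb (negbTE bi) eqxx; case: eqP => [->//|_].
by case: eqP; lia.
Qed.

Lemma dep_act_neq u i k : k != i -> dep (act k u) i = dep u i.
Proof. by move=> ki; have := dep_act k u i; rewrite (negbTE ki); lia. Qed.

Lemma dep_act_up u i : wt u i = 1 -> dep (act i u) i = (dep u i).+1.
Proof. by move=> ui; have := dep_act i u i; rewrite eqxx ui; lia. Qed.

Lemma dep_act_down v j : wt v j = -1 -> dep v j = (dep (act j v) j).+1.
Proof. by move=> vj; have := dep_act j v j; rewrite eqxx vj; lia. Qed.

Lemma wle_two u v i j : i != j -> wt u i = 1 -> wt v j = -1 ->
  wle (act i u) v -> wle u (act j v) -> wle (act i u) (act j v).
Proof.
move=> ij ui vj /wleP iuv /wleP ujv; apply/wleP => l.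
have := iuv l; have := ujv l; have := dep_act i u l; have := dep_act j v l.
by rewrite ui vj; case: eqP => [<-|_]; rewrite ?(negbTE ij); lia.
Qed.

End Cosquare.

Section IsoLabels.
Variables (I I' : finType) (A : I -> I -> int) (A' : I' -> I' -> int).
Variables (M : minuscule A) (M' : minuscule A') (g : M -> M').
Implicit Types (u v x y z : M) (i j k : I).

Lemma iso_on_atom_inv u v (k' : I') : iso_on g u v -> wle u v ->
  wt (g u) k' = 1 -> wle (act k' (g u)) (g v) ->
  exists2 k, wt u k = 1 & wle (act k u) v /\ g (act k u) = act k' (g u).
Proof.
move=> giso uv guk k'uv; have [gle gsurj] := giso.
have [z [uz zv gz]] := gsurj _ (wle_act_up guk) k'uv.
have neq_uz : u != z.
  apply/eqP => E; have := act_neq (x := g u) (i := k').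
  by rewrite guk -gz -E eqxx => /(_ isT).
have [k uk dk] := atom_exists uz neq_uz; have kuz := wle_actl uz uk dk.
have kuv := wle_trans kuz zv; exists k => //; split=> //.
have [k1 guk1 gk] := iso_on_atom giso uk kuv.
have uku := wle_act_up uk.
rewrite -gz; apply: wle_height_eq; first by rewrite gle.
have := height_act k' (g u); have := height_act k1 (g u).
by rewrite gz gk guk guk1; lia.
Qed.

Lemma iso_on_coatom_inv u v (k' : I') : iso_on g u v -> wle u v ->
  wt (g v) k' = -1 -> wle (g u) (act k' (g v)) ->
  exists2 k, wt v k = -1 & wle u (act k v) /\ g (act k v) = act k' (g v).
Proof.
move=> giso uv gvk uk'v; have [gle gsurj] := giso.
have [z [uz zv gz]] := gsurj _ uk'v (wle_act_down gvk).
have neq_zv : z != v.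
  apply/eqP => E; have := act_neq (x := g v) (i := k').
  by rewrite gvk -gz E eqxx => /(_ isT).
have [k vk dk] := coatom_exists zv neq_zv; have zkv := wle_actr zv vk dk.
have ukv := wle_trans uz zkv; exists k => //; split=> //.
have [k1 gvk1 gk] := iso_on_coatom giso vk ukv.
have kvv := wle_act_down vk.
rewrite -gz; apply/esym/wle_height_eq; first by rewrite gle.
have := height_act k' (g v); have := height_act k1 (g v).
by rewrite gz gk gvk gvk1; lia.
Qed.

Lemma iso_on_label u v i (i' : I') k (k' : I') : iso_on g u v ->
  wt u i = 1 -> wt (g u) i' = 1 -> g (act i u) = act i' (g u) ->
  wt u k = 1 -> wt (g u) k' = 1 -> g (act k u) = act k' (g u) ->
  wle (act i u) v -> wle (act k u) v -> (i' == k') = (i == k).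
Proof.
move=> giso ui gui gi uk guk gk iv kv.
have uu := wle_refl u; have iu := wle_act_up ui; have ku := wle_act_up uk.
apply/eqP/eqP => [E|E]; last first.
  by apply: (act_label_inj (x := g u)); rewrite ?gui // -gi -gk E.
apply: (act_label_inj (x := u)); rewrite ?ui //.
by apply: (iso_on_inj giso) => //; rewrite gi gk E.
Qed.

Lemma iso_on_colabel u v j (j' : I') k (k' : I') : iso_on g u v ->
  wt v j = -1 -> wt (g v) j' = -1 -> g (act j v) = act j' (g v) ->
  wt v k = -1 -> wt (g v) k' = -1 -> g (act k v) = act k' (g v) ->
  wle u (act j v) -> wle u (act k v) -> (j' == k') = (j == k).
Proof.
move=> giso vj gvj gj vk gvk gk uj uk.
have vv := wle_refl v; have jv := wle_act_down vj; have kv := wle_act_down vk.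
apply/eqP/eqP => [E|E]; last first.
  by apply: (act_label_inj (x := g v)); rewrite ?gvj // -gj -gk E.
apply: (act_label_inj (x := v)); rewrite ?vj //.
by apply: (iso_on_inj giso) => //; rewrite gj gk E.
Qed.

Lemma iso_on_label_eq u v i (i' : I') j (j' : I') : iso_on g u v ->
  wt u i = 1 -> wt v j = -1 -> wle (act i u) v -> wle u (act j v) ->
  wt (g u) i' = 1 -> g (act i u) = act i' (g u) ->
  wt (g v) j' = -1 -> g (act j v) = act j' (g v) ->
  ~~ wle (act i u) (act j v) -> i = j /\ i' = j'.
Proof.
move=> [gle _] ui vj iuv ujv gui gi gvj gj nle.
have uiu := wle_act_up ui; have jvv := wle_act_down vj.
have uv := wle_trans uiu iuv.
split; apply/eqP; apply: contraNT nle => neq; first exact: wle_two.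
rewrite -gle // gi gj; apply: wle_two => //; first by rewrite -gi gle ?wle_refl.
by rewrite -gj gle ?wle_refl.
Qed.

Section CartanStep.
Variables (u v : M) (i j : I) (i' j' : I').
Hypotheses (giso : iso_on g u v) (ui : wt u i = 1) (vj : wt v j = -1).
Hypotheses (iujv : wle (act i u) (act j v)) (gui : wt (g u) i' = 1).
Hypotheses (gi : g (act i u) = act i' (g u)) (gvj : wt (g v) j' = -1).
Hypotheses (gj : g (act j v) = act j' (g v)).

Let uiu := wle_act_up ui.
Let jvv := wle_act_down vj.
Let ujv := wle_trans uiu iujv.
Let iuv := wle_trans iujv jvv.
Let uv := wle_trans ujv jvv.

(** A second atom k moves the question to the shorter interval [act k u, v]: the square on i and k
    shows that [i'] still labels the image of the atom i there. If [act k u] is not below [act j v],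
    then k = j, and both entries vanish because they join two atoms. *)
Lemma cartan_iso_atom k : wt u k = 1 -> wle (act k u) v -> k != i ->
  (wt (act k u) i = 1 -> wle (act i (act k u)) (act j v) ->
   wt (g (act k u)) i' = 1 ->
   g (act i (act k u)) = act i' (g (act k u)) -> A i j = A' i' j') ->
  A i j = A' i' j'.
Proof.
move=> uk kuv ki IH.
have [k' guk gk] := iso_on_atom giso uk kuv.
have k'i' : k' != i'.
  by rewrite (iso_on_label giso uk guk gk ui gui gi).
have uku := wle_act_up uk.
have [kujv|nkujv] := boolP (wle (act k u) (act j v)); last first.
  have [kj k'j'] := iso_on_label_eq giso uk vj kuv ujv guk gk gvj gj nkujv.
  rewrite kj in uk ki; rewrite k'j' in guk k'i'.
  rewrite eq_sym in ki; rewrite eq_sym in k'i'.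
  by rewrite (wt1_A0 ki ui uk) (wt1_A0 k'i' gui guk).
have Aki : A k i = 0 by apply: (wt1_A0 ki uk ui).
have kui : wt (act k u) i = 1 by rewrite wt_act0.
have ikujv : wle (act i (act k u)) (act j v).
  apply: wle_actl => //; rewrite dep_act_neq //.
  by have /wleP/(_ i) := iujv; rewrite dep_act_up.
have kgiso := iso_on_sub giso uku kuv (wle_refl v).
have ikuv := wle_trans ikujv jvv.
have [b gkb gb] := iso_on_atom kgiso kui ikuv.
have iuk : wt (act i u) k = 1 by rewrite wt_act0 //; apply: (cartan_eq0 M).
have E : act i (act k u) = act k (act i u) by apply/esym/act_comm.
have kiuv : wle (act k (act i u)) v by rewrite -E.
have [a gia ga] := iso_on_atom (iso_on_sub giso uiu iuv (wle_refl v)) iuk kiuv.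
have bE : b = i'.
  apply: (@act_square _ _ _ (g u) i' k' a b) => //.
  - by rewrite -gi.
  - by rewrite -gk.
  - by rewrite eq_sym.
  - by rewrite -gi -gk -ga -gb E.
by rewrite bE in gkb gb; apply: IH.
Qed.

Lemma cartan_iso_coatom k : wt v k = -1 -> wle u (act k v) -> k != j ->
  (wt (act k v) j = -1 -> wle (act i u) (act j (act k v)) ->
   wt (g (act k v)) j' = -1 ->
   g (act j (act k v)) = act j' (g (act k v)) -> A i j = A' i' j') ->
  A i j = A' i' j'.
Proof.
move=> vk ukv kj IH.
have [k' gvk gk] := iso_on_coatom giso vk ukv.
have k'j' : k' != j'.
  by rewrite (iso_on_colabel giso vk gvk gk vj gvj gj).
have kvv := wle_act_down vk.
have [iukv|niukv] := boolP (wle (act i u) (act k v)); last first.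
  have [ik i'k'] := iso_on_label_eq giso ui vk iuv ukv gui gi gvk gk niukv.
  rewrite -ik in vk kj; rewrite -i'k' in gvk k'j'.
  by rewrite (wtN1_A0 kj vk vj) (wtN1_A0 k'j' gvk gvj).
have Akj : A k j = 0 by apply: (wtN1_A0 kj vk vj).
have kvj : wt (act k v) j = -1 by rewrite wt_act0.
have iujkv : wle (act i u) (act j (act k v)).
  apply: wle_actr => //; rewrite (@dep_act_neq _ _ _ v) //.
  by have /wleP/(_ j) := iujv; rewrite (dep_act_down vj).
have kgiso := iso_on_sub giso (wle_refl u) ukv kvv.
have ujkv := wle_trans uiu iujkv.
have [b gkb gb] := iso_on_coatom kgiso kvj ujkv.
have jvk : wt (act j v) k = -1 by rewrite wt_act0 //; apply: (cartan_eq0 M).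
have E : act j (act k v) = act k (act j v) by apply/esym/act_comm.
have ukjv : wle u (act k (act j v)) by rewrite -E.
have [a gia ga] := iso_on_coatom (iso_on_sub giso (wle_refl u) ujv jvv) jvk ukjv.
have bE : b = j'.
  apply: (@act_cosquare _ _ _ (g v) j' k' a b) => //.
  - by rewrite -gj.
  - by rewrite -gk.
  - by rewrite eq_sym.
  - by rewrite -gj -gk -ga -gb E.
by rewrite bE in gkb gb; apply: IH.
Qed.
End CartanStep.

Hypotheses (slA : simply_laced A) (slA' : simply_laced A').

Lemma cartan_iso u v i j (i' j' : I') : iso_on g u v ->
  wt u i = 1 -> wt v j = -1 -> wle (act i u) (act j v) ->
  wt (g u) i' = 1 -> g (act i u) = act i' (g u) ->
  wt (g v) j' = -1 -> g (act j v) = act j' (g v) ->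
  A i j = A' i' j'.
Proof.
have [n] := ubnP (height v - height u).
elim: n u v i j i' j' => // n IHn u v i j i' j' lt_n giso.
move=> ui vj iujv gui gi gvj gj.
have [gle gsurj] := giso.
have uiu := wle_act_up ui; have jvv := wle_act_down vj.
have ujv := wle_trans uiu iujv; have iuv := wle_trans iujv jvv.
have uv := wle_trans ujv jvv.
have h_iujv := wle_height iujv.
have hi := height_act i u; rewrite ui in hi.
have hj := height_act j v; rewrite vj in hj.
have [/existsP[k /and3P[/eqP uk kuv ki]]|/existsPn noatom] := boolP
    [exists k, [&& wt u k == 1, wle (act k u) v & k != i]].
  apply: (cartan_iso_atom giso ui vj iujv gui gi gvj gj uk kuv ki).
  move=> kui ikujv gkui gki; have uku := wle_act_up uk.
  have hk := height_act k u; rewrite uk in hk.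
  have lt_k : (height v - height (act k u) < n)%N.
    by move: lt_n h_iujv hi hj hk; clear; lia.
  apply: (IHn (act k u) v _ _ _ _ lt_k) => //.
  exact: iso_on_sub uku kuv (wle_refl v).
have [/existsP[k /and3P[/eqP vk ukv kj]]|/existsPn nocoatom] := boolP
    [exists k, [&& wt v k == -1, wle u (act k v) & k != j]].
  apply: (cartan_iso_coatom giso ui vj iujv gui gi gvj gj vk ukv kj).
  move=> kvj iujkv gkvj gkj; have kvv := wle_act_down vk.
  have hk := height_act k v; rewrite vk in hk.
  have lt_k : (height (act k v) - height u < n)%N.
    by move: lt_n h_iujv hi hj hk; clear; lia.
  apply: (IHn u (act k v) _ _ _ _ lt_k) => //.
  exact: iso_on_sub (wle_refl u) ukv kvv.
have guv : wle (g u) (g v) by rewrite gle ?wle_refl.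
have giujv : wle (act i' (g u)) (act j' (g v)) by rewrite -gi -gj gle.
rewrite (cartan_of_endsE slA ui vj iujv); first last.
- move=> k vk dk; have ukv := wle_actr uv vk dk.
  apply/eqP; apply: contraT => kj.
  by have := nocoatom k; rewrite vk eqxx ukv kj.
- move=> k uk dk; have kuv := wle_actl uv uk dk.
  apply/eqP; apply: contraT => ki.
  by have := noatom k; rewrite uk eqxx kuv ki.
rewrite (cartan_of_endsE slA' gui gvj giujv); first last.
- move=> k' vk' dk'; have uk'v := wle_actr guv vk' dk'.
  have [k vk [ukv gk]] := iso_on_coatom_inv giso uv vk' uk'v.
  apply/eqP; rewrite (iso_on_colabel giso vk vk' gk vj gvj gj) //.
  apply: contraT => kj.
  by have := nocoatom k; rewrite vk eqxx ukv kj.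
- move=> k' uk' dk'; have k'uv := wle_actl guv uk' dk'.
  have [k uk [kuv gk]] := iso_on_atom_inv giso uv uk' k'uv.
  apply/eqP; rewrite (iso_on_label giso uk uk' gk ui gui gi) //.
  apply: contraT => ki.
  by have := noatom k; rewrite uk eqxx kuv ki.
(* Both end pairings are sums of entries belonging to intervals [z, v] with z above the atom, or
   [u, z] with z below the coatom; these are shorter, so the induction hypothesis supplies them. *)
congr cartan_of_ends.
  rewrite -gi; apply: (wt_iso_down giso uiu iujv vj gvj gj) => //.
    move=> z k k' iuz zk kzjv gzk gzkE.
    have zv : wle z v by apply: wle_trans (wle_trans (wle_act_up zk) kzjv) jvv.
    have lt_z : (height v - height z < n)%N.
      by have := wle_height iuz; move: lt_n h_iujv hi hj; clear; lia.
    apply: (IHn z v _ _ _ _ lt_z) => //.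
    exact: iso_on_sub (wle_trans uiu iuz) zv (wle_refl v).
  exact: wle_refl.
rewrite -gj; apply: (wt_iso_up giso iujv jvv ui gui gi) => //.
  move=> z k k' zjv zk iukz gzk gzkE.
  have uz : wle u z.
    by apply: wle_trans uiu (wle_trans iukz (wle_act_down zk)).
  (* Transporting upwards involves the transposed entry; a simply laced matrix is symmetric. *)
  have -> : A k i = A i k by case: (eqVneq i k) => [->//|/slA[][-> ->]].
  have -> : A' k' i' = A' i' k' by case: (eqVneq i' k') => [->//|/slA'[][-> ->]].
  have lt_z : (height z - height u < n)%N.
    by have := wle_height zjv; move: lt_n h_iujv hi hj; clear; lia.
  apply: (IHn u z _ _ _ _ lt_z) => //.
  exact: iso_on_sub (wle_refl u) uz (wle_trans zjv jvv).
exact: wle_refl.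
Qed.

Lemma wt_iso_coatom u v j (j' : I') : iso_on g u v -> wt v j = -1 ->
  wle u (act j v) -> wt (g v) j' = -1 -> g (act j v) = act j' (g v) ->
  wt u j = wt (g u) j'.
Proof.
move=> giso vj ujv gvj gj; have jvv := wle_act_down vj.
apply: (wt_iso_down giso (wle_refl u) ujv vj gvj gj) => //; last exact: wle_refl.
move=> z k k' uz zk kzjv gzk gzkE.
have zv : wle z v by apply: wle_trans (wle_trans (wle_act_up zk) kzjv) jvv.
by apply: (cartan_iso (iso_on_sub giso uz zv (wle_refl v))).
Qed.

Lemma wt_iso_atom u v i (i' : I') : iso_on g u v -> wt u i = 1 ->
  wle (act i u) v -> wt (g u) i' = 1 -> g (act i u) = act i' (g u) ->
  wt v i = wt (g v) i'.
Proof.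
move=> giso ui iuv gui gi; have uiu := wle_act_up ui.
apply: (wt_iso_up giso iuv (wle_refl v) ui gui gi) => //; last exact: wle_refl.
move=> z k k' zv zk iukz gzk gzkE.
have uz : wle u z.
  by apply: wle_trans uiu (wle_trans iukz (wle_act_down zk)).
have -> : A k i = A i k by case: (eqVneq i k) => [->//|/slA[][-> ->]].
have -> : A' k' i' = A' i' k' by case: (eqVneq i' k') => [->//|/slA'[][-> ->]].
by apply: (cartan_iso (iso_on_sub giso (wle_refl u) uz zv)).
Qed.

Variables (R : M -> M -> {poly int}) (R' : M' -> M' -> {poly int}).
Hypotheses (RP : R_system R) (RP' : R_system R').

Theorem R_iso u v : iso_on g u v -> wle u v -> R u v = R' (g u) (g v).
Proof.
have [_ Ruu Rrec] := RP; have [R'le R'uu R'rec] := RP'; have [Rle _ _] := RP.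
have [n] := ubnP (height v - height u).
elim: n u v => // n IHn u v lt_n giso uv; have [gle _] := giso.
have [<-|neq_uv] := eqVneq u v; first by rewrite Ruu R'uu.
have hlt := lt_height uv neq_uv.
have [i di ci] := wle_corner uv neq_uv.
have [ui|ui] := eqVneq (wt u i) 1; last first.
  have {ci} [vi ui0] : wt v i = -1 /\ wt u i = 0.
    case: ci => -[H1 H2]; first by rewrite H1 in ui.
    by split=> //; case: (wtP u i) ui H2 => ->.
  have uiv := wle_actr uv vi di; have ivv := wle_act_down vi.
  have [i' gvi gi] := iso_on_coatom giso vi uiv.
  have gui : wt (g u) i' = 0 by rewrite -(wt_iso_coatom giso vi uiv gvi gi).
  have [_ E _] := Rrec u v i vi; have [_ E' _] := R'rec (g u) _ _ gvi.
  rewrite {}E // {}E' //.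
  have hi := height_act i v; rewrite vi in hi.
  rewrite -gi IHn //; first by lia.
  exact: iso_on_sub (wle_refl u) uiv ivv.
have iuv := wle_actl uv ui di; have uiu := wle_act_up ui.
have [i' gui gi] := iso_on_atom giso ui iuv.
have hi := height_act i u; rewrite ui in hi.
have IHi : R (act i u) v = R' (act i' (g u)) (g v).
  rewrite -gi IHn //; first by have := wle_height iuv; lia.
  exact: iso_on_sub uiu iuv (wle_refl v).
have gvi := wt_iso_atom giso ui iuv gui gi.
(* Here the recursion has no descent at [i]; the dual recursion removes the atom instead. *)
have [vi0|vi0] := eqVneq (wt v i) 0.
  by rewrite (R_bottom RP slA ui vi0) (R_bottom RP' slA' gui) -?gvi // IHi.
have {ci} vi : wt v i = -1.
  by case: ci => -[H1 H2] //; case: (wtP v i) vi0 H2 => ->.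
rewrite vi in gvi; symmetry in gvi.
have uiv := wle_actr uv vi di; have ivv := wle_act_down vi.
(* The atom and the coatom labelled i must get a common label. If the atom is below the coatom,
   [cartan_iso] gives an entry equal to [A i i] = 2, and off-diagonal entries are at most 0. *)
have gE : g (act i v) = act i' (g v).
  have [j' gvj gj] := iso_on_coatom giso vi uiv.
  suff -> : i' = j' by [].
  have [iuiv|niuiv] := boolP (wle (act i u) (act i v)); last first.
    by have [] := iso_on_label_eq giso ui vi iuv uiv gui gi gvj gj niuiv.
  have Aii := cartan_iso giso ui vi iuiv gui gi gvj gj.
  apply/eqP; apply: contraT => neq; have := cartan_offdiag M' neq.
  by rewrite -Aii (cartan_diag M).
have [_ _ E] := Rrec u v i vi; have [_ _ E'] := R'rec (g u) _ _ gvi.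
rewrite {}E // {}E' //.
have hvi := height_act i v; rewrite vi in hvi.
congr (_ * _ + _ * _).
  rewrite -gE IHn //; first by lia.
  exact: iso_on_sub (wle_refl u) uiv ivv.
rewrite -gE -gi; have [iuiv|niuiv] := boolP (wle (act i u) (act i v)).
  rewrite IHn //; first by have := wle_height iuiv; lia.
  exact: iso_on_sub uiu iuiv ivv.
by rewrite Rle // R'le // gle.
Qed.

End IsoLabels.

(** * Relative Kazhdan-Lusztig polynomials *)

Definition KL_system (I : finType) (A : I -> I -> int) (M : minuscule A)
    (R P : M -> M -> {poly int}) : Prop :=
  [/\ forall u, P u u = 1,
      forall u v, wle u v -> u != v ->
        ((size (P u v)).-1.*2 < height v - height u)%N &
      forall u v, wle u v -> reciprocal (height v - height u) (P u v) =
        \sum_(z | wle u z && wle z v) R u z * P z v].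

(** Below degree d/2 the reciprocal has no coefficients, so the difference shows -p there, and p
    lives only there. This is the uniqueness argument for Kazhdan-Lusztig polynomials. *)
Lemma reciprocal_sub_inj (d : nat) (p q : {poly int}) :
  ((size p).-1.*2 < d)%N -> ((size q).-1.*2 < d)%N ->
  reciprocal d p - p = reciprocal d q - q -> p = q.
Proof.
move=> sp sq E; apply/polyP => k.
have coef_big (r : {poly int}) l :
    ((size r).-1.*2 < d)%N -> (d <= l.*2)%N -> r`_l = 0.
  move=> sr dl; apply: nth_default.
  by case: (size r) sr => // n; rewrite /= -!addnn => sr; lia.
have [kd|kd] := leqP d k.*2; first by rewrite !coef_big.
have := congr1 (fun r : {poly int} => r`_k) E.
rewrite !coefB !coef_poly; have -> : (k < d.+1)%N by lia.
have dk : (d <= (d - k).*2)%N by lia.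
by rewrite (coef_big p _ sp dk) (coef_big q _ sq dk) !sub0r => /oppr_inj.
Qed.

Section KLIso.
Variables (I I' : finType) (A : I -> I -> int) (A' : I' -> I' -> int).
Variables (M : minuscule A) (M' : minuscule A') (g : M -> M').
Hypotheses (slA : simply_laced A) (slA' : simply_laced A').
Variables (R P : M -> M -> {poly int}) (R' P' : M' -> M' -> {poly int}).
Hypotheses (RP : R_system R) (RP' : R_system R').
Hypotheses (PP : KL_system R P) (PP' : KL_system R' P').

Theorem KL_iso u v : iso_on g u v -> wle u v -> P u v = P' (g u) (g v).
Proof.
have [Puu Psize Prec] := PP; have [P'uu P'size P'rec] := PP'.
have [n] := ubnP (height v - height u).
elim: n u v => // n IHn u v lt_n giso uv; have [gle gsurj] := giso.
have [<-|neq_uv] := eqVneq u v; first by rewrite Puu P'uu.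
have guv : wle (g u) (g v) by rewrite gle ?wle_refl.
have gneq_uv : g u != g v.
  apply: contra neq_uv => /eqP E; apply/eqP.
  by apply: (iso_on_inj giso) E; rewrite ?wle_refl.
have hE : (height (g v) - height (g u) = height v - height u)%N.
  have := iso_on_height giso uv; have := wle_height uv; have := wle_height guv.
  by lia.
have ss := Psize u v uv neq_uv; have ss' := P'size _ _ guv gneq_uv.
rewrite hE in ss'; apply: (reciprocal_sub_inj ss ss').
rewrite Prec // -[in RHS]hE P'rec //.
have [_ Ruu _] := RP; have [_ R'uu _] := RP'.
(* The term z = u is P u v itself and cancels on the left; the remaining sum involves only P z v
   with z above u, known by induction. *)
rewrite (bigD1 u) ?wle_refl //= Ruu mul1r addrAC subrr add0r.
rewrite (bigD1 (g u)) ?wle_refl //= R'uu mul1r addrAC subrr add0r.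
pose D := [set z | (wle u z && wle z v) && (z != u)].
have inD z : z \in D -> [/\ wle u z, wle z v & z != u].
  by rewrite inE => /andP[/andP[]].
have ginj : {in D &, injective g}.
  by move=> x y /inD[ux xv _] /inD[uy yv _]; apply: (iso_on_inj giso).
rewrite (eq_bigl (mem D)) => [|z]; last by rewrite !inE.
rewrite [RHS](eq_bigl (mem (g @: D))) => [|z']; last first.
  apply/andP/imsetP => [[/andP[uz' z'v] neq]|[z /inD[uz zv neq] ->]].
    have [z [uz zv gz]] := gsurj z' uz' z'v; exists z => //.
    by rewrite inE uz zv; apply: contraNneq neq => <-; rewrite gz.
  rewrite !gle ?wle_refl // uz zv; split=> //; apply: contra neq => /eqP E.
  by apply/eqP; apply: (iso_on_inj giso) E; rewrite ?wle_refl.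
rewrite big_imset //; apply: eq_bigr => z /inD[uz zv neq_zu].
rewrite (R_iso slA slA' RP RP' (iso_on_sub giso (wle_refl u) uz zv) uz).
rewrite IHn //; last exact: iso_on_sub uz zv (wle_refl v).
have := lt_height uz; rewrite eq_sym => /(_ neq_zu).
by have := wle_height zv; lia.
Qed.
End KLIso.

Local Close Scope ring_scope.

(** * The exchange condition *)

Section Coxeter.
Local Open Scope group_scope.
Variables (X : cartan_type) (W : weyl_group X).
Implicit Types (u v w r x y : W) (i j : 'I_(rank X)) (ks : seq 'I_(rank X)).

Local Notation s := (simple W).

Definition word ks : W := \prod_(i <- ks) s i.

Lemma simpleK i : s i * s i = 1.
Proof.
have := simple_rel W i i; rewrite /coxeter_matrix eqxx.
by rewrite -[X in X = 1]/((s i * s i)%g).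
Qed.

Lemma simpleV i : (s i)^-1 = s i.
Proof. by apply/eqP; rewrite eq_invg_mul simpleK. Qed.

Lemma simpleKl i w : s i * (s i * w) = w.
Proof. by rewrite mulgA simpleK mul1g. Qed.

Lemma word_nil : word [::] = 1.
Proof. by rewrite /word big_nil. Qed.

Lemma word_cons i ks : word (i :: ks) = s i * word ks.
Proof. by rewrite /word big_cons. Qed.

Lemma word_cat ks ls : word (ks ++ ls) = word ks * word ls.
Proof. by rewrite /word big_cat. Qed.

Lemma word_rev ks : word (rev ks) = (word ks)^-1.
Proof.
elim: ks => [|i ks IH]; first by rewrite word_nil invg1.
by rewrite rev_cons -cats1 word_cat IH !word_cons word_nil mulg1 invMg simpleV.
Qed.

Lemma len_word ks : (len (word ks) <= size ks)%N.
Proof.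
rewrite /len; case: ex_minnP => m _; apply.
by apply/existsP; exists (in_tuple ks).
Qed.

Lemma reduced_word w : exists2 ks, word ks = w & size ks = len w.
Proof.
rewrite /len; case: ex_minnP => m /existsP[t /eqP wE] _.
by exists t; rewrite ?size_tuple.
Qed.

Lemma word_ind (P : W -> Prop) :
  P 1 -> (forall i w, P w -> P (s i * w)) -> forall w, P w.
Proof.
move=> P1 Ps w; have [ks <- _] := reduced_word w.
by elim: ks => [|i ks IH]; rewrite ?word_nil // word_cons; apply: Ps.
Qed.

Lemma len_simple i w : (len (s i * w) <= (len w).+1)%N.
Proof.
by have [ks <- <-] := reduced_word w; rewrite -word_cons; apply: len_word.
Qed.

Lemma lenV w : len w^-1 = len w.
Proof.
have le x : (len x^-1 <= len x)%N.
  have [ks <- <-] := reduced_word x.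
  by rewrite -word_rev -[X in (_ <= X)%N]size_rev; apply: len_word.
by apply/eqP; rewrite eqn_leq le -{1}[w]invgK le.
Qed.

Lemma len1 : len (1 : W) = 0%N.
Proof. by apply/eqP; rewrite -leqn0 -word_nil; apply: (len_word [::]). Qed.

(** Sign character: sending every generator to the transposition of [bool] respects the relations,
    so the parity of the length is a homomorphism. *)
Lemma len_simple_neq i w : len (s i * w) != len w.
Proof.
have [|f fM fs] := @simple_univ _ W {perm bool} (fun=> tperm true false).
  by move=> a b; rewrite tperm2 expg1n.
have f1 : f 1 = 1.
  by apply: (mulgI (f 1)); rewrite -fM !mulg1.
have fword ks : f (word ks) = tperm true false ^+ size ks.
  elim: ks => [|k ks IH]; first by rewrite word_nil expg0.
  by rewrite word_cons fM fs IH -expgS.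
have flen x : f x = tperm true false ^+ len x.
  by have [ks <- <-] := reduced_word x.
apply/negP => /eqP E; have := flen (s i * w).
rewrite E fM fs -flen => H.
have /permP/(_ true) : tperm true false = 1 :> {perm bool}.
  by apply: (mulIg (f w)); rewrite mul1g.
by rewrite tpermL perm1.
Qed.

(* These involutions of W * bool satisfy the Coxeter relations; the induced
   action of W counts the left inversions of a word modulo 2. *)

Definition flip i (a : W * bool) : W * bool :=
  (a.1 ^ s i, a.2 (+) (a.1 == s i)).

Lemma flipE i r e : flip i (r, e) = (r ^ s i, e (+) (r == s i)).
Proof. by []. Qed.

Lemma flipK i : involutive (flip i).
Proof.
case=> r e; rewrite !flipE -conjgM simpleK conjg1.
have -> : (r ^ s i == s i) = (r == s i).
  by rewrite -[RHS](inj_eq (conjg_inj (s i))) [s i ^ s i]conjgE mulKg.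
by rewrite -addbA addbb addbF.
Qed.

Definition flip_perm i : {perm W * bool} := perm (can_inj (flipK i)).

Lemma conj_simple_eq x y i : (x ^ s i == y) = (x == y ^ s i).
Proof. by apply/eqP/eqP => [<-|->]; rewrite -conjgM simpleK conjg1. Qed.

(** The element s_i inverts g = s_i s_j, hence conjugates of s_i by powers of g are again of the
    form g^l s_i. Even l arise here, odd l in [conj_iterS]. *)
Lemma conj_iter i j r k :
  (r ^ ((s i * s j) ^+ k) == s i) = (r == (s i * s j) ^+ k.*2 * s i).
Proof.
set g := s i * s j.
have gV : s i * g^-1 = g * s i by rewrite /g invMg !simpleV mulgA.
have sgV l : s i * (g ^+ l)^-1 = g ^+ l * s i.
  rewrite -expgVn; elim: l => [|l IH]; first by rewrite !expg0 mulg1 mul1g.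
  by rewrite expgS mulgA gV -mulgA IH mulgA -expgS.
rewrite -(inj_eq (conjg_inj (g ^+ k)^-1)) conjgK; congr (r == _).
by rewrite conjgE invgK sgV mulgA -expgD addnn.
Qed.

Lemma conj_iterS i j r k :
  ((r ^ ((s i * s j) ^+ k)) ^ s i == s j) = (r == (s i * s j) ^+ k.*2.+1 * s i).
Proof.
set g := s i * s j.
have gV : s i * g^-1 = g * s i by rewrite /g invMg !simpleV mulgA.
have sgV l : s i * (g ^+ l)^-1 = g ^+ l * s i.
  rewrite -expgVn; elim: l => [|l IH]; first by rewrite !expg0 mulg1 mul1g.
  by rewrite expgS mulgA gV -mulgA IH mulgA -expgS.
have gE : s i * (s j * s i) = g * s i by rewrite mulgA.
rewrite conj_simple_eq; clearbody g.
rewrite -(inj_eq (conjg_inj (g ^+ k)^-1)) conjgK; congr (r == _).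
rewrite [s j ^ s i]conjgE simpleV conjgE invgK.
by rewrite gE -(mulgA g) sgV !mulgA -expgSr -expgD addSn addnn.
Qed.

Lemma flip_perm_iter i j k r e :
  ((flip_perm i * flip_perm j) ^+ k) (r, e) =
  (r ^ ((s i * s j) ^+ k),
   e (+) odd (\sum_(l < k.*2) (r == (s i * s j) ^+ l * s i)%g)).
Proof.
elim: k => [|k IH]; first by rewrite !expg0 perm1 conjg1 big_ord0 addbF.
rewrite expgSr permM IH permM !permE !flipE.
rewrite conj_iter conj_iterS -!conjgM -expgSr.
rewrite doubleS !big_ord_recr /= !oddD !oddb !addbA.
by [].
Qed.

(** In m rounds l runs over 2m values, and g^m = 1 makes the second half repeat the first: each
    reflection is counted an even number of times. *)
Lemma flip_perm_rel i j :
  (flip_perm i * flip_perm j) ^+ coxeter_matrix i j = 1.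
Proof.
apply/permP => -[r e]; rewrite flip_perm_iter perm1 simple_rel conjg1.
set m := coxeter_matrix i j; rewrite -addnn big_split_ord /=.
under [X in (_ + X)%N]eq_bigr => l _ do rewrite expgD simple_rel mul1g.
by rewrite addnn odd_double addbF.
Qed.

(** [N w r] is the parity of the number of times r occurs among the left inversions of a word of w;
    the universal property makes it independent of the word. *)
Lemma inversion_cocycle : exists N : W -> W -> bool,
  [/\ forall r, N 1 r = false, forall i r, N (s i) r = (r == s i) &
      forall x y r, N (x * y) r = N x r (+) N y (r ^ x)].
Proof.
have [f fM fs] := @simple_univ _ W {perm W * bool} _ flip_perm_rel.
pose N w r := (f w (r, false)).2.
have f1 : f 1 = 1 by apply: (mulgI (f 1)); rewrite -fM !mulg1.
have fE w r e : f w (r, e) = (r ^ w, e (+) N w r).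
  rewrite /N; elim/word_ind: w r e => [|i w IH] r e.
    by rewrite f1 !perm1 conjg1 addbF.
  rewrite fM !permM fs !permE !flipE (IH _ (e (+) _)) (IH _ (_ (+) _)) /=.
  by rewrite conjgM addbA.
exists N; split=> [r|i r|x y r]; first by rewrite /N f1 perm1.
  by rewrite /N fs permE.
by rewrite /N fM permM !fE /=.
Qed.

Lemma reflectionsP r : reflect (exists i x, r = s i ^ x) (r \in reflections W).
Proof.
apply: (iffP imset2P) => [[i x _ _ ->]|[i [x ->]]]; first by exists i, x.
by exists i x.
Qed.

Lemma reflectionK r : r \in reflections W -> r * r = 1.
Proof. by case/reflectionsP=> i [x ->]; rewrite -conjMg simpleK conj1g. Qed.

(** If [N w r] holds, r is a left inversion of every word of w, reduced or not, and multiplying by r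
    deletes a letter. Since [N r r] holds, exactly one of w and rw has r as an inversion; were it
    rw, then w would be the shorter one. *)
Lemma strong_exchange r ks : r \in reflections W ->
  (len (r * word ks) < len (word ks))%N ->
  exists k1 i k2, ks = k1 ++ i :: k2 /\ r * word ks = word (k1 ++ k2).
Proof.
move=> rR; have [N [N1 Ns NM]] := inversion_cocycle.
have Nword ls q : N (word ls) q ->
    exists k1 i k2, ls = k1 ++ i :: k2 /\ q * word ls = word (k1 ++ k2).
  elim: ls q => [|i ls IH] q; first by rewrite word_nil N1.
  rewrite word_cons NM Ns; have [->|_] := eqVneq q (s i).
    by move=> _; exists nil, i, ls; rewrite simpleKl.
  rewrite addFb => /IH[k1 [k [k2 [-> E]]]].
  exists (i :: k1), k, k2; split=> //=; rewrite word_cons -E.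
  by rewrite conjgE simpleV !mulgA simpleK mul1g.
have Nr : N r r.
  case/reflectionsP: rR => i [x ->].
  have : N (x^-1 * x) (s i ^ x) = false by rewrite mulVg N1.
  have E : s i ^ x = x^-1 * (s i * x) by [].
  rewrite NM conjgK {2}E NM conjgK NM Ns eqxx.
  by rewrite [s i ^ s i]conjgE mulKg addTb addbN => ->.
move=> lt_r; apply: (Nword); apply: contraLR lt_r => nN.
rewrite -leqNgt.
have [ls lsE lsz] := reduced_word (r * word ks).
have [|k1 [i [k2 [lE rE]]]] := Nword ls r.
  by rewrite lsE NM Nr conjgE mulKg (negbTE nN).
rewrite lsE mulgA reflectionK // mul1g in rE.
rewrite -lsz rE lE (leq_trans (len_word _)) // !size_cat /=.
by rewrite addnS.
Qed.

End Coxeter.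

(** * The orbit of a minuscule weight *)

Definition cartan_bond (I : Type) (A : I -> I -> int) (i j : I) (m : nat) :=
  [\/ m = 2 /\ A i j = 0%R,
      [/\ m = 3, A i j = (-1)%R & A j i = (-1)%R],
      [/\ m = 4, A i j = (-1)%R & A j i = (-2)%R] |
      [/\ m = 4, A i j = (-2)%R & A j i = (-1)%R]].

Section BraidAct.
Local Open Scope ring_scope.
Variables (I : finType) (A : I -> I -> int) (M : minuscule A).
Implicit Types (x : M) (i j : I).

Lemma act_braid3 i j x : A i j = -1 -> A j i = -1 ->
  act i (act j (act i x)) = act j (act i (act j x)).
Proof.
move=> Aij Aji; apply: dep_inj => k.
have := dep_act i (act j (act i x)) k; have := dep_act j (act i x) k.
have := dep_act i x k; have := dep_act j (act i (act j x)) k.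
have := dep_act i (act j x) k; have := dep_act j x k.
rewrite !wt_act !(cartan_diag M) Aij Aji.
by case: (i == k); case: (j == k); lia.
Qed.

Lemma act_braid4 i j x : A i j = -1 -> A j i = -2 ->
  act i (act j (act i (act j x))) = act j (act i (act j (act i x))).
Proof.
move=> Aij Aji; apply: dep_inj => k.
have := dep_act i (act j (act i (act j x))) k.
have := dep_act j (act i (act j x)) k; have := dep_act i (act j x) k.
have := dep_act j x k; have := dep_act j (act i (act j (act i x))) k.
have := dep_act i (act j (act i x)) k.
have := dep_act j (act i x) k; have := dep_act i x k.
rewrite !wt_act !(cartan_diag M) Aij Aji.
by case: (i == k); case: (j == k); lia.
Qed.

Definition act_perm i : {perm M} := perm (can_inj (@actK _ _ M i)).

Lemma act_permE i x : act_perm i x = act i x.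
Proof. by rewrite permE. Qed.

Lemma act_perm_rel i j m : i != j -> cartan_bond A i j m ->
  ((act_perm i * act_perm j) ^+ m = 1)%g.
Proof.
move=> ij b; apply/permP => x; rewrite perm1.
case: b => [[-> Aij]|[-> Aij Aji]|[-> Aij Aji]|[-> Aij Aji]];
  rewrite !expgS expg0 mulg1 !permM !act_permE.
- by rewrite (act_comm _ Aij) !actK.
- by rewrite -(act_braid3 _ Aij Aji) !actK.
- by rewrite (act_braid4 _ Aij Aji) !actK.
- by rewrite -(act_braid4 _ Aji Aij) !actK.
Qed.

End BraidAct.

Lemma cat_cons_split (T : Type) (s1 s2 k1 k2 : seq T) (i : T) :
  s1 ++ s2 = k1 ++ i :: k2 ->
  (exists m, s1 = k1 ++ i :: m /\ k2 = m ++ s2) \/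
  (exists m, k1 = s1 ++ m /\ s2 = m ++ i :: k2).
Proof.
elim: s1 k1 => [|a s1 IH] [|b k1] //=.
- by move=> ->; right; exists [::].
- by move=> ->; right; exists (b :: k1).
- by case=> -> <-; left; exists s1.
- case=> -> /IH[[m [-> ->]]|[m [-> ->]]]; first by left; exists m.
  by right; exists m.
Qed.

Section Orbit.
Local Open Scope group_scope.
Variables (X : cartan_type) (W : weyl_group X).
Variables (A : 'I_(rank X) -> 'I_(rank X) -> int) (M : minuscule A).
Hypothesis bondA : forall i j, i != j -> cartan_bond A i j (coxeter_matrix i j).
Implicit Types (u v w r h : W) (x y z : M) (i j : 'I_(rank X)).
Implicit Types (ks : seq 'I_(rank X)).

Local Notation s := (simple W).
Local Notation J := [set i | wt (top M) i == 0%R].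
Local Notation WJ := (<<[set s i | i in J]>>%g).

Lemma orbit_map_exists : exists phi : W -> M,
  phi 1 = top M /\ forall i w, phi (s i * w) = act i (phi w).
Proof.
have [|f fM fs] := @simple_univ _ W {perm M} (@act_perm _ _ M).
  move=> i j; have [->|ij] := eqVneq i j.
    rewrite /coxeter_matrix eqxx expg1; apply/permP => x.
    by rewrite permM !act_permE actK perm1.
  exact: act_perm_rel (bondA ij).
have f1 : f 1 = 1 by apply: (mulgI (f 1)); rewrite -fM !mulg1.
(* A product of permutations applies its left factor first; the inverse turns this into a left
   action. *)
exists (fun w => f w^-1 (top M)); split; first by rewrite invg1 f1 perm1.
by move=> i w; rewrite invMg simpleV fM fs permM act_permE.
Qed.

Variable phi : W -> M.
Hypotheses (phi1 : phi 1 = top M).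
Hypotheses (phi_simple : forall i w, phi (s i * w) = act i (phi w)).

Lemma phi_simpleJ w i : i \in J -> phi (w * s i) = phi w.
Proof.
rewrite inE => /eqP iJ; elim/word_ind: w => [|k w IH]; last first.
  by rewrite -mulgA !phi_simple IH.
by rewrite mul1g -[s i]mulg1 phi_simple phi1 act_fix.
Qed.

Lemma WJ_word h : h \in WJ ->
  exists2 ks, all [in J] ks & word W ks = h.
Proof.
case/gen_prodgP=> k [c cJ ->].
elim: k c cJ => [|k IH] c cJ.
  by exists [::]; rewrite // word_nil big_ord0.
have [ks ksJ ksE] := IH _ (fun l => cJ (lift ord0 l)).
have /imsetP[j jJ cE] := cJ ord0.
by exists (j :: ks); rewrite /= ?jJ // word_cons big_ord_recl cE ksE.
Qed.

Lemma phi_WJ w h : h \in WJ -> phi (w * h) = phi w.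
Proof.
case/WJ_word=> ks ksJ <-; elim/last_ind: ks ksJ => [|ks i IH].
  by rewrite word_nil mulg1.
rewrite all_rcons -cats1 word_cat word_cons word_nil mulg1 mulgA => /andP[iJ].
by move=> ksJ; rewrite phi_simpleJ // IH.
Qed.

(* [down x w]: some word for [w] lowers [top M] to [x] at each of its letters.
   These [w] are the minimal coset representatives. *)
Inductive down : M -> W -> Prop :=
  | down_top : down (top M) 1
  | down_act i x w : wt x i = 1%R -> down x w -> down (act i x) (s i * w).

Lemma down_phi x w : down x w -> phi w = x.
Proof. by elim=> // i y v yi _ <-. Qed.

Lemma down_len x w : down x w -> (len w <= height x)%N.
Proof.
elim=> [|i y v yi _ IH]; first by rewrite len1.
have := height_act i y; have := len_simple i v; rewrite yi; lia.
Qed.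

Lemma down_exists x : exists w, down x w.
Proof.
elim/minuscule_ind: x => [|x i xi [w xw]]; first by exists 1; apply: down_top.
exists (s i * w); rewrite -[x](actK i); apply: down_act => //.
by rewrite wt_actK xi.
Qed.

Lemma downP x w : down x w ->
  (x = top M /\ w = 1) \/
  (exists i y v, [/\ wt y i = 1%R, down y v, x = act i y & w = s i * v]).
Proof. by case=> [|i y v yi yv]; [left|right; exists i, y, v]. Qed.

Lemma braid_rel i j m : coxeter_matrix i j = m.+1 ->
  (s i * s j) ^+ m * s i = s j.
Proof.
move=> mE; apply: (mulIg (s j)); rewrite simpleK -mulgA -expgSr.
by rewrite -mE simple_rel.
Qed.

Lemma conj_bond2 i j : coxeter_matrix j i = 2 -> s i ^ s j = s i.
Proof. by move/braid_rel => H; rewrite conjgE simpleV mulgA -[RHS]H expg1. Qed.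

Lemma conj_bond3 i j : coxeter_matrix i j = 3 -> (s i ^ s j) ^ s i = s j.
Proof.
move/braid_rel => H; rewrite -[RHS]H !conjgE !simpleV !expgS expg0 mulg1.
by rewrite !mulgA.
Qed.

Lemma conj_bond4 i j : coxeter_matrix j i = 4 ->
  ((s i ^ s j) ^ s i) ^ s j = s i.
Proof.
move/braid_rel => H; rewrite -[RHS]H !conjgE !simpleV !expgS expg0 mulg1.
by rewrite !mulgA.
Qed.

Lemma coxeter_matrixC i j : coxeter_matrix i j = coxeter_matrix j i.
Proof. by rewrite /coxeter_matrix eq_sym minnC maxnC. Qed.

(* The descents of a minuscule weight commute, so two lowering words for [x]
   differ by W_J; a reflection fixing [x] is moved to the right through the last
   two or three letters of the word by a braid relation. *)
Lemma down_coset_stab n x : height x = n ->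
  (forall w w', down x w -> down x w' -> w^-1 * w' \in WJ) /\
  (forall w i, down x w -> wt x i = 0%R -> s i ^ w \in WJ).
Proof.
elim/ltn_ind: n x => n IHn x xn.
have hstep y k : wt y k = 1%R -> x = act k y -> (height y < n)%N.
  by move=> yk xE; have := height_act k y; rewrite -xE yk xn; lia.
have hup y i : wt y i = (-1)%R -> (height (act i y) < height y)%N.
  by move=> yi; have := height_act i y; rewrite yi; lia.
have htop : x <> top M -> (height x > 0)%N.
  by rewrite lt0n => xt; apply/eqP => /height_eq0.
split=> [w w' xw xw'|w i xw xi].
  have [[xt ->]|[i [y [a [yi ya xE wE]]]]] := downP xw.
    have [[_ ->]|[i [y [a [yi _ xE _]]]]] := downP xw'.
      by rewrite invg1 mulg1 group1.
    by have := height_act i y; rewrite -xE xt height_top yi; lia.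
  have [[xt _]|[j [y' [b [y'j y'b xE' wE']]]]] := downP xw'.
    by have := height_act i y; rewrite -xE xt height_top yi; lia.
  have [ij|ij] := eqVneq i j.
    have yE : y = y' by rewrite -[y](actK i) -xE xE' ij actK.
    rewrite wE wE' -ij invMg mulgA mulgKV; rewrite -yE in y'b.
    by have [/(_ a b ya y'b)] := IHn _ (hstep _ _ yi xE) y erefl.
  have xi : wt x i = (-1)%R by rewrite xE wt_actK yi.
  have xj : wt x j = (-1)%R by rewrite xE' wt_actK y'j.
  have Aij := wtN1_A0 ij xi xj.
  have yE : y = act i x by rewrite xE actK.
  have y'E : y' = act j x by rewrite xE' actK.
  have yj : wt y j = (-1)%R by rewrite yE wt_act0.
  have y'i : wt y' i = (-1)%R by rewrite y'E wt_act0 // (cartan_eq0 M).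
  have pE : act j y = act i y' by rewrite yE y'E act_comm // (cartan_eq0 M).
  (* The last letters i and j commute, so both words are compared with words extending a common one
     for [act j (act i x)]. *)
  have [e pe] := down_exists (act j y).
  have yje : down y (s j * e).
    by rewrite -[y](actK j); apply: down_act => //; rewrite wt_actK yj.
  have y'ie : down y' (s i * e).
    rewrite -[y'](actK i) -pE; apply: down_act => //.
    by rewrite pE wt_actK y'i.
  have [/(_ a _ ya yje) aE _] := IHn _ (hstep _ _ yi xE) y erefl.
  have [/(_ b _ y'b y'ie) bE _] := IHn _ (hstep _ _ y'j xE') y' erefl.
  have ij2 : coxeter_matrix i j = 2.
    case: (bondA ij) => [[-> //]|[]|[]|[]]; by rewrite Aij.
  rewrite wE wE'.
  have -> : (s i * a)^-1 * (s j * b) = (a^-1 * (s j * e)) * (b^-1 * (s i * e))^-1.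
    rewrite !invMg invgK !simpleV !mulgA; congr (_ * b).
    rewrite -[in RHS](mulgA _ e) mulgV mulg1.
    have := conj_bond2 ij2; rewrite conjgE simpleV => E.
    by rewrite -!mulgA; congr (_ * _); rewrite -[in LHS]E !mulgA simpleK mul1g.
  by rewrite groupM ?groupV.
have [[xt ->]|[k [y [a [yk ya xE wE]]]]] := downP xw.
  by rewrite conjg1 mem_gen // imset_f // inE -xt xi.
have xk : wt x k = (-1)%R by rewrite xE wt_actK yk.
have yE : y = act k x by rewrite xE actK.
have ki : k != i by apply/eqP => E; rewrite -E xk in xi.
have yi : wt y i = A k i by rewrite yE wt_act xi xk; lia.
have hy := hstep _ _ yk xE.
have step y1 j : (height y1 < n)%N -> wt y1 j = (-1)%R -> exists2 e,
    down (act j y1) e & forall e', down y1 e' ->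
      exists2 h, h \in WJ & e' = s j * e * h.
  move=> hy1 y1j; have [e ye] := down_exists (act j y1); exists e => // e' ye'.
  have y1e : down y1 (s j * e).
    by rewrite -[y1](actK j); apply: down_act => //; rewrite wt_actK y1j.
  have [/(_ _ _ y1e ye') E _] := IHn _ hy1 y1 erefl.
  by exists ((s j * e)^-1 * e') => //; rewrite mulKVg.
have WJ_conj r h : h \in WJ -> r \in WJ -> r ^ h \in WJ.
  by move=> hJ rJ; rewrite groupJ.
rewrite wE conjgM.
(* The bond decides how many letters are crossed: one, two (where s_i becomes s_k), or three. The
   other orientation of the double bond would give a pairing -2. *)
case: (bondA ki) => [[m2 Aki]|[m3 Aki Aik]|[m4 Aki Aik]|[m4 Aki Aik]].
- rewrite conj_bond2 //.
  by have [_] := IHn _ hy y erefl; apply; rewrite ?yi.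
- rewrite Aki in yi; have [b yb /(_ a ya)[h hJ ->]] := step _ _ hy yi.
  rewrite -mulgA !conjgM conj_bond3 1?coxeter_matrixC // -conjgM.
  rewrite conjgM; apply: (WJ_conj) => //.
  have hz := hup _ _ yi.
  have [_] := IHn _ (ltn_trans hz hy) _ erefl; apply => //.
  by rewrite wt_act yk yi Aik.
- rewrite Aki in yi; have [b yb /(_ a ya)[h hJ ->]] := step _ _ hy yi.
  have hz := hup _ _ yi; have hz' := ltn_trans hz hy.
  have zk : wt (act i y) k = (-1)%R by rewrite wt_act yk yi Aik.
  have [c zc /(_ b yb)[h' h'J ->]] := step _ _ hz' zk.
  have hw := hup _ _ zk.
  rewrite !conjgM conj_bond4 //.
  do 2![apply: (WJ_conj) => //].
  have [_] := IHn _ (ltn_trans hw hz') _ erefl; apply => //.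
  by rewrite !wt_act yk yi (cartan_diag M) Aik Aki.
- by have := wt_bound y i; rewrite yi Aki.
Qed.

Lemma down_coset x w w' : down x w -> down x w' -> w^-1 * w' \in WJ.
Proof. by have [H _] := down_coset_stab (erefl (height x)); apply: H. Qed.

Lemma down_stab x w i : down x w -> wt x i = 0%R -> s i ^ w \in WJ.
Proof. by have [_ H] := down_coset_stab (erefl (height x)); apply: H. Qed.

(** In particular the stabiliser of [top M] is W_J. Multiplying w by a generator lowers, fixes or
    raises the weight; only the fixed case needs [down_stab]. *)
Lemma down_repr w h : down (phi w) h -> h^-1 * w \in WJ.
Proof.
elim/word_ind: w h => [|i w IH] h; rewrite ?phi1 ?phi_simple => wz.
  by rewrite (down_coset wz) //; apply: down_top.
have [e we] := down_exists (phi w); have eJ := IH _ we.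
suff: h^-1 * (s i * e) \in WJ.
  by move=> zJ; have := groupM zJ eJ; rewrite -!mulgA mulKVg.
have [wi|wi|wi] := wtP (phi w) i.
- have iwh : down (phi w) (s i * h).
    by rewrite -[phi w](actK i); apply: down_act; rewrite // wt_actK wi.
  by have := down_coset iwh we; rewrite invMg simpleV -mulgA.
- rewrite act_fix // in wz.
  have := groupM (down_coset wz we) (down_stab we wi).
  by rewrite conjgE -!mulgA mulKVg.
- by apply: (down_coset wz); apply: down_act.
Qed.

Lemma height_len w : (height (phi w) <= len w)%N.
Proof.
have [ks <- <-] := reduced_word w.
elim: ks => [|i ks IH]; first by rewrite word_nil phi1 height_top.
rewrite word_cons phi_simple /=.
by have := height_act i (phi (word W ks)); have := wt_bound (phi (word W ks)) i; lia.
Qed.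

Lemma down_lenE x w : down x w -> len w = height x.
Proof.
move=> xw; apply/eqP; rewrite eqn_leq down_len //.
by rewrite -{1}(down_phi xw) height_len.
Qed.

(** Write w as h times a word in J. If the latter ends in j, minimality makes [w * s j] longer, so
    exchange recovers w by deleting a letter from a word of [w * s j]. A letter of h cannot go, as
    the weight would be reached in fewer steps than its height; so the J part shrinks until it is
    empty. *)
Lemma quot_eq w h : w \in quot W J -> down (phi w) h -> w = h.
Proof.
rewrite inE => /forall_inP wq wx.
have [ks ksJ ksE] := WJ_word (down_repr wx).
have {ksE} wE : w = h * word W ks by rewrite ksE mulKVg.
have [n] := ubnP (size ks); elim: n ks wE ksJ => // n IHn ks.
case/lastP: ks => [|ks j]; first by rewrite word_nil mulg1.
rewrite size_rcons all_rcons -cats1 word_cat word_cons word_nil mulg1 mulgA.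
move=> wE /andP[jJ ksJ] lt_n.
have [xs xsE xsz] := reduced_word h.
pose y := h * word W ks; have yE : y = word W (xs ++ ks).
  by rewrite word_cat xsE.
have wy : w = y * s j by [].
clearbody y.
have rR : s j ^ y^-1 \in reflections W by apply/reflectionsP; exists j, y^-1.
have ryE : s j ^ y^-1 * y = w.
  by rewrite wy conjgE invgK -!mulgA mulVg mulg1.
have ysE : w * s j = y by rewrite wy -mulgA simpleK mulg1.
have lt_y : (len (s j ^ y^-1 * word W (xs ++ ks)) < len (word W (xs ++ ks)))%N.
  by rewrite -yE ryE -ysE; apply: wq.
have [k1 [i [k2 [kE E]]]] := strong_exchange rR lt_y.
have {}E : w = word W (k1 ++ k2) by rewrite -E -yE ryE.
have [[m [mE1 mE2]]|[m [mE1 mE2]]] := cat_cons_split kE.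
  have wE2 : w = word W (k1 ++ m) * word W ks.
    by rewrite E mE2 catA word_cat.
  have phiE : phi (word W (k1 ++ m)) = phi w.
    rewrite wE2 phi_WJ // /word big_seq; apply: group_prod => l lks.
    by rewrite mem_gen // imset_f //; apply: (allP ksJ).
  have := height_len (word W (k1 ++ m)); rewrite phiE -(down_lenE wx) -xsz mE1.
  have := len_word W (k1 ++ m); rewrite !size_cat /=; lia.
apply: (IHn (m ++ k2)).
- by rewrite E mE1 -catA word_cat xsE.
- by move: ksJ; rewrite mE2 !all_cat /= => /and3P[-> _ ->].
- by move: lt_n; rewrite mE2 !size_cat /=; lia.
Qed.

Lemma quot_down w : w \in quot W J -> down (phi w) w.
Proof.
by move=> wq; have [x wx] := down_exists (phi w); rewrite [X in down _ X](quot_eq wq wx).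
Qed.

Lemma down_quot x w : down x w -> w \in quot W J.
Proof.
move=> xw; rewrite inE; apply/forall_inP => j jJ.
have le1 : (len w <= len (w * s j))%N.
  by rewrite (down_lenE xw) -(down_phi xw) -(phi_simpleJ w jJ) height_len.
rewrite ltn_neqAle le1 andbT -lenV -[X in _ != X]lenV invMg simpleV eq_sym.
exact: len_simple_neq.
Qed.

Lemma quot_inj : {in quot W J &, injective phi}.
Proof.
move=> u v uq vq E; have [x ux] := down_exists (phi u).
rewrite (quot_eq uq ux); rewrite E in ux; exact/esym/(quot_eq vq ux).
Qed.

End Orbit.

(** * The Bruhat order and the two polynomial families on the orbit *)

Section Transfer.
Local Open Scope group_scope.
Variables (X : cartan_type) (W : weyl_group X).
Variables (A : 'I_(rank X) -> 'I_(rank X) -> int) (M : minuscule A).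
Hypothesis bondA : forall i j, i != j -> cartan_bond A i j (coxeter_matrix i j).
Implicit Types (u v w r h : W) (x y z : M) (i j : 'I_(rank X)).
Implicit Types (ks : seq 'I_(rank X)).

Local Notation s := (simple W).
Local Notation J := [set i | wt (top M) i == 0%R].
Local Notation WJ := (<<[set s i | i in J]>>%g).

Variable phi : W -> M.
Hypotheses (phi1 : phi 1 = top M).
Hypotheses (phi_simple : forall i w, phi (s i * w) = act i (phi w)).

Let down := @down X W A M.
Let down_phi := down_phi phi1 phi_simple.
Let down_lenE := down_lenE phi1 phi_simple.
Let quot_eq := quot_eq bondA phi1 phi_simple.
Let quot_down := quot_down bondA phi1 phi_simple.
Let quot_inj := quot_inj bondA phi1 phi_simple.
Let down_quot := down_quot phi1 phi_simple.

Fixpoint descending ks : Prop :=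
  if ks is i :: l then wt (phi (word W l)) i = 1%R /\ descending l else True.

Lemma down_word x w : down x w -> exists2 ks, word W ks = w & descending ks.
Proof.
elim=> [|i y v yi yv [ks ksE ksd]]; first by exists [::]; rewrite ?word_nil.
exists (i :: ks); first by rewrite word_cons ksE.
by split; rewrite // ksE (down_phi yv).
Qed.

Lemma wle_act_act x y i : wle x y -> wt y i = 1%R -> wle (act i x) (act i y).
Proof.
move=> /wleP xy yi; apply/wleP => k; have := xy k.
have := dep_act i x k; have := dep_act i y k; have := wt_bound x i.
by rewrite yi; case: eqP; lia.
Qed.

(** A letter that adds its root to the larger coefficient vector adds at most as much to the smaller
    one. *)
Lemma descending_mono ks ls w : descending (ks ++ ls) ->
  wle (phi w) (phi (word W ls)) ->
  wle (phi (word W ks * w)) (phi (word W (ks ++ ls))).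
Proof.
elim: ks => [|i ks IH] /=; first by rewrite word_nil mul1g.
case=> ki kd wls; rewrite !word_cons -mulgA !phi_simple.
by apply: wle_act_act => //; apply: IH.
Qed.

(** Write v as a lowering word followed by a word in J and delete a letter by exchange. In the J
    part the weight is unchanged; in the lowering part a lowering step is skipped, and the letters
    to its left preserve the comparison. *)
Lemma wle_reflection v r : r \in reflections W -> (len (r * v) < len v)%N ->
  wle (phi (r * v)) (phi v).
Proof.
move=> rR lt_rv; have [e ve] := down_exists W (phi v).
have [ks ksE ksd] := down_word ve.
have [hs hsJ hsE] := WJ_word (down_repr bondA phi1 phi_simple ve).
have vE : v = word W (ks ++ hs) by rewrite word_cat ksE hsE mulKVg.
have hsWJ ls : all [in J] ls -> word W ls \in WJ.
  move=> lsJ; rewrite /word big_seq; apply: group_prod => l lls.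
  by rewrite mem_gen // imset_f //; apply: (allP lsJ).
rewrite {1 2}vE in lt_rv.
have [k1 [i [k2 [kE E]]]] := strong_exchange rR lt_rv.
have vphi : phi v = phi (word W ks) by rewrite vE word_cat phi_WJ // hsWJ.
rewrite vphi vE E.
have [[m [mE1 mE2]]|[m [mE1 mE2]]] := cat_cons_split kE.
  rewrite mE2 catA word_cat phi_WJ ?hsWJ // mE1 in ksd *.
  rewrite [word W (k1 ++ m)]word_cat; apply: descending_mono => //.
  rewrite word_cons phi_simple; apply: wle_act_up.
  by elim: (k1) ksd => [|a k IH] /= [].
rewrite mE1 -catA word_cat phi_WJ ?wle_refl // hsWJ //.
by move: hsJ; rewrite mE2 !all_cat /= => /and3P[-> _ ->].
Qed.

Lemma bruhat_wle u v : bruhat u v -> wle (phi u) (phi v).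
Proof.
case/connectP=> p; elim: p u => [|w p IH] u /=; first by move=> _ ->; apply: wle_refl.
case/andP=> /andP[tR lt_uw] pth vE; apply: wle_trans (IH _ pth vE).
(* [bruhat] multiplies by reflections on the right, exchange on the left; conjugation by w passes
   between them. *)
set t := u^-1 * w in tR.
have rR : t ^ w^-1 \in reflections W.
  case/reflectionsP: tR => i [x ->]; apply/reflectionsP.
  by exists i, (x * w^-1); rewrite conjgM.
have uE : t ^ w^-1 * w = u.
  rewrite conjgE invgK -!mulgA mulVg mulg1.
  have := reflectionK tR; rewrite {1}/t -!mulgA => E.
  by apply: (mulgI u^-1); rewrite E mulVg.
by rewrite -{1}uE; apply: wle_reflection => //; rewrite uE.
Qed.

Lemma quot_len u : u \in quot W J -> len u = height (phi u).
Proof. by move=> /quot_down/down_lenE. Qed.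

Lemma quot_up u i : u \in quot W J -> wt (phi u) i = 1%R ->
  s i * u \in quot W J.
Proof.
move=> uq ui; apply: (down_quot (x := act i (phi u))).
by apply: down_act => //; apply: quot_down.
Qed.

Lemma quot_simple_down u i : u \in quot W J -> wt (phi u) i = (-1)%R ->
  s i * u \in quot W J.
Proof.
move=> uq ui; have [e ue] := down_exists W (act i (phi u)).
suff -> : s i * u = e by apply: (down_quot ue).
rewrite (quot_eq (h := s i * e) uq) ?simpleKl //.
by rewrite -[phi u](actK i); apply: down_act; rewrite // wt_actK ui.
Qed.

Lemma bruhat_simple u i : (len u < len (s i * u))%N -> bruhat u (s i * u).
Proof.
move=> lt_u; apply: connect1; rewrite lt_u andbT.
by apply/reflectionsP; exists i, u.
Qed.

Lemma wle_bruhat u v : u \in quot W J -> v \in quot W J ->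
  wle (phi u) (phi v) -> bruhat u v.
Proof.
have [n] := ubnP (height (phi v) - height (phi u)).
elim: n u v => // n IHn u v lt_n uq vq uv.
have [/(quot_inj uq vq)->|neq] := eqVneq (phi u) (phi v); first exact: connect0.
have hlt := lt_height uv neq.
have [i di [[ui _]|[vi _]]] := wle_corner uv neq.
  have iuq := quot_up uq ui; have iuv := wle_actl uv ui di.
  have := height_act i (phi u); rewrite ui => h.
  apply: (connect_trans (y := s i * u)).
    by apply: bruhat_simple; rewrite !quot_len // phi_simple; lia.
  by apply: IHn => //; rewrite phi_simple //; lia.
have ivq := quot_simple_down vq vi; have uiv := wle_actr uv vi di.
have := height_act i (phi v); rewrite vi => h.
apply: (connect_trans (y := s i * v)).
  by apply: IHn => //; rewrite phi_simple //; lia.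
rewrite -[v in connect _ _ v](simpleKl i); apply: bruhat_simple.
by rewrite simpleKl !quot_len // phi_simple; lia.
Qed.

Lemma bruhatE u v : u \in quot W J -> v \in quot W J ->
  bruhat u v = wle (phi u) (phi v).
Proof.
by move=> uq vq; apply/idP/idP; [apply: bruhat_wle|apply: wle_bruhat].
Qed.

Definition section (x : M) : W :=
  odflt 1 [pick w | (w \in quot W J) && (phi w == x)].

Lemma sectionP x : section x \in quot W J /\ phi (section x) = x.
Proof.
rewrite /section; case: pickP => [w /andP[wq /eqP]|none] //.
have [e xe] := down_exists W x.
by have := none e; rewrite (down_quot xe) (down_phi xe) eqxx.
Qed.

Lemma section_quot x : section x \in quot W J.
Proof. by case: (sectionP x). Qed.

Lemma phi_section x : phi (section x) = x.
Proof. by case: (sectionP x). Qed.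

Lemma section_phi u : u \in quot W J -> section (phi u) = u.
Proof. by move=> uq; apply: quot_inj; rewrite ?section_quot ?phi_section. Qed.

Lemma bruhat_section x y : bruhat (section x) (section y) = wle x y.
Proof. by rewrite bruhatE ?section_quot // !phi_section. Qed.

Lemma section_inj : injective section.
Proof. by move=> x y E; rewrite -[x]phi_section E phi_section. Qed.

Lemma section_act i x : wt x i <> 0%R -> s i * section x = section (act i x).
Proof.
move=> xi; apply: quot_inj; rewrite ?section_quot //; last first.
  by rewrite phi_simple !phi_section.
have xq := section_quot x.
case: (wtP x i) => [xi1|//|xi1]; [apply: quot_simple_down|apply: quot_up] => //;
  by rewrite phi_section.
Qed.

Lemma len_section x : len (section x) = height x.
Proof. by rewrite quot_len ?section_quot ?phi_section. Qed.

Lemma interval_section x y :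
  interval J (section x) (section y) = section @: [set z | wle x z && wle z y].
Proof.
apply/setP => w; rewrite in_set; apply/andP/imsetP.
  case=> wq /andP[xw wy]; exists (phi w); last by rewrite section_phi.
  by rewrite inE -!bruhat_section section_phi // xw wy.
case=> z; rewrite inE -!bruhat_section => /andP[xz zy] ->.
by rewrite xz zy section_quot.
Qed.

Section Families.
Local Open Scope ring_scope.
Variables (R P : W -> W -> {poly int}).
Hypotheses (RP : relative_R J R) (PP : relative_KL J R P).

Lemma R_system_section : R_system (fun x y => R (section x) (section y)).
Proof.
split=> [x y xy|x|x y i yi].
- have [H _ _] := RP (section_quot x) (section_quot y).
  by apply: H; rewrite bruhat_section.
- by have [_ ] := RP (section_quot x) (section_quot x).
have [_ _ H] := RP (section_quot x) (section_quot y).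
have yiE : section (act i y) = (s i * section y)%g.
  by rewrite section_act // yi.
have ylt : i \in left_descents (section y).
  rewrite inE -yiE !len_section.
  by have := height_act i y; rewrite yi; lia.
have R0 a b : ~~ wle a b -> R (section a) (section b) = 0.
  have [H0 _ _] := RP (section_quot a) (section_quot b).
  by move=> ab; apply: H0; rewrite bruhat_section.
have lt_xy : wle x y -> x != y -> bruhat_lt (section x) (section y).
  move=> xy neq; rewrite /bruhat_lt bruhat_section xy andbT.
  by apply: contra neq => /eqP/section_inj ->; rewrite eqxx.
have simple_lt a b k : wt a k = -1 -> b = act k a ->
    bruhat_lt (section b) (section a).
  move=> ak ->; rewrite /bruhat_lt bruhat_section wle_act_down // andbT.
  apply/negP => /eqP/section_inj E.
  by have := act_neq (x := a) (i := k); rewrite ak E eqxx => /(_ isT).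
have dec : wle x (act i y) -> wle x y.
  by move/wle_trans; apply; apply: wle_act_down.
split=> xi /=.
- have xiE : section (act i x) = (s i * section x)%g by rewrite section_act // xi.
  have [xy|xy] := boolP (wle x y); last first.
    rewrite !R0 //; apply: contra xy => /wleP xy; apply/wleP => k.
    have := xy k; have := dep_act i x k; have := dep_act i y k.
    by rewrite xi yi; case: eqP; lia.
  have [<-|neq] := eqVneq x y.
    by have [_ -> _] := RP (section_quot x) (section_quot x);
       have [_ -> _] := RP (section_quot (act i x)) (section_quot (act i x)).
  have [E _ _] := H i (lt_xy xy neq) ylt.
  by rewrite E -xiE ?yiE //; apply: simple_lt xi _.
- have neq : x != y by apply/eqP => E; move: xi; rewrite E yi.
  have [xy|xy] := boolP (wle x y); last first.
    by rewrite !R0 ?mulr0 //; apply: contra xy => /dec.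
  have [_ E _] := H i (lt_xy xy neq) ylt.
  have phiE : phi (s i * section x)%g = x.
    by rewrite phi_simple phi_section act_fix.
  have lt_len : (len (section x) < len (s i * section x)%g)%N.
    rewrite ltn_neqAle eq_sym len_simple_neq /= len_section -{1}phiE.
    exact: height_len.
  rewrite E ?yiE //.
    rewrite /bruhat_lt bruhat_simple // andbT.
    by apply: contraTneq lt_len => <-; rewrite ltnn.
  (* Were it minimal, [s i * section x] would be the representative of the fixed weight x, and not
     longer. *)
  apply: contraTN lt_len => xq.
  by rewrite -[(s i * section x)%g](section_phi xq) phiE ltnn.
- have xiE : section (act i x) = (s i * section x)%g by rewrite section_act // xi.
  have neq : x != y by apply/eqP => E; move: xi; rewrite E yi.
  have [xy|xy] := boolP (wle x y); last first.
    have xiy : ~~ wle x (act i y) by apply: contra xy => /dec.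
    rewrite !R0 ?mulr0 ?addr0 //; apply: contra xiy.
    by apply: wle_trans; apply: wle_act_up.
  have [_ _ E] := H i (lt_xy xy neq) ylt.
  rewrite E -xiE ?yiE ?section_quot //.
  by apply: simple_lt (esym (actK i x)); rewrite wt_actK xi.
Qed.

Lemma KL_system_section : KL_system
  (fun x y => R (section x) (section y)) (fun x y => P (section x) (section y)).
Proof.
split=> [x|x y xy neq|x y xy].
- by have [] := PP (section_quot x) (section_quot x).
- have [_ _ H _] := PP (section_quot x) (section_quot y).
  rewrite -!len_section; apply: H; rewrite /bruhat_lt bruhat_section xy andbT.
  by apply: contra neq => /eqP/section_inj ->; rewrite eqxx.
- have [_ _ _ H] := PP (section_quot x) (section_quot y).
  rewrite -!len_section H ?bruhat_section // interval_section big_imset /=.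
    by apply: eq_bigl => z; rewrite inE.
  by move=> z1 z2 _ _ /section_inj.
Qed.
End Families.

End Transfer.

Local Open Scope ring_scope.

(** * Constructing minuscule systems *)

Section Build.
Variables (I : finType) (A : I -> I -> int) (N : nat).
Variables (wtf : (I -> nat) -> I -> int) (Inv : (I -> nat) -> Prop).
Hypotheses (Adiag : forall i, A i i = 2).
Hypotheses (Aoff : forall i j, i != j -> A i j <= 0).
Hypotheses (Aeq0 : forall i j, A i j = 0 -> A j i = 0).
Hypotheses (Apos : sign_nonreversing A).
Hypotheses (wtf0 : forall h, (forall i, h i = 0%N) ->
  forall i, 0 <= wtf h i).
Hypotheses (wtfS : forall h h' i, (forall j, h' j = h j + (i == j))%N ->
  forall j, wtf h' j = wtf h j - A i j).
Hypotheses (Inv0 : forall h, (forall i, h i = 0%N) -> Inv h).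
Hypotheses (InvS : forall h h' i, Inv h -> wtf h i = 1 ->
  (forall j, h' j = h j + (i == j))%N -> Inv h').
Hypotheses (InvN : forall h, Inv h -> forall i, (h i <= N)%N).
Hypotheses (Invw : forall h, Inv h -> forall i, -1 <= wtf h i <= 1).

Local Notation state := {ffun I -> 'I_N.+1}.
Implicit Types (f g : state) (i j k : I).

Let hgt f : I -> nat := fun i => f i.
Definition add_root f i g := [forall j, g j == (f j + (i == j))%N :> nat].
(** Only lowering steps generate the orbit, and N bounds the coefficients to keep the states finite.
    Stability under raising is proved in [reachable_down]. *)
Definition root_step f g := [exists i, (wtf (hgt f) i == 1) && add_root f i g].
Definition state0 : state := [ffun=> ord0].
Definition reachable f := connect root_step state0 f.

Lemma add_rootP f i g :
  reflect (forall j, g j = (f j + (i == j))%N :> nat) (add_root f i g).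
Proof. exact: 'forall_eqP. Qed.

Lemma state0E i : state0 i = 0%N :> nat.
Proof. by rewrite ffunE. Qed.

Lemma wtf_add f i g : add_root f i g ->
  forall j, wtf (hgt g) j = wtf (hgt f) j - A i j.
Proof. by move/add_rootP/wtfS. Qed.

Lemma reachable_ind (P : state -> Prop) : P state0 ->
  (forall f i g, reachable f -> P f -> wtf (hgt f) i = 1 -> add_root f i g ->
     P g) ->
  forall f, reachable f -> P f.
Proof.
move=> P0 PS f /connectP[q]; elim/last_ind: q f => [|q g IH] f /=.
  by move=> _ ->.
rewrite rcons_path last_rcons => /andP[pq /existsP[i /andP[/eqP wi fg]]] ->.
apply: (PS _ i g _ _ wi fg); last exact: IH.
by apply/connectP; exists q.
Qed.

Lemma reachable_Inv f : reachable f -> Inv (hgt f).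
Proof.
elim/reachable_ind: f / => [|f i g _ If wi /add_rootP fg].
  by apply: Inv0 => i; apply: state0E.
exact: InvS fg.
Qed.

Lemma reachable_up f i : reachable f -> wtf (hgt f) i = 1 ->
  exists2 g, reachable g & add_root f i g.
Proof.
move=> rf wi; have If := reachable_Inv rf.
have Ig : Inv (fun j => hgt f j + (i == j))%N by apply: InvS wi _.
exists [ffun j => inord (f j + (i == j))]; last first.
  apply/add_rootP => j; rewrite ffunE inordK // ltnS; exact: (InvN Ig).
apply: connect_trans rf (connect1 _); apply/existsP; exists i.
rewrite wi eqxx; apply/add_rootP => j; rewrite ffunE inordK // ltnS.
exact: (InvN Ig).
Qed.

(** Let k be the last step of a path to f. If k differs from i, both are descents of f and hence
    orthogonal: i is undone before k by induction, and k is then performed again. *)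
Lemma reachable_down f i : reachable f -> wtf (hgt f) i = -1 ->
  exists2 g, reachable g & add_root g i f.
Proof.
move=> rf; elim/reachable_ind: f / rf i => [|f k g rf IH wk fg] i wi.
  by have := wtf0 state0E i; rewrite wi.
have [<-|ki] := eqVneq k i; first by exists f.
have wgi := wtf_add fg i; rewrite wi in wgi.
have Aki : A k i = 0.
  by have := Invw (reachable_Inv rf) i; have := Aoff ki; lia.
have Aik := Aeq0 Aki.
have [|e re ef] := IH i; first by lia.
have wek : wtf (hgt e) k = 1 by have := wtf_add ef k; lia.
have [d rd ed] := reachable_up re wek.
exists d => //; apply/add_rootP => j.
by move/add_rootP: fg ->; move/add_rootP: ed ->; move/add_rootP: ef ->; lia.
Qed.

Definition build_weight : finType := {f : state | reachable f}.
Implicit Types (x y : build_weight).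

Definition build_dep x i : nat := val x i.
Definition build_wt x i : int := wtf (build_dep x) i.
Definition is_act i x y : bool := [forall j, (build_dep y j)%:Z ==
  (build_dep x j)%:Z + (if i == j then build_wt x i else 0)].
Definition build_act i x : build_weight := odflt x [pick y | is_act i x y].

Lemma build_actP i x : is_act i x (build_act i x).
Proof.
rewrite /build_act; case: pickP => [y //|none].
have rx := valP x; have := Invw (reachable_Inv rx) i.
have [y yP] : exists y, is_act i x y; last by rewrite none in yP.
have wE : build_wt x i = wtf (hgt (val x)) i by [].
have [w1|w1] := eqVneq (wtf (hgt (val x)) i) 1.
  have [g rg /add_rootP xg] := reachable_up rx w1.
  exists (exist _ g rg); apply/forallP => j.
  have -> : build_dep (exist _ g rg) j = (build_dep x j + (i == j))%N by exact: xg.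
  by rewrite wE w1; apply/eqP; case: (i == j); lia.
have [w2|w2] := eqVneq (wtf (hgt (val x)) i) (-1).
  have [g rg /add_rootP gx] := reachable_down rx w2.
  exists (exist _ g rg); apply/forallP => j.
  have -> : build_dep x j = (build_dep (exist _ g rg) j + (i == j))%N by exact: gx.
  by rewrite wE w2; apply/eqP; case: (i == j); lia.
exists x; apply/forallP => j; apply/eqP.
by have := Invw (reachable_Inv rx) i; rewrite wE; case: (i == j); lia.
Qed.

Lemma build_dep_act i x j : (build_dep (build_act i x) j)%:Z =
  (build_dep x j)%:Z + (if i == j then build_wt x i else 0).
Proof. by have /forallP/(_ j)/eqP := build_actP i x. Qed.

Lemma build_dep_inj x y : (forall i, build_dep x i = build_dep y i) -> x = y.
Proof. by move=> E; apply/val_inj/ffunP => i; apply/val_inj/E. Qed.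

Lemma build_wt_act i x j :
  build_wt (build_act i x) j = build_wt x j - build_wt x i * A i j.
Proof.
have E := build_dep_act i x; have := Invw (reachable_Inv (valP x)) i.
rewrite -[wtf _ i]/(build_wt x i) => b.
have : [\/ build_wt x i = -1, build_wt x i = 0 | build_wt x i = 1].
  move: b; case: (build_wt x i) => [[|[|n]]|[|n]]; try lia.
  - by constructor 2.
  - by constructor 3.
  - by constructor 1.
case=> w; rewrite w in E *.
- have H : wtf (build_dep x) j = wtf (build_dep (build_act i x)) j - A i j.
    by apply: wtfS => k; have := E k; case: (i == k); lia.
  by rewrite /build_wt H; lia.
- by rewrite (build_dep_inj (x := build_act i x) (y := x)) => [|k];
    [lia | have := E k; case: (i == k); lia].
- rewrite /build_wt (@wtfS (build_dep x) _ i) => [|k]; first by lia.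
  by have := E k; case: (i == k); lia.
Qed.

Definition build_top : build_weight := exist _ state0 (connect0 _ _).

Lemma build_wt_descent x : x != build_top -> exists i, build_wt x i = -1.
Proof.
have : val x = state0 \/ exists i, wtf (hgt (val x)) i = -1.
  elim/reachable_ind: (val x) / (valP x) => [|g i h _ _ wi gh]; first by left.
  by right; exists i; rewrite (wtf_add gh) wi Adiag.
by case=> [xE|[i wi _]]; [case/eqP; apply: val_inj | exists i].
Qed.

Definition build_minuscule : minuscule A :=
  @Minuscule I A build_weight build_wt build_act build_dep build_top
    Adiag Aoff Aeq0 Apos
    (fun x => Invw (reachable_Inv (valP x))) build_wt_act build_dep_act
    build_dep_inj state0E build_wt_descent.

Lemma build_minuscule_Inv (x : build_minuscule) : Inv (dep x).
Proof. exact: reachable_Inv (valP x). Qed.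

Lemma build_minuscule_wt (x : build_minuscule) i : wt x i = wtf (dep x) i.
Proof. by []. Qed.
End Build.

Section Cartan.
Variable X : cartan_type.
Implicit Types (i j : 'I_(rank X)).

(** Rows and columns are indexed by ordinals; the entry [(i, j)] is
    [<alpha_i, alpha_j^vee>], where [alpha_n] is long in type B and short in
    type C.  These are the Cartan matrices for which the nodes of the list are
    minuscule: the dual types have the same Weyl group. *)
Definition cartan (i j : 'I_(rank X)) : int :=
  match coxeter_matrix i j with
  | 1 => 2
  | 3 => -1
  | 4 => if ((i < j)%N == if X is TypeB _ then true else false) then -1 else -2
  | _ => 0
  end.

Lemma bond_values (a b : nat) : bond X a b \in [:: 2; 3; 4]%N.
Proof. by case: (X) => [n|n|n|n||] /=; repeat case: ifP. Qed.

Lemma cartanP i j : i != j ->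
  [\/ [/\ coxeter_matrix i j = 2%N, cartan i j = 0 & cartan j i = 0],
      [/\ coxeter_matrix i j = 3%N, cartan i j = -1 & cartan j i = -1],
      [/\ coxeter_matrix i j = 4%N, cartan i j = -1 & cartan j i = -2] |
      [/\ coxeter_matrix i j = 4%N, cartan i j = -2 & cartan j i = -1]].
Proof.
move=> ij; rewrite /cartan (coxeter_matrixC j i).
have : coxeter_matrix i j \in [:: 2; 3; 4]%N.
  by rewrite /coxeter_matrix (negbTE ij) bond_values.
rewrite !inE => /or3P[] /eqP ->.
- by constructor 1.
- by constructor 2.
have := ij; rewrite -val_eqE /= neq_ltn => /orP[] lt_ij;
  rewrite lt_ij ltnNge (ltnW lt_ij) /=.
  by case: (X); do [by constructor 3 | by constructor 4].
by case: (X); do [by constructor 3 | by constructor 4].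
Qed.

Lemma cartan_ii i : cartan i i = 2.
Proof. by rewrite /cartan /coxeter_matrix eqxx. Qed.

Lemma cartan_le0 i j : i != j -> cartan i j <= 0.
Proof. by case/cartanP => [[_ ->]|[_ ->]|[_ ->]|[_ ->]]. Qed.

Lemma cartan_0C i j : cartan i j = 0 -> cartan j i = 0.
Proof.
have [->//|/cartanP] := eqVneq i j.
by case=> [[_ -> ->]|[_ -> ->]|[_ -> ->]|[_ -> ->]].
Qed.

Variables (p : nat) (N : nat) (Inv : ('I_(rank X) -> nat) -> Prop).

(** The pairing with the coroot j of the fundamental weight at [p], counted from 0, minus the sum of
    the h_i alpha_i. *)
Definition coweight (h : 'I_(rank X) -> nat) (j : 'I_(rank X)) : int :=
  (val j == p)%:Z - \sum_i (h i)%:Z * cartan i j.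

Hypothesis pos : sign_nonreversing cartan.
Hypotheses (Inv0 : forall h, (forall i, h i = 0%N) -> Inv h).
Hypotheses (InvS : forall h h' i, Inv h -> coweight h i = 1 ->
  (forall j, h' j = h j + (i == j))%N -> Inv h').
Hypotheses (InvN : forall h, Inv h -> forall i, (h i <= N)%N).
Hypotheses (Invw : forall h, Inv h -> forall i, -1 <= coweight h i <= 1).

Lemma minuscule_exists : exists M : minuscule cartan,
  [/\ forall i, wt (top M) i = (val i == p)%:Z,
      forall x : M, Inv (dep x) &
      forall (x : M) i, wt x i = coweight (dep x) i].
Proof.
have wtf0 h : (forall i, h i = 0%N) -> forall i, coweight h i = (val i == p)%:Z.
  move=> h0 i; rewrite /coweight big1 ?subr0 // => k _.
  by rewrite h0 mul0r.
have wtfS h h' i : (forall j, h' j = h j + (i == j))%N ->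
    forall j, coweight h' j = coweight h j - cartan i j.
  move=> E j; rewrite /coweight -addrA -opprD; congr (_ - _).
  under eq_bigr => k _ do rewrite E PoszD mulrDl.
  rewrite big_split /=; congr (_ + _).
  rewrite (bigD1 i) //= eqxx mul1r big1 ?addr0 // => k ki.
  by rewrite eq_sym (negbTE ki) mul0r.
have wtf0' h : (forall i, h i = 0%N) -> forall i, 0 <= coweight h i.
  by move=> h0 i; rewrite wtf0.
exists (build_minuscule cartan_ii cartan_le0 cartan_0C pos
  wtf0' wtfS Inv0 InvS InvN Invw).
split=> [i|x|x i].
- by rewrite build_minuscule_wt wtf0 // => k; apply: dep_top.
- exact: build_minuscule_Inv.
- exact: build_minuscule_wt.
Qed.
End Cartan.

(* Bourbaki labels: [ext d k] is the value of [d] at label [k], and [0] off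
   the range [1 <= k <= n]. *)
Definition ext n (d : 'I_n -> int) (k : nat) : int :=
  if k is k'.+1 then oapp d 0 (insub k') else 0.

Lemma ext_ord n (d : 'I_n -> int) (i : 'I_n) : ext d i.+1 = d i.
Proof. by rewrite /= valK. Qed.

Lemma ext_out n (d : 'I_n -> int) k : (n < k)%N -> ext d k = 0.
Proof. by case: k => // k; rewrite ltnS /= => nk; rewrite insubN -?leqNgt. Qed.

Lemma sum_ext n (d : 'I_n -> int) k :
  \sum_i d i * (i.+1 == k)%:Z = ext d k.
Proof.
case: k => [|k] /=; first by rewrite big1 // => i _; rewrite mulr0.
case: insubP => [j _ jk|nk] /=.
  rewrite (bigD1 j) //= -jk eqxx mulr1 big1 ?addr0 // => i ij.
  by rewrite eqSS (inj_eq val_inj) (negbTE ij) mulr0.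
rewrite big1 // => i _; rewrite eqSS.
by case: eqP => [E|_]; [rewrite -E ltn_ord in nk | rewrite mulr0].
Qed.

Lemma ext_add n (h h' : 'I_n -> nat) i :
  (forall j, h' j = h j + (i == j))%N -> forall k,
  ext (fun j => (h' j)%:Z) k = ext (fun j => (h j)%:Z) k + (k == i.+1)%:Z.
Proof.
move=> E [|k] //=; case: insubP => [j _ jk|nk] /=.
  rewrite E -jk eqSS; have [->|ij] := eqVneq i j; first by rewrite eqxx; lia.
  by rewrite eq_sym -val_eqE in ij; rewrite (negbTE ij); lia.
by rewrite eqSS; case: eqP => [E'|_]; [rewrite E' ltn_ord in nk|].
Qed.

Lemma cartanA n (i j : 'I_(rank (TypeA n))) : cartan i j =
  2 * (i.+1 == j.+1)%:Z - (i.+1 == j)%:Z - (i.+1 == j.+2)%:Z.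
Proof.
rewrite /cartan /coxeter_matrix -val_eqE /=; move: (ltn_ord i) (ltn_ord j) => /=.
move: (nat_of_ord i) (nat_of_ord j) => a b.
by case: (ltngtP a b) => ab; do ?[case: ifP => ? /=]; lia.
Qed.

Lemma cartanD n (i j : 'I_(rank (TypeD n))) : cartan i j =
  2 * (i.+1 == j.+1)%:Z -
  if (j.+1 == n)%N then (i.+2 == j)%:Z
  else if (j.+2 == n)%N then (i.+1 == j)%:Z
  else (i.+1 == j)%:Z + (i.+1 == j.+2)%:Z + ((j.+3 == n) && (i.+1 == n))%:Z.
Proof.
rewrite /cartan /coxeter_matrix -val_eqE /=; move: (ltn_ord i) (ltn_ord j) => /=.
move: (nat_of_ord i) (nat_of_ord j) => a b.
by case: (ltngtP a b) => ab; do ?[case: ifP => ? /=]; lia.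
Qed.

Lemma cartanC n (i j : 'I_(rank (TypeC n))) : cartan i j =
  2 * (i.+1 == j.+1)%:Z -
  (if j.+1 == n then 2 else 1) * (i.+1 == j)%:Z - (i.+1 == j.+2)%:Z.
Proof.
rewrite /cartan /coxeter_matrix -val_eqE /=; move: (ltn_ord i) (ltn_ord j) => /=.
move: (nat_of_ord i) (nat_of_ord j) => a b.
by case: (ltngtP a b) => ab; do ?[case: ifP => ? /=]; lia.
Qed.

Lemma cartanB n (i j : 'I_(rank (TypeB n))) : cartan i j =
  2 * (i.+1 == j.+1)%:Z -
  (i.+1 == j)%:Z - (if j.+2 == n then 2 else 1) * (i.+1 == j.+2)%:Z.
Proof.
rewrite /cartan /coxeter_matrix -val_eqE /=; move: (ltn_ord i) (ltn_ord j) => /=.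
move: (nat_of_ord i) (nat_of_ord j) => a b.
by case: (ltngtP a b) => ab; do ?[case: ifP => ? /=]; lia.
Qed.

Section CartanSums.
Variable n : nat.
Implicit Types (d : 'I_n -> int) (j : 'I_n).

Lemma cartanA_sum d j :
  \sum_i d i * cartan (X := TypeA n) i j = 2 * ext d j.+1 - ext d j - ext d j.+2.
Proof.
rewrite -!sum_ext mulr_sumr -!sumrB; apply: eq_bigr => i _.
by rewrite cartanA; ring.
Qed.

Lemma cartanC_sum d j : \sum_i d i * cartan (X := TypeC n) i j =
  2 * ext d j.+1 - (if j.+1 == n then 2 else 1) * ext d j - ext d j.+2.
Proof.
rewrite -!sum_ext !mulr_sumr -!sumrB; apply: eq_bigr => i _.
by rewrite cartanC; ring.
Qed.

Lemma cartanB_sum d j : \sum_i d i * cartan (X := TypeB n) i j =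
  2 * ext d j.+1 - ext d j - (if j.+2 == n then 2 else 1) * ext d j.+2.
Proof.
rewrite -!sum_ext !mulr_sumr -!sumrB; apply: eq_bigr => i _.
by rewrite cartanB; ring.
Qed.

Lemma cartanD_sum d j : \sum_i d i * cartan (X := TypeD n) i j =
  2 * ext d j.+1 - if j.+1 == n then ext d j.-1
  else if j.+2 == n then ext d j
  else ext d j + ext d j.+2 + (if j.+3 == n then ext d n else 0).
Proof.
transitivity (2 * (\sum_i d i * (i.+1 == j.+1)%:Z) -
   \sum_i d i * (if j.+1 == n then (i.+2 == j)%:Z
  else if j.+2 == n then (i.+1 == j)%:Z
  else (i.+1 == j)%:Z + (i.+1 == j.+2)%:Z + ((j.+3 == n) && (i.+1 == n))%:Z)).
  by rewrite mulr_sumr -sumrB; apply: eq_bigr => i _; rewrite cartanD; ring.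
rewrite sum_ext; congr (_ - _).
case: ifP => _.
  by case: (nat_of_ord j) => [|k]; [rewrite /= big1 // => i _; rewrite mulr0|exact: sum_ext].
case: ifP => _; first exact: sum_ext.
under eq_bigr => i _ do rewrite !mulrDr.
rewrite !big_split /= !sum_ext; congr (_ + _).
case: ifP => _; last by rewrite big1 // => i _; rewrite mulr0.
exact: sum_ext.
Qed.
End CartanSums.

(** * Positivity of the Cartan matrices *)

Lemma sign_nonreversing_intro (I : finType) (A : I -> I -> int) :
  (forall d : I -> int, (forall i, d i * \sum_j d j * A j i <= 0) ->
     forall i, d i = 0) -> sign_nonreversing A.
Proof.
move=> H d [k dk]; have [/existsP[i di]|/existsPn none] :=
  boolP [exists i, 0 < d i * \sum_j d j * A j i]; first by exists i.
by case/eqP: dk; apply: H => i; rewrite leNgt none.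
Qed.

(** With a the value at a node and b the weighted sum over its neighbours, failure of the sign
    condition becomes a linear inequality between absolute values. *)
Lemma quad_le (a b : int) : a * (2 * a - b) <= 0 -> 2 * `|a| <= `|b|.
Proof. nia. Qed.

(** Discrete convexity: along an arm starting from the value 0, |f k| / k does not decrease. *)
Lemma arm_le (f : nat -> int) m : f 0%N = 0 ->
  (forall k, (k < m)%N -> f k.+1 * (2 * f k.+1 - f k - f k.+2) <= 0) ->
  forall k, (k <= m)%N -> k.+1%:Z * `|f k| <= k%:Z * `|f k.+1|.
Proof.
move=> f0 H; elim=> [|k IH] km; first by rewrite f0; lia.
have {IH} := IH (ltnW km); have := H k km.
rewrite -addrA -opprD => /quad_le.
nia.
Qed.

Lemma arm_eq0 (f : nat -> int) m :
  (forall k, (k <= m)%N -> k.+1%:Z * `|f k| <= k%:Z * `|f k.+1|) ->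
  f m.+1 = 0 -> forall k, (k <= m.+1)%N -> f k = 0.
Proof.
move=> H fm k; elim: m H fm => [|m IH] H fm km.
  case: k km => [|[|//]] // _.
  by have := H 0%N isT; rewrite mul1r mul0r normr_le0 => /eqP.
have [->//|km'] := eqVneq k m.+2; apply: IH; [|have := H m.+1 (leqnn _); nia|lia].
by move=> l lm; apply: H; lia.
Qed.

Lemma ext_eq0 n (d : 'I_n -> int) :
  (forall k, (k <= n)%N -> ext d k = 0) -> forall i, d i = 0.
Proof. by move=> H i; rewrite -ext_ord H. Qed.

Lemma cartanA_pos n : sign_nonreversing (@cartan (TypeA n)).
Proof.
apply: sign_nonreversing_intro => d H; apply: (@ext_eq0 n).
have arm k : (k < n)%N ->
    ext d k.+1 * (2 * ext d k.+1 - ext d k - ext d k.+2) <= 0.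
  by move=> kn; have := H (Ordinal kn); rewrite cartanA_sum -(ext_ord d).
have := @arm_eq0 _ n (arm_le (erefl : ext d 0 = 0) arm).
by move=> E k kn; apply: E; [apply: ext_out|lia].
Qed.

Lemma cartanC_pos n : (1 < n)%N -> sign_nonreversing (@cartan (TypeC n)).
Proof.
case: n => [|[|n]] // _.
apply: sign_nonreversing_intro => d H; apply: (@ext_eq0 n.+2).
have E k : (k < n.+2)%N -> ext d k.+1 * (2 * ext d k.+1 -
    (if k.+1 == n.+2 then 2 else 1) * ext d k - ext d k.+2) <= 0.
  by move=> kn; have := H (Ordinal kn); rewrite cartanC_sum -(ext_ord d).
have e0 : ext d 0 = 0 by [].
have eN : ext d n.+3 = 0 by apply: ext_out.
move: (ext d) e0 eN E => f f0 fN E {H}.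
have arm k : (k < n.+1)%N -> f k.+1 * (2 * f k.+1 - f k - f k.+2) <= 0.
  move=> kn; have := E k.
  have -> : (k.+1 == n.+2) = false by lia.
  by rewrite mul1r; apply; lia.
have armle := arm_le f0 arm.
(* At the double bond |f (n+2)| <= |f (n+1)|, while the arm gives (n+2) |f (n+1)| <= (n+1) |f
   (n+2)|; both values vanish. *)
have := E n.+1; rewrite eqxx fN subr0 => /(_ (leqnn _))/quad_le E1.
have E3 := armle n.+1 (leqnn _).
by apply: arm_eq0 armle _; nia.
Qed.

Lemma cartanB_pos n : (1 < n)%N -> sign_nonreversing (@cartan (TypeB n)).
Proof.
case: n => [|[|n]] // _.
apply: sign_nonreversing_intro => d H; apply: (@ext_eq0 n.+2).
have E k : (k < n.+2)%N -> ext d k.+1 * (2 * ext d k.+1 - ext d k -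
    (if k.+2 == n.+2 then 2 else 1) * ext d k.+2) <= 0.
  by move=> kn; have := H (Ordinal kn); rewrite cartanB_sum -(ext_ord d).
have e0 : ext d 0 = 0 by [].
have eN : ext d n.+3 = 0 by apply: ext_out.
move: (ext d) e0 eN E => f f0 fN E {H}.
have arm k : (k < n)%N -> f k.+1 * (2 * f k.+1 - f k - f k.+2) <= 0.
  move=> kn; have := E k.
  have -> : (k.+2 == n.+2) = false by lia.
  by rewrite mul1r; apply; lia.
have armle := arm_le f0 arm.
have := E n; rewrite eqxx -addrA -opprD => /(_ (leqnSn _))/quad_le E1.
have := E n.+1; rewrite fN mulr0 subr0 => /(_ (leqnn _))/quad_le E2.
have E3 := armle n (leqnn _).
have fn1 : f n.+1 = 0 by nia.
move=> k kn; have [->|kn'] := eqVneq k n.+2; first by rewrite fn1 in E2; lia.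
by apply: arm_eq0 armle fn1 _ _; lia.
Qed.

Lemma cartanD_pos n : (2 < n)%N -> sign_nonreversing (@cartan (TypeD n)).
Proof.
case: n => [|[|[|n]]] // _.
apply: sign_nonreversing_intro => d H; apply: (@ext_eq0 n.+3).
have E k : (k < n.+3)%N -> ext d k.+1 * (2 * ext d k.+1 -
    if k.+1 == n.+3 then ext d k.-1 else if k.+2 == n.+3 then ext d k
    else ext d k + ext d k.+2 + (if k.+3 == n.+3 then ext d n.+3 else 0)) <= 0.
  by move=> kn; have := H (Ordinal kn); rewrite cartanD_sum -(ext_ord d).
have e0 : ext d 0 = 0 by [].
move: (ext d) e0 E => f f0 E {H}.
have arm k : (k < n)%N -> f k.+1 * (2 * f k.+1 - f k - f k.+2) <= 0.
  move=> kn; have := E k; rewrite !eqSS.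
  have -> : (k == n.+2) = false by lia.
  have -> : (k == n.+1) = false by lia.
  have -> : (k == n) = false by lia.
  by rewrite addr0 -addrA -opprD; apply; lia.
have armle := arm_le f0 arm.
have E3 := armle n (leqnn _).
have := E n; rewrite !eqSS eqxx.
have -> : (n == n.+2) = false by lia.
have -> : (n == n.+1) = false by lia.
have n3 : (n < n.+3)%N by lia.
move=> /(_ n3)/quad_le E0.
have := E n.+1; rewrite !eqSS eqxx.
have -> : (n == n.+1) = false by lia.
move=> /(_ (leqnSn _))/quad_le E1.
have := E n.+2; rewrite eqxx => /(_ (leqnn _))/quad_le /= E2.
(* Each of the two end labels carries at most half of |f (n+1)|, so the branching label yields |f
   (n+1)| <= |f n|, against the growth along the arm. *)
have fn1 : f n.+1 = 0 by nia.
move=> k kn; have [->|kn'] := eqVneq k n.+3; first by rewrite fn1 in E2; lia.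
have [->|kn2] := eqVneq k n.+2; first by rewrite fn1 in E1; lia.
by apply: arm_eq0 armle fn1 _ _; lia.
Qed.

(** Neighbour sums in the E_7 diagram; they serve E_6 as well, since [ext] vanishes at the label 7
    in rank 6. *)
Definition nbrE (f : nat -> int) (k : nat) : int :=
  match k with
  | 1 => f 3%N | 2 => f 4%N | 3 => f 1%N + f 4%N | 4 => f 2%N + f 3%N + f 5%N
  | 5 => f 4%N + f 6%N | 6 => f 5%N + f 7%N | 7 => f 6%N | _ => 0
  end.

Lemma cartanE6_sum (d : 'I_6 -> int) (j : 'I_6) :
  \sum_i d i * cartan (X := TypeE6) i j = 2 * ext d j.+1 - nbrE (ext d) j.+1.
Proof.
have f7 : ext d 7 = 0 by apply: ext_out.
have dE i : d i = ext d i.+1 by rewrite ext_ord.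
move: (ext d) f7 dE => f f7 dE.
case: j => [[|[|[|[|[|[|//]]]]]] jn];
rewrite !big_ord_recl !big_ord0 !dE /cartan /coxeter_matrix -!val_eqE /= ?f7; ring.
Qed.

Lemma cartanE7_sum (d : 'I_7 -> int) (j : 'I_7) :
  \sum_i d i * cartan (X := TypeE7) i j = 2 * ext d j.+1 - nbrE (ext d) j.+1.
Proof.
have dE i : d i = ext d i.+1 by rewrite ext_ord.
move: (ext d) dE => f dE.
case: j => [[|[|[|[|[|[|[|//]]]]]]] jn];
rewrite !big_ord_recl !big_ord0 !dE /cartan /coxeter_matrix -!val_eqE /=; ring.
Qed.

Lemma nbrE_pos (f : nat -> int) : f 0%N = 0 ->
  (forall k, (k < 7)%N -> f k.+1 * (2 * f k.+1 - nbrE f k.+1) <= 0) ->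
  forall k, (k <= 7)%N -> f k = 0.
Proof.
move=> f0 H.
have := quad_le (H 0%N isT); have := quad_le (H 1%N isT).
have := quad_le (H 2%N isT); have := quad_le (H 3%N isT).
have := quad_le (H 4%N isT); have := quad_le (H 5%N isT).
have := quad_le (H 6%N isT); rewrite /nbrE => h7 h6 h5 h4 h3 h2 h1.
by case=> [|[|[|[|[|[|[|[|//]]]]]]]] _; [done|..]; lia.
Qed.

Lemma cartanE6_pos : sign_nonreversing (@cartan TypeE6).
Proof.
apply: sign_nonreversing_intro => d H; apply: (@ext_eq0 6) => k k6.
apply: (nbrE_pos (f := ext d)) => //; last exact: leq_trans k6 _.
move=> l l7; have [l6|l6] := ltnP l 6.
  by have := H (Ordinal l6); rewrite cartanE6_sum -(ext_ord d).
by rewrite (@ext_out 6 d l.+1 l6) mul0r.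
Qed.

Lemma cartanE7_pos : sign_nonreversing (@cartan TypeE7).
Proof.
apply: sign_nonreversing_intro => d H; apply: (@ext_eq0 7) => k k7.
apply: (nbrE_pos (f := ext d)) => // l l7.
by have := H (Ordinal l7); rewrite cartanE7_sum -(ext_ord d).
Qed.

Arguments ext : simpl never.

(** * Explicit minuscule orbits *)

Local Notation hx h := (ext (fun i => (h i)%:Z)).

Definition supported (n : nat) (f : nat -> int) : Prop :=
  f 0%N = 0 /\ forall k, (n < k)%N -> f k = 0.

Lemma supported_hx n (h : 'I_n -> nat) : supported n (hx h).
Proof. by split=> // k nk; apply: ext_out. Qed.

(** Coefficients become functions of all natural labels, zero outside 1, ..., rank, so that
    invariants and pairings can be given by uniform formulas and checked by arithmetic. *)
Lemma model_exists (X : cartan_type) (p N : nat) (Q : (nat -> int) -> Prop)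
    (w : (nat -> int) -> nat -> int) :
  sign_nonreversing (@cartan X) ->
  (forall (h : 'I_(rank X) -> nat) j, coweight p h j = w (hx h) j) ->
  (forall f, (forall k, f k = 0) -> Q f) ->
  (forall f f' a, (a < rank X)%N -> supported (rank X) f -> Q f -> w f a = 1 ->
    (forall k, f' k = f k + (k == a.+1)%:Z) -> Q f') ->
  (forall f, supported (rank X) f -> Q f -> forall k, (k <= rank X)%N ->
    f k <= N%:Z) ->
  (forall f a, (a < rank X)%N -> supported (rank X) f -> Q f ->
    -1 <= w f a <= 1) ->
  exists M : minuscule (@cartan X),
  [/\ forall i, wt (top M) i = (val i == p)%:Z,
      forall x : M, Q (hx (dep x)) &
      forall (x : M) i, wt x i = w (hx (dep x)) i].
Proof.
move=> pos cowE Q0 QS QN Qw.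
have [||||M [Mtop MQ Mw]] := @minuscule_exists X p N (fun h => Q (hx h)) pos.
- by move=> h h0; apply: Q0 => -[|k] //; rewrite /ext; case: insub => //= i; rewrite h0.
- move=> h h' i Qh hi /ext_add E; rewrite cowE in hi.
  exact: QS (ltn_ord i) (supported_hx h) Qh hi E.
- move=> h Qh i; have := QN _ (supported_hx h) Qh i.+1 (ltn_ord i).
  by rewrite ext_ord; lia.
- by move=> h Qh i; rewrite cowE; apply: Qw (supported_hx h) Qh.
by exists M; split=> // x i; rewrite Mw cowE.
Qed.

(* In the classical types, the invariants describe the coordinates of the weight
   in the basis eps_i of Bourbaki; here they are 0 or 1. *)
Lemma minusculeA n p : (p < n)%N -> exists M : minuscule (@cartan (TypeA n)),
  forall i, wt (top M) i = (val i == p)%:Z.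
Proof.
move=> pn; have [||||||M [Mtop _ _]] := @model_exists (TypeA n) p n
  (fun f => forall k, (k <= n)%N -> 0 <= (k <= p)%N%:Z - f k.+1 + f k <= 1)
  (fun f j => (j == p :> nat)%:Z - 2 * f j.+1 + f j + f j.+2);
  last by exists M.
- exact: cartanA_pos.
- by move=> h j; rewrite /coweight cartanA_sum; ring.
- by move=> f f0 k kn; rewrite !f0; lia.
- move=> f f' a /= an _ Qf fa E k kn; rewrite !E.
  have := Qf k kn; have := Qf a (ltnW an); have := Qf a.+1 an.
  have [->|] := eqVneq k a.+1; first by lia.
  by have [->|] := eqVneq k a; lia.
- move=> f [f0 _] Qf k /= kn; suff: f k <= k%:Z by lia.
  elim: k kn => [|k IH] kn; first by rewrite f0.
  by have := IH (ltnW kn); have := Qf k (ltnW kn); lia.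
- move=> f a /= an _ Qf; have := Qf a (ltnW an); have := Qf a.+1 an.
  by lia.
Qed.

Lemma minusculeC n : (1 < n)%N -> exists M : minuscule (@cartan (TypeC n)),
  [/\ forall i, wt (top M) i = (val i == n.-1)%:Z,
  forall (x : M) i,
    wt x i = (if i.+1 == n then 1 - 2 * hx (dep x) n + 2 * hx (dep x) n.-1
              else hx (dep x) i - 2 * hx (dep x) i.+1 + hx (dep x) i.+2) &
  forall (x : M) k, (k < n)%N ->
    0 <= 1 - hx (dep x) k.+1 + hx (dep x) k <= 1].
Proof.
case: n => [|[|n]] // _.
have [||||||M [Mtop MQ Mw]] := @model_exists (TypeC n.+2) n.+1 n.+2
  (fun f => forall k, (k < n.+2)%N -> 0 <= 1 - f k.+1 + f k <= 1)
  (fun f j => if j.+1 == n.+2 then 1 - 2 * f n.+2 + 2 * f n.+1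
              else f j - 2 * f j.+1 + f j.+2); last by exists M; split.
- exact: cartanC_pos.
- move=> h j; rewrite /coweight cartanC_sum !eqSS /=.
  have /= [_ /(_ n.+3 (leqnn _))] := supported_hx h; move: (hx h) => f hn.
  by case: eqP => [->|_]; lia.
- by move=> f f0 k kn; rewrite !f0; lia.
- move=> f f' a /= an _ Qf fa E k kn; rewrite !E.
  have := Qf k kn; have := Qf a an; have := Qf a.+1.
  move: fa; have [[->]|an1] := eqVneq a.+1 n.+2.
    by have [->|] := eqVneq k n.+1; lia.
  have [->|] := eqVneq k a.+1; first by lia.
  by have [->|] := eqVneq k a; lia.
- move=> f [f0 _] Qf k /= kn; suff: f k <= k%:Z by lia.
  elim: k kn => [|k IH] kn; first by rewrite f0.
  by have := IH (ltnW kn); have := Qf k kn; lia.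
- move=> f a /= an [_ fn] Qf; have := Qf a an.
  have [[->]|an1] := eqVneq a.+1 n.+2; first by lia.
  by have := Qf a.+1; lia.
Qed.

Lemma minusculeDspin n : (2 < n)%N -> exists M : minuscule (@cartan (TypeD n)),
  forall i, wt (top M) i = (val i == n.-1)%:Z.
Proof.
case: n => [|[|[|n]]] // _.
(* The labels n + 2 and n + 3 carry eps_(n+2) - eps_(n+3) and eps_(n+2) + eps_(n+3), so both enter
   the last two coordinates. *)
have [||||||M [Mtop _ _]] := @model_exists (TypeD n.+3) n.+2 n.+3
  (fun f => [/\ forall k, (k <= n)%N -> 0 <= 1 - f k.+1 + f k <= 1,
     0 <= 1 - f n.+2 - f n.+3 + f n.+1 <= 1 & 0 <= 1 + f n.+2 - f n.+3 <= 1])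
  (fun f j => if j == n.+2 then 1 - 2 * f n.+3 + f n.+1
              else if j == n.+1 then - 2 * f n.+2 + f n.+1
              else f j - 2 * f j.+1 + f j.+2 + (if j == n then f n.+3 else 0));
  last by exists M.
- exact: cartanD_pos.
- move=> h j; rewrite /coweight cartanD_sum !eqSS /=.
  move: (hx h) => f; case: eqP => [->|_] /=; first by lia.
  case: eqP => [->|_]; first by lia.
  by case: eqP => _; lia.
- by move=> f f0; split=> [k kn||]; rewrite !f0; lia.
- move=> f f' a /= an _ [Qf Q1 Q2] fa E.
  suff H k : (k <= n)%N -> 0 <= 1 - f' k.+1 + f' k <= 1.
    split=> //; move: fa Q1 Q2; rewrite !E.
      have [->|a2] := eqVneq a n.+2; first by lia.
      have [->|a1] := eqVneq a n.+1; first by lia.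
      by have := Qf n (leqnn _); have [->|a0] := eqVneq a n; lia.
    have [->|a2] := eqVneq a n.+2; first by lia.
    by have [->|a1] := eqVneq a n.+1; lia.
  move=> kn; have := Qf k kn; have := Qf a; have := Qf a.+1.
  move: kn fa Q1 Q2; rewrite !E.
  have [->|a2] := eqVneq a n.+2; first by lia.
  have [->|a1] := eqVneq a n.+1; first by lia.
  have [->|ka] := eqVneq k a.+1; first by have [->|a0] := eqVneq a n; lia.
  by have [->|ka'] := eqVneq k a; have [a0|a0] := eqVneq a n; rewrite ?a0; lia.
- move=> f [f0 _] [Qf Q1 Q2] k /= kn.
  have H l : (l <= n.+1)%N -> f l <= l%:Z.
    elim: l => [|l IH] ln; first by rewrite f0.
    by have := IH (ltnW ln); have := Qf l ln; lia.
  have := H n.+1 (leqnn _).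
  have [->|k2] := eqVneq k n.+2; first by lia.
  have [->|k3] := eqVneq k n.+3; first by lia.
  by have := H k; lia.
- move=> f a /= an _ [Qf Q1 Q2]; have := Qf a; have := Qf a.+1; have := Qf n.
  have [->|a2] := eqVneq a n.+2; first by lia.
  have [->|a1] := eqVneq a n.+1; first by lia.
  by have [->|a0] := eqVneq a n; lia.
Qed.

(* The weights +-eps_i form a chain, and [t] is the distance to the top. *)
Lemma minusculeB n : (1 < n)%N -> exists M : minuscule (@cartan (TypeB n)),
  (forall i, wt (top M) i = (val i == 0)%:Z) /\
  forall x : M, exists t, forall k, hx (dep x) k =
    ((0 < k <= n) && (k <= t))%N%:Z + ((n.*2 <= k + t) && (k < n))%N%:Z.
Proof.
case: n => [|[|n]] // _.
(* With r the rank, the chain uses the labels 1, ..., r and then r - 1, ..., 1 again: one indicator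
   for each pass, hence coefficients at most 2. *)
have [||||||M [Mtop MQ _]] := @model_exists (TypeB n.+2) 0 2
  (fun f => exists2 t, (t < n.+2.*2)%N & forall k, f k =
    ((0 < k <= n.+2) && (k <= t))%N%:Z +
    ((n.+2.*2 <= k + t) && (k < n.+2))%N%:Z)
  (fun f j => (j == 0)%:Z - 2 * f j.+1 + f j +
     (if j == n then 2 else 1) * f j.+2).
- exact: cartanB_pos.
- move=> h j; rewrite /coweight cartanB_sum !eqSS /=.
  by move: (hx h) => f; case: eqP => _; lia.
- move=> f f0; exists 0; first by lia.
  by move=> k; rewrite f0; lia.
- move=> f f' a /= an _ [t tn fE] fa E.
  have ta : (t < n.+2)%N /\ a = t \/ (n.+2 <= t)%N /\ (a + t = n.+1.*2)%N.
    by move: fa; rewrite !fE; case: ifP; clear -an tn; lia.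
  exists t.+1; first by clear -ta an; lia.
  by move=> k; rewrite E fE; case: ta => -[tn' at_]; clear -tn' at_ an; lia.
- by move=> f _ [t _ fE] k _; rewrite fE; lia.
- move=> f a /= an _ [t tn fE]; rewrite !fE.
  by do ?[case: ifP => ?]; lia.
by exists M; split=> // x; have [t _ xE] := MQ x; exists t.
Qed.

(* The four cases are the weights eps_(t+1) with t + 1 < n, eps_n, -eps_n and
   -eps_t. *)
Lemma minusculeDvec n : (2 < n)%N -> exists M : minuscule (@cartan (TypeD n)),
  forall i, wt (top M) i = (val i == 0)%:Z.
Proof.
case: n => [|[|[|n]]] // _.
have [||||||M [Mtop _ _]] := @model_exists (TypeD n.+3) 0 2
  (fun f =>
   [\/ exists2 t, (t <= n.+1)%N & forall k, f k = ((0 < k) && (k <= t))%N%:Z,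
       forall k, f k = ((0 < k) && (k <= n.+2))%N%:Z,
       forall k, f k = ((0 < k) && (k <= n.+1))%N%:Z + (k == n.+3)%:Z |
       exists2 t, (0 < t)%N & forall k, f k = ((0 < k) && (k <= n.+3))%N%:Z +
         ((t <= k) && (k <= n.+1))%N%:Z])
  (fun f j => (j == 0)%:Z - 2 * f j.+1 +
              (if j == n.+2 then f n.+1
               else if j == n.+1 then f n.+1
               else f j + f j.+2 + (if j == n then f n.+3 else 0)));
  last by exists M.
- exact: cartanD_pos.
- move=> h j; rewrite /coweight cartanD_sum !eqSS /=.
  move: (hx h) (nat_of_ord j) => f a; have [->|_] := eqVneq a n.+2; first by rewrite /=; lia.
  have [->|_] := eqVneq a n.+1; first by lia.
  by have [->|_] := eqVneq a n; lia.
- move=> f f0; constructor 1; exists 0 => // k.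
  by rewrite f0; lia.
- move=> f f' a /= an _ [[t tn fE]|fE|fE|[t t0 fE]] fa E.
  + have [tn1|tn1] := eqVneq t n.+1.
      have [aE|aE] := eqVneq a n.+1.
        by constructor 2 => k; rewrite E fE; lia.
      constructor 3 => k; rewrite E fE; move: fa; rewrite !fE.
      by do ?[case: ifP => ?]; lia.
    constructor 1; exists t.+1; first by lia.
    move=> k; rewrite E fE; move: fa; rewrite !fE.
    by do ?[case: ifP => ?]; lia.
  + constructor 4; exists n.+2 => // k; rewrite E fE; move: fa; rewrite !fE.
    by do ?[case: ifP => ?]; lia.
  + constructor 4; exists n.+2 => // k; rewrite E fE; move: fa; rewrite !fE.
    by do ?[case: ifP => ?]; lia.
  + constructor 4; have [tn|tn] := leqP t n.+2.
      exists t.-1; first by move: fa; rewrite !fE; do ?[case: ifP => ?]; lia.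
      move=> k; rewrite E fE; move: fa; rewrite !fE.
      by do ?[case: ifP => ?]; lia.
    exists n.+1 => // k; rewrite E fE; move: fa; rewrite !fE.
    by do ?[case: ifP => ?]; lia.
- by move=> f _ [[t tn fE]|fE|fE|[t t0 fE]] k _; rewrite fE; lia.
- move=> f a /= an _ [[t tn fE]|fE|fE|[t t0 fE]]; rewrite !fE;
  by do ?[case: ifP => ?]; lia.
Qed.

(** * The exceptional orbits, by enumeration *)

Definition nbrN (v : nat -> nat) (k : nat) : nat :=
  match k with
  | 1 => v 3 | 2 => v 4 | 3 => v 1 + v 4 | 4 => v 2 + v 3 + v 5
  | 5 => v 4 + v 6 | 6 => v 5 + v 7 | 7 => v 6 | _ => 0
  end%N.

Section OrbitList.
Variables (n p : nat).

(* Vectors list the values at the labels [0, ..., n]; the entry at the dummy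
   label [0] stays [0]. *)
Definition lowerable (v : seq nat) (a : nat) : bool :=
  ((a == p) + nbrN (nth 0%N v) a.+1 == (nth 0 v a.+1).*2.+1)%N.

Definition lower_all (L : seq (seq nat)) : seq (seq nat) :=
  undup (L ++ [seq incr_nth v a.+1 | v <- L, a <- [seq a <- iota 0 n | lowerable v a]]).

Definition orbit_list (m : nat) := iter m lower_all [:: nseq n.+1 0%N].

(** The pairing at a is y - 2x; the inequalities bound it by 1 in absolute value, and the
    implication says that the list is closed under lowering. *)
Definition orbit_check (L : seq (seq nat)) (N : nat) : bool :=
  (all (fun v =>
    [&& nth 0 v 0 == 0, all (fun x => x <= N) v, size v == n.+1 &
     all (fun a => let x := nth 0 v a.+1 in
       let y := (a == p) + nbrN (nth 0%N v) a.+1 in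
       [&& y <= x.*2.+1, x.*2 <= y.+1 &
        (y == x.*2.+1) ==> (incr_nth v a.+1 \in L)]) (iota 0 n)]) L)%N.
End OrbitList.

Lemma nbrE_nbrN (v : nat -> nat) k :
  nbrE (fun k => (v k)%:Z) k = (nbrN v k)%:Z.
Proof. by case: k => [|[|[|[|[|[|[|[|k]]]]]]]]. Qed.

Lemma eq_nbrE (f f' : nat -> int) k : (forall k, f k = f' k) ->
  nbrE f k = nbrE f' k.
Proof. by move=> E; case: k => [|[|[|[|[|[|[|[|k]]]]]]]] //=; rewrite ?E. Qed.

Lemma minuscule_list (X : cartan_type) (p N : nat) (L : seq (seq nat)) :
  sign_nonreversing (@cartan X) ->
  (forall (d : 'I_(rank X) -> int) j, \sum_i d i * cartan i j =
     2 * ext d j.+1 - nbrE (ext d) j.+1) ->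
  nseq (rank X).+1 0%N \in L -> orbit_check (rank X) p L N ->
  exists M : minuscule (@cartan X), forall i, wt (top M) i = (val i == p)%:Z.
Proof.
move=> pos sumE L0 /allP LP.
have [|||||M [Mtop _ _]] := @model_exists X p N
  (fun f => exists2 v, v \in L & forall k, f k = (nth 0%N v k)%:Z)
  (fun f j => (j == p)%:Z - 2 * f j.+1 + nbrE f j.+1) pos; last by exists M.
- by move=> h j; rewrite /coweight sumE; ring.
- move=> f f0; exists (nseq (rank X).+1 0%N) => // k.
  by rewrite f0 nth_nseq; case: ifP.
- move=> f f' a an _ [v vL fE] fa E.
  have /and4P[_ _ /eqP sv /allP /(_ a)] := LP v vL.
  rewrite mem_iota add0n an => /(_ isT) /and3P[_ _ /implyP H].
  exists (incr_nth v a.+1).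
    apply: H; move: fa; rewrite (eq_nbrE _ fE) fE nbrE_nbrN; lia.
  by move=> k; rewrite E fE nth_incr_nth eq_sym addnC PoszD.
- move=> f _ [v vL fE] k _; rewrite fE.
  have /and4P[_ /allP vN _ _] := LP v vL.
  have [kv|kv] := ltnP k (size v); last by rewrite nth_default.
  by have := vN _ (mem_nth 0%N kv).
- move=> f a an _ [v vL fE]; have /and4P[_ _ _ /allP /(_ a)] := LP v vL.
  rewrite mem_iota add0n an => /(_ isT) /and3P[H1 H2 _].
  by rewrite (eq_nbrE _ fE) fE nbrE_nbrN; lia.
Qed.

Lemma minusculeE6 : exists M : minuscule (@cartan TypeE6),
  forall i, wt (top M) i = (val i == 0)%:Z.
Proof.
(* 16 is the dimension of the homogeneous space, hence the greatest height; 6 bounds the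
   coefficients. *)
apply: (@minuscule_list TypeE6 0 6 (orbit_list 6 0 16)).
- exact: cartanE6_pos.
- exact: cartanE6_sum.
- by vm_compute.
- by vm_compute.
Qed.

Lemma minusculeE7 : exists M : minuscule (@cartan TypeE7),
  forall i, wt (top M) i = (val i == 6)%:Z.
Proof.
(* The greatest height is 27; the last 6 before the list is the coefficient of alpha_4 at the lowest
   weight, the largest that occurs. *)
apply: (@minuscule_list TypeE7 6 6 (orbit_list 7 6 27)).
- exact: cartanE7_pos.
- exact: cartanE7_sum.
- by vm_compute.
- by vm_compute.
Qed.

(** * From type C_n to type D_(n+1), and from type B_n to type A_(2n-1) *)

(* In type C_n, [a] is the label n - 1 and [l] the label n. *)
Section TypeCRecursion.
Variables (I : finType) (A : I -> I -> int) (M : minuscule A).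
Variables (R : M -> M -> {poly int}) (RP : R_system R).
Variables (a l : I).
Hypotheses (al : a != l) (Aal : A a l = -2) (Ala : A l a = -1).
Hypothesis A0l : forall i, i != a -> i != l -> A i l = 0.
Hypothesis Asl : forall i j, i != l -> j != l -> i != j ->
  (A i j = 0 /\ A j i = 0) \/ (A i j = -1 /\ A j i = -1).
Hypothesis wtl : forall x : M, wt x l <> 0.
Implicit Types (u v x : M) (i j k : I).

Let RN1 u v i (vi : wt v i = -1) (ui : wt u i = -1) :
  R u v = R (act i u) (act i v).
Proof. by have [_ _ /(_ u v i vi)[-> //]] := RP. Qed.
Let R0 u v i (vi : wt v i = -1) (ui : wt u i = 0) :
  R u v = 'X * R u (act i v).
Proof. by have [_ _ /(_ u v i vi)[_ -> //]] := RP. Qed.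
Let R1 u v i (vi : wt v i = -1) (ui : wt u i = 1) :
  R u v = ('X - 1) * R u (act i v) + 'X * R (act i u) (act i v).
Proof. by have [_ _ /(_ u v i vi)[_ _ -> //]] := RP. Qed.

(** The commuting expansion of [R_bottom_step] with the required equations as hypotheses, so that it
    applies at k = l, where no pairing is 0. *)
Lemma R_commute_step u v j k : A j k = 0 -> wt v j = -1 ->
  R u (act j v) = 'X * R (act k u) (act j v) ->
  R (act j u) (act j v) = 'X * R (act k (act j u)) (act j v) ->
  R u v = 'X * R (act k u) v.
Proof.
move=> Ajk vj E1 E2; have Akj := cartan_eq0 M Ajk.
have uj' : wt (act k u) j = wt u j by rewrite wt_act0.
case: (wtP u j) => uj.
- by rewrite !(RN1 vj) ?uj' // (act_comm _ Ajk).
- by rewrite !(R0 vj) ?uj' // E1.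
- by rewrite !(R1 vj) ?uj' // (act_comm _ Ajk) E1 E2; ring.
Qed.

Let wt_al x : wt (act a x) l = wt x l + 2 * wt x a.
Proof. by rewrite wt_act Aal; ring. Qed.
Let wt_la x : wt (act l x) a = wt x a + wt x l.
Proof. by rewrite wt_act Ala; ring. Qed.
Let wt_ll x : wt (act l x) l = - wt x l.
Proof. exact: wt_actK. Qed.
Let wt_aa x : wt (act a x) a = - wt x a.
Proof. exact: wt_actK. Qed.

Let parity x := odd (dep x a).

(** The double bond forces u to pair to -1 with [l]. Then v descends by l, a, l to a weight that
    pairs to 0 with [a] again, where induction applies. *)
Lemma R_type_C_step_a u v : wt u a = 1 -> wt v a = 0 -> wt v l = -1 ->
  (forall u' v', (height v' < height v)%N -> wt u' a = 1 -> wt v' a = 0 ->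
     R u' v' = 'X * R (act a u') v') ->
  R u v = 'X * R (act a u) v.
Proof.
move=> ua va vl IH.
have ul : wt u l = -1.
  by have := wt_bound (act a u) l; rewrite wt_al; case: (wtP u l) => ->; lia.
have h1 := height_act l v; have h2 := height_act a (act l v).
have h3 := height_act l (act a (act l v)).
rewrite ?wt_al ?wt_la ?wt_ll ?wt_aa va vl in h1 h2 h3.
rewrite (RN1 vl ul) [R (act a u) v](R1 vl); last by rewrite wt_al; lia.
have lva : wt (act l v) a = -1 by rewrite wt_la; lia.
rewrite (R0 lva (u := act l u)); last by rewrite wt_la; lia.
rewrite (RN1 lva (u := act a u)); last by rewrite wt_aa; lia.
rewrite actK (R0 lva (u := act l (act a u))); last first.
  by rewrite wt_la wt_aa wt_al; lia.
have alvl : wt (act a (act l v)) l = -1 by rewrite wt_al wt_la wt_ll; lia.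
rewrite (R1 alvl (u := act l u)); last by rewrite wt_ll; lia.
rewrite (RN1 alvl (u := u)) // (RN1 alvl (u := act l (act a u))); last first.
  by rewrite wt_ll wt_al; lia.
rewrite !actK (IH u); first by ring.
- by lia.
- by [].
- by rewrite wt_la wt_aa wt_al wt_la wt_ll; lia.
Qed.

(** Different parities mean that [l] stands for different end labels of D_(n+1) at u and at v. The
    equation is [R_bottom] for the end label active at u, which pairs to 0 with v. *)
Lemma R_type_C_step_l u v : wt u l = 1 -> wt v l = 1 -> wt v a = -1 ->
  parity u != parity v ->
  (forall u' v', (height v' < height v)%N -> wt u' a = 1 -> wt v' a = 0 ->
     R u' v' = 'X * R (act a u') v') ->
  (forall u' v', (height v' < height v)%N -> wt u' l = 1 -> wt v' l = 1 ->
     parity u' != parity v' -> R u' v' = 'X * R (act l u') v') ->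
  R u v = 'X * R (act l u) v.
Proof.
move=> ul vl va neq IHa IHl.
have avl : wt (act a v) l = -1 by rewrite wt_al; lia.
have h1 := height_act a v; have h2 := height_act l (act a v).
rewrite ?wt_al ?wt_la ?wt_ll ?wt_aa va vl in h1 h2.
have lt_v : (height (act l (act a v)) < height v)%N by lia.
have lava : wt (act l (act a v)) a = 0 by rewrite wt_la wt_aa wt_al; lia.
have lavl : wt (act l (act a v)) l = 1 by rewrite wt_ll wt_al; lia.
have dla x : dep (act l x) a = dep x a.
  by have := dep_act l x a; rewrite eq_sym (negbTE al); lia.
have daa x : (dep (act a x) a)%:Z = (dep x a)%:Z + wt x a.
  by have := dep_act a x a; rewrite eqxx.
have par_v : parity (act l (act a v)) = ~~ parity v.
  by rewrite /parity dla; have := daa v; rewrite va; lia.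
case: (wtP u a) => ua; last first.
- by have := wt_bound (act a u) l; rewrite wt_al ua ul.
- have lul : wt (act l u) l = -1 by rewrite wt_ll ul.
  have lua : wt (act l u) a = 1 by rewrite wt_la; lia.
  have alul : wt (act a (act l u)) l = 1 by rewrite wt_al; lia.
  have E1 := IHa _ _ lt_v lua lava.
  have E2 : R (act a (act l u)) (act l (act a v)) =
      'X * R (act l (act a (act l u))) (act l (act a v)).
    apply: IHl => //; rewrite par_v.
    have -> : parity (act a (act l u)) = ~~ parity u.
      by rewrite /parity; have := daa (act l u); rewrite dla lua; lia.
    by case: (parity u) neq; case: (parity v).
  rewrite (R0 va ua) (R1 va lua) (RN1 avl lul) actK (R1 avl ul).
  by rewrite (R1 avl alul) E1 E2; ring.
have aul : wt (act a u) l = -1 by rewrite wt_al; lia.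
have lau_l : wt (act l (act a u)) l = 1 by rewrite wt_ll; lia.
have aua : wt (act a u) a = 1 by rewrite wt_aa; lia.
rewrite (RN1 va ua) (RN1 avl aul) IHl //; last first.
  have -> : parity (act l (act a u)) = ~~ parity u.
    by rewrite /parity dla; have := daa u; rewrite ua; lia.
  by rewrite par_v; case: (parity u) neq; case: (parity v).
rewrite actK IHa // actK (R0 va (u := act l u)); last by rewrite wt_la; lia.
by rewrite (RN1 avl (u := act l u)) ?wt_ll ?ul // actK.
Qed.

Lemma R_type_C u v :
  (forall k, k != l -> wt u k = 1 -> wt v k = 0 -> R u v = 'X * R (act k u) v) /\
  (wt u l = 1 -> wt v l = 1 -> parity u != parity v ->
     R u v = 'X * R (act l u) v).
Proof.
have [n] := ubnP (height v); elim: n u v => // n IHn u v lt_n.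
have IHk u' v' k : (height v' < height v)%N -> k != l -> wt u' k = 1 ->
    wt v' k = 0 -> R u' v' = 'X * R (act k u') v'.
  by move=> lt_v; have [H _] := IHn u' v' (leq_trans lt_v lt_n); apply: H.
have IHl u' v' : (height v' < height v)%N -> wt u' l = 1 -> wt v' l = 1 ->
    parity u' != parity v' -> R u' v' = 'X * R (act l u') v'.
  by move=> lt_v; have [_ H] := IHn u' v' (leq_trans lt_v lt_n); apply: H.
have [vE|/wt_descent[j vj]] := eqVneq v (top M).
  have [Rle _ _] := RP.
  have nle w : w != v -> ~~ wle w v.
    by apply: contra => wv; apply/eqP/wle_anti; rewrite // vE wle_top.
  split=> [k _ uk vk|ul vl neq].
    rewrite (Rle u) ?(Rle (act k u)) ?mulr0 // nle //; apply/eqP => E.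
      by move: vk; rewrite -E wt_actK uk.
    by move: vk; rewrite -E uk.
  rewrite (Rle u) ?(Rle (act l u)) ?mulr0 // nle //.
    by apply/eqP => E; move: vl; rewrite -E wt_ll ul.
  by apply: contraNneq neq => ->.
have hj := height_act j v; rewrite vj in hj.
have lt_jv : (height (act j v) < height v)%N by lia.
split=> [k kl uk vk|ul vl neq].
  have jk : j != k by apply/eqP => E; move: vk; rewrite -E vj.
  have [jl|jl] := eqVneq j l.
    rewrite jl in vj.
    have [ka|ka] := eqVneq k a.
      rewrite ka in uk vk *; apply: R_type_C_step_a => // u' v' lt_v.
      exact: IHk.
    apply: (R_bottom_step RP vj uk vk) => [|u' v' i lt_v].
      by left; split; [apply: (cartan_eq0 M)|]; apply: A0l.
    by case/orP=> /eqP ->; [move=> _ /wtl | apply: IHk].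
  apply: (R_bottom_step RP vj uk vk) => [|u' v' i lt_v]; first exact: Asl.
  by case/orP=> /eqP ->; apply: IHk.
have jl : j != l by apply/eqP => E; move: vl; rewrite -E vj.
have [ja|ja] := eqVneq j a.
  rewrite ja in vj; apply: R_type_C_step_l => // u' v' lt_v; exact: IHk.
have Ajl := A0l ja jl; have Alj := cartan_eq0 M Ajl.
have par_j x : parity (act j x) = parity x.
  rewrite /parity; congr (odd _); have := dep_act j x a.
  by rewrite (negbTE ja); lia.
by apply: (R_commute_step Ajl vj); apply: IHl; rewrite ?par_j ?wt_act0.
Qed.

End TypeCRecursion.

Lemma cartan_simply_laced (X : cartan_type) :
  (forall i j : 'I_(rank X), coxeter_matrix i j != 4%N) ->
  simply_laced (@cartan X).
Proof.
move=> no4 i j /cartanP[[_ -> ->]|[_ -> ->]|[m4 _ _]|[m4 _ _]].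
- by left.
- by right.
- by have := no4 i j; rewrite m4.
- by have := no4 i j; rewrite m4.
Qed.

(** The values 1 and -1 of w force h = c and h = c + 1, so the parity of c tells which half of h
    moves. *)
Lemma half_step (h h' c : nat) (w : int) :
  w = 1 - 2 * h%:Z + 2 * c%:Z -> w = 1 \/ w = -1 -> h'%:Z = h%:Z + w ->
  (uphalf h')%:Z = (uphalf h)%:Z + (if odd c then 0 else w) /\
  (h'./2)%:Z = (h./2)%:Z + (if odd c then w else 0).
Proof. by case: ifP; lia. Qed.

Lemma half_inj n n' : uphalf n = uphalf n' -> n./2 = n'./2 -> n = n'.
Proof. by lia. Qed.

Lemma half_weight (h c : nat) (w : int) :
  w = 1 - 2 * h%:Z + 2 * c%:Z -> 0 <= 1 - h%:Z + c%:Z <= 1 ->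
  (if ~~ odd c then w else 0) = 1 - (2 * (uphalf h)%:Z - c%:Z) /\
  (if odd c then w else 0) = - (2 * (h./2)%:Z - c%:Z).
Proof. by move=> -> b; case: (boolP (odd c)) => oc /=; split; lia. Qed.

Lemma half_leq n n' :
  (uphalf n <= uphalf n')%N -> (n./2 <= n'./2)%N -> (n <= n')%N.
Proof. by lia. Qed.

Lemma leq_half n n' : (n <= n')%N -> (uphalf n <= uphalf n')%N /\ (n./2 <= n'./2)%N.
Proof. by lia. Qed.

(** * The orbit of C_n with the labels of D_(n+1) *)

Section TypeCFold.
Variable m : nat.
Variable M : minuscule (@cartan (TypeC m.+2)).
Hypothesis wtE : forall (x : M) (i : 'I_m.+2), wt x i =
  if i.+1 == m.+2 then 1 - 2 * hx (dep x) m.+2 + 2 * hx (dep x) m.+1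
  else hx (dep x) i - 2 * hx (dep x) i.+1 + hx (dep x) i.+2.
Hypothesis bits : forall (x : M) k, (k < m.+2)%N ->
  0 <= 1 - hx (dep x) k.+1 + hx (dep x) k <= 1.
Implicit Types (x y u v : M) (i j : 'I_m.+3).

Let a : 'I_m.+2 := inord m.
Let l : 'I_m.+2 := ord_max.
Let aE : a = m :> nat.
Proof. by rewrite inordK. Qed.

Definition fold_label i : 'I_m.+2 := inord (minn i m.+1).

Lemma fold_labelE i : fold_label i = minn i m.+1 :> nat.
Proof. by rewrite inordK //; lia. Qed.

(* The label n of type C_n alternates between the labels n and n + 1 of type
   D_(n+1), according to the parity of the coefficient at the label n - 1. *)
Definition fold_active x i : bool :=
  if i == m.+1 :> nat then ~~ odd (dep x a)
  else if i == m.+2 :> nat then odd (dep x a) else true.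

Definition fold_wt x i : int := if fold_active x i then wt x (fold_label i) else 0.
Definition fold_act i x : M := if fold_active x i then act (fold_label i) x else x.
(** The end labels of D_(n+1) share the coefficient at [l]. They alternate, starting with [m.+1],
    which therefore takes the larger half. *)
Definition fold_dep x i : nat :=
  if i == m.+1 :> nat then uphalf (dep x l)
  else if i == m.+2 :> nat then (dep x l)./2 else dep x (fold_label i).

Let wt_l x : wt x l = 1 - 2 * (dep x l)%:Z + 2 * (dep x a)%:Z.
Proof.
by rewrite wtE eqxx -(ext_ord (fun k => (dep x k)%:Z) l)
  -(ext_ord (fun k => (dep x k)%:Z) a) aE.
Qed.

Let wt_l1 x : wt x l = 1 \/ wt x l = -1.
Proof. by case: (wtP x l) => E; [right| |left] => //; have := wt_l x; lia. Qed.

Lemma fold_labelP i :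
  [\/ i = m.+1 :> nat /\ fold_label i = l,
      i = m.+2 :> nat /\ fold_label i = l |
      [/\ i != m.+1 :> nat, i != m.+2 :> nat & fold_label i = i :> nat]].
Proof.
have := ltn_ord i; have := fold_labelE i.
have [E|n1] := eqVneq (i : nat) m.+1.
  by constructor 1; split=> //; apply: val_inj; rewrite /= fold_labelE E /=; lia.
have [E|n2] := eqVneq (i : nat) m.+2.
  by constructor 2; split=> //; apply: val_inj; rewrite /= fold_labelE E /=; lia.
by move=> E lt_i; constructor 3; split=> //; rewrite E; lia.
Qed.

Lemma fold_wt_bound x i : -1 <= fold_wt x i <= 1.
Proof. by rewrite /fold_wt; case: ifP => // _; apply: wt_bound. Qed.

Lemma fold_dep_act i x j : (fold_dep (fold_act i x) j)%:Z =
  (fold_dep x j)%:Z + (if i == j then fold_wt x i else 0).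
Proof.
rewrite /fold_act /fold_wt; case: ifP => act_i; last first.
  by case: (i == j); rewrite addr0.
have dE k : (dep (act (fold_label i) x) k)%:Z =
    (dep x k)%:Z + (if fold_label i == k then wt x (fold_label i) else 0).
  exact: dep_act.
have ijE : (i == j) = (i == j :> nat) by [].
rewrite /fold_dep ijE; have dl := dE l; have dj := dE (fold_label j).
have step := half_step (wt_l x) (wt_l1 x).
case: (fold_labelP i) => [[iE fi]|[iE fi]|[i1 i2 fi]].
- rewrite fi eqxx in dl *; rewrite fi in dj.
  move: act_i; rewrite /fold_active iE eqxx => par.
  have [s1 s2] := step _ dl; rewrite ?par ?(negbTE par) in s1 s2.
  case: (fold_labelP j) => [[jE fj]|[jE fj]|[j1 j2 fj]].
  + by rewrite jE !eqxx s1.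
  + by rewrite jE eqxx gtn_eqF // s2 ltn_eqF.
  + rewrite (negbTE j1) (negbTE j2); move: dj.
    have -> : (l == fold_label j) = false.
      by apply/negP => /eqP E; move: j1; rewrite -fj -E /= eqxx.
    by rewrite eq_sym (negbTE j1) => ->.
- rewrite fi eqxx in dl *; rewrite fi in dj.
  move: act_i; rewrite /fold_active iE eqxx gtn_eqF // => par.
  have [s1 s2] := step _ dl; rewrite ?par ?(negbTE par) in s1 s2.
  case: (fold_labelP j) => [[jE fj]|[jE fj]|[j1 j2 fj]].
  + by rewrite jE eqxx s1 gtn_eqF.
  + by rewrite jE eqxx gtn_eqF // s2 eqxx.
  + rewrite (negbTE j1) (negbTE j2); move: dj.
    have -> : (l == fold_label j) = false.
      by apply/negP => /eqP E; move: j1; rewrite -fj -E /= eqxx.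
    by rewrite eq_sym (negbTE j2) => ->.
have li : (fold_label i == l) = false.
  apply/negP => /eqP E; move: fi; rewrite E /=; have := ltn_ord i; lia.
rewrite li addr0 in dl; have {}dl : dep (act (fold_label i) x) l = dep x l.
  by case: dl.
rewrite dl; case: (fold_labelP j) => [[jE fj]|[jE fj]|[j1 j2 fj]].
- by rewrite jE eqxx (negbTE i1) addr0.
- by rewrite jE eqxx (negbTE i2) addr0 gtn_eqF.
rewrite (negbTE j1) (negbTE j2) dj; congr (_ + _).
by rewrite -val_eqE /= fi fj.
Qed.

Lemma neq_last_ltn (k : 'I_m.+2) : k != l -> (k < m.+1)%N.
Proof.
by move=> kl; rewrite ltn_neqAle -ltnS (ltn_ord k) andbT -(inj_eq val_inj) in kl *.
Qed.

Lemma fold_label_widen (k : 'I_m.+2) : k != l ->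
  fold_label (widen_ord (leqnSn m.+2) k) = k.
Proof.
move/neq_last_ltn => lt_k; apply: val_inj; rewrite /= fold_labelE /=.
by apply/minn_idPl/ltnW.
Qed.

Lemma fold_label_last k : (m < k < m.+3)%N -> fold_label (inord k) = l.
Proof.
case/andP=> mk km; apply: val_inj; rewrite /= fold_labelE inordK //.
by rewrite (minn_idPr mk).
Qed.

Lemma fold_dep_inj x y : (forall i, fold_dep x i = fold_dep y i) -> x = y.
Proof.
move=> E; apply: dep_inj => k.
have [kE|kl] := eqVneq k l.
  have := E (inord m.+2); have := E (inord m.+1).
  by rewrite /fold_dep !inordK // !eqxx gtn_eqF // kE; apply: half_inj.
have := E (widen_ord (leqnSn _) k); have lt_k := neq_last_ltn kl.
rewrite /fold_dep /= fold_label_widen // (ltn_eqF lt_k).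
by rewrite (ltn_eqF (ltn_trans lt_k (ltnSn _))).
Qed.

Lemma fold_dep_top i : fold_dep (top M) i = 0%N.
Proof. by rewrite /fold_dep !dep_top; do ?case: ifP. Qed.

Lemma fold_descent x : x != top M -> exists i, fold_wt x i = -1.
Proof.
have h1 : (m < m.+1 < m.+3)%N by lia.
have h2 : (m < m.+2 < m.+3)%N by lia.
move=> /wt_descent[k xk]; rewrite /fold_wt.
have [kE|kl] := eqVneq k l.
  rewrite kE in xk; have [par|par] := boolP (odd (dep x a)).
    exists (inord m.+2); rewrite (fold_label_last h2).
    by rewrite /fold_active inordK // gtn_eqF // eqxx par.
  exists (inord m.+1); rewrite (fold_label_last h1).
  by rewrite /fold_active inordK // eqxx par.
have lt_k := neq_last_ltn kl.
exists (widen_ord (leqnSn _) k); rewrite /fold_active /= fold_label_widen //.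
by rewrite (ltn_eqF lt_k) (ltn_eqF (ltn_trans lt_k (ltnSn _))).
Qed.

Lemma fold_depE x k : hx (fold_dep x) k =
  if k == m.+2 then (uphalf (dep x l))%:Z
  else if k == m.+3 then ((dep x l)./2)%:Z else hx (dep x) k.
Proof.
have [k0|k0] := posnP k; first by rewrite k0.
have [km|km] := leqP k m.+3; last first.
  rewrite !ext_out //; last exact: ltnW.
  by do 2![case: eqP => [E|_]; first by lia].
case: k k0 km => // k _ km; rewrite !eqSS.
have := ext_ord (fun k => (fold_dep x k)%:Z) (Ordinal km) => /= ->.
rewrite /fold_dep /=; case: eqP => // k1; case: eqP => // k2.
have km' : (k < m.+2)%N by lia.
have := ext_ord (fun k => (dep x k)%:Z) (Ordinal km') => /= ->.
by congr (Posz (dep x _)); apply: val_inj; rewrite /= fold_labelE /=; lia.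
Qed.

Lemma fold_wtE x j : fold_wt x j =
  (j == m.+1 :> nat)%:Z - \sum_i (fold_dep x i)%:Z * cartan (X := TypeD m.+3) i j.
Proof.
rewrite cartanD_sum.
have gE k : hx (fold_dep x) k = if k == m.+2 then (uphalf (dep x l))%:Z
  else if k == m.+3 then ((dep x l)./2)%:Z else hx (dep x) k := fold_depE x k.
have b := bits x (k := m.+1) (leqnn _).
have hl : hx (dep x) m.+2 = dep x l := ext_ord (fun k => (dep x k)%:Z) l.
have ha : hx (dep x) m.+1 = dep x a.
  by rewrite -(ext_ord (fun k => (dep x k)%:Z) a) aE.
rewrite hl ha in b; have [w1 w2] := half_weight (wt_l x) b.
rewrite /fold_wt /fold_active.
have e1 : (m.+2 == m.+3) = false by lia.
have e1' : (m.+3 == m.+2) = false by lia.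
have e2 : (m.+1 == m.+2) = false by lia.
have e2' : (m.+2 == m.+1) = false by lia.
have e3 : (m.+1 == m.+3) = false by lia.
case: (fold_labelP j) => [[jE ->]|[jE ->]|[j1 j2 jE]].
- by rewrite jE !eqxx e1 !gE eqxx e2 e3 ha w1.
- by rewrite jE /= e2' !eqxx !gE e1' eqxx e2 e3 ha w2 sub0r.
have lt_j : (j < m.+1)%N by have := ltn_ord (fold_label j); lia.
rewrite (negbTE j1) (negbTE j2) sub0r wtE jE.
move: (nat_of_ord j) lt_j => k lt_k.
have k1 : (k.+1 == m.+2) = false by lia.
have k2 : (k.+1 == m.+3) = false by lia.
have k3 : (k.+2 == m.+3) = false by lia.
have k4 : (k == m.+2) = false by lia.
have k5 : (k == m.+3) = false by lia.
rewrite k1 k2 k3 !gE k1 k2 k4 k5 !eqSS; have [->|km] := eqVneq k m.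
  have e0 : (m.+1 == m) = false by lia.
  (* At the branching label the two halves add up to the type C coefficient. *)
  rewrite eqxx e0 hl; have := uphalf_half (dep x l).
  have := odd_double_half (dep x l).
  move: (hx _ m) (hx _ m.+1) (dep x l) => A B h; lia.
have k6 : (k == m.+1) = false by lia.
rewrite k6; move: (hx _ k) (hx _ k.+1) (hx _ k.+2).
by move=> A B C; lia.
Qed.

Lemma fold_wt_act i x j :
  fold_wt (fold_act i x) j = fold_wt x j - fold_wt x i * cartan (X := TypeD m.+3) i j.
Proof.
rewrite !(fold_wtE _ j) -addrA -opprD; congr (_ - _).
under eq_bigr => k _ do rewrite fold_dep_act mulrDl.
rewrite big_split /=; congr (_ + _).
rewrite (bigD1 i) //= eqxx big1 ?addr0 // => k ki.
by rewrite eq_sym (negbTE ki) mul0r.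
Qed.

Definition fold_minuscule : minuscule (@cartan (TypeD m.+3)) :=
  @Minuscule _ (@cartan (TypeD m.+3)) M fold_wt fold_act fold_dep (top M)
    (@cartan_ii (TypeD m.+3)) (@cartan_le0 (TypeD m.+3))
    (@cartan_0C (TypeD m.+3)) (@cartanD_pos m.+3 isT)
    fold_wt_bound fold_wt_act fold_dep_act fold_dep_inj fold_dep_top
    fold_descent.

Lemma fold_wle x y : wle (M := fold_minuscule) x y = wle x y.
Proof.
apply/wleP/wleP => [H k|H i].
  have [->|kl] := eqVneq k l.
    have := H (inord m.+2); have := H (inord m.+1).
    by rewrite /= /fold_dep !inordK // !eqxx gtn_eqF //; apply: half_leq.
  have := H (widen_ord (leqnSn _) k); have lt_k := neq_last_ltn kl.
  rewrite /= /fold_dep /= fold_label_widen // (ltn_eqF lt_k).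
  by rewrite (ltn_eqF (ltn_trans lt_k (ltnSn _))).
have [H1 H2] := leq_half (H l); have := H (fold_label i); rewrite /= /fold_dep.
by case: ifP => // _; case: ifP.
Qed.

Lemma fold_height x : height (M := fold_minuscule) x = height x.
Proof.
elim/(minuscule_ind (M := fold_minuscule)): x => [|x i xi IH].
  by rewrite height_top [RHS]height_top.
have xi' : fold_wt x i = -1 by [].
have := height_act (M := fold_minuscule) i x; rewrite IH xi.
have -> : act (m := fold_minuscule) i x = act (fold_label i) x.
  by move: xi'; rewrite /= /fold_act /fold_wt; case: ifP.
rewrite height_act; move: xi'; rewrite /fold_wt; case: ifP => // _ ->.
lia.
Qed.

(** An end label active at v but not at u pairs to 0 with u in type D. When u pairs to 1 with [l],
    [R_type_C] turns q R (act l u) (act l v) into R u (act l v), and the type C rule collapses to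
    the zero rule; the pairing -1 is immediate from [R_type_C]. *)
Lemma fold_R_inactive R u v : R_system (M := M) R -> wt v l = -1 ->
  odd (dep u a) != odd (dep v a) -> R u v = 'X * R u (act l v).
Proof.
move=> RP vl par; have [_ _ /(_ u v l vl)[E1 _ E3]] := RP.
have al : a != l by rewrite -val_eqE /= aE ltn_eqF.
have RC u' v' : wt u' l = 1 -> wt v' l = 1 -> odd (dep u' a) != odd (dep v' a) ->
    R u' v' = 'X * R (act l u') v'.
  have ll : l = m.+1 :> nat by [].
  pose cC := @cartan (TypeC m.+2).
  have Aal : cC a l = -2 by rewrite /cC cartanC aE ll; do ?case: ifP => ?; lia.
  have Ala : cC l a = -1 by rewrite /cC cartanC aE ll; do ?case: ifP => ?; lia.
  have A0l k : k != a -> k != l -> cC k l = 0.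
    rewrite /cC cartanC ll => ka kl; move: ka kl (ltn_ord k).
    by rewrite -!val_eqE /= aE; move: (nat_of_ord k) => b; do ?case: ifP => ?; lia.
  have Asl k k' : k != l -> k' != l -> k != k' ->
      (cC k k' = 0 /\ cC k' k = 0) \/ (cC k k' = -1 /\ cC k' k = -1).
    move=> kl kl' kk; rewrite /cC !cartanC; move: kl kl' kk (ltn_ord k) (ltn_ord k').
    by rewrite -!val_eqE /=; move: (nat_of_ord k) (nat_of_ord k') => b c; do ?case: ifP => ?; lia.
  have wtl x : wt x l <> 0 by case: (wt_l1 x) => ->.
  by have [_] := R_type_C RP al Aal Ala A0l Asl wtl u' v'.
have dla x : dep (act l x) a = dep x a.
  by have := dep_act l x a; rewrite eq_sym (negbTE al) addr0 => -[].
have lvl : wt (act l v) l = 1 by rewrite wt_actK vl.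
case: (wt_l1 u) => ul.
  by rewrite (E3 ul) (RC u (act l v)) ?dla //; ring.
have lul : wt (act l u) l = 1 by rewrite wt_actK ul.
by rewrite (E1 ul) (RC (act l u) (act l v)) ?actK ?dla.
Qed.

Lemma fold_R_system R : R_system (M := M) R -> R_system (M := fold_minuscule) R.
Proof.
move=> RP; have [Rle Ruu Rrec] := RP.
split=> [u v|//|u v i]; first by rewrite fold_wle; apply: Rle.
rewrite /= /fold_act /fold_wt; case: ifP => // vi vfi.
have [E1 E2 E3] := Rrec u v (fold_label i) vfi.
case: ifP => ui; first by split.
split=> // _.
have [li par] : fold_label i = l /\ odd (dep (m := M) u a) != odd (dep (m := M) v a).
  move: ui vi; rewrite /fold_active.
  case: (fold_labelP i) => [[iE ->]|[iE ->]|[i1 i2 _]].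
  - by rewrite iE eqxx => /negbFE-> /negbTE->.
  - by rewrite iE gtn_eqF // eqxx => -> ->.
  - by rewrite (negbTE i1) (negbTE i2).
rewrite li in vfi *; exact: fold_R_inactive.
Qed.

Lemma fold_KL_system R P :
  KL_system (M := M) R P -> KL_system (M := fold_minuscule) R P.
Proof.
case=> [Puu Psz Prec]; split=> [//|u v|u v]; rewrite fold_wle ?fold_height.
  exact: Psz.
move=> uv; rewrite Prec //; apply: eq_bigl => z.
by rewrite !fold_wle.
Qed.
End TypeCFold.

(** * Totally ordered orbits as projective spaces *)

Section Chain.
Variables (I : finType) (A : I -> I -> int) (M : minuscule A).
Hypothesis total : forall x y : M, wle x y || wle y x.
Implicit Types (x y u v w : M).

Lemma chain_wle x y : wle x y = (height x <= height y)%N.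
Proof.
apply/idP/idP => [/wle_height //|hxy].
have /orP[//|yx] := total x y.
by rewrite (wle_height_eq yx hxy) wle_refl.
Qed.

Lemma chain_height_inj x y : height x = height y -> x = y.
Proof. by move=> E; apply: wle_anti; rewrite chain_wle E. Qed.

(** A closed formula is wanted because the labels of [M], which may repeat along the chain, are
    about to be replaced by distinct ones. *)
Lemma chain_R (R : M -> M -> {poly int}) u v : R_system R ->
  (height u < height v)%N ->
  R u v = ('X - 1) * 'X ^+ (height v - height u).-1.
Proof.
move=> RP; have [Rle Ruu Rrec] := RP.
have [n] := ubnP (height v); elim: n u v => // n IHn u v lt_n uv.
have uv' : wle u v by rewrite chain_wle ltnW.
have neq : u != v by apply: contraTneq uv => ->; rewrite ltnn.
have [j vj dj] := coatom_exists uv' neq.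
have hw := height_act j v; rewrite vj in hw.
have wj : wt (act j v) j = 1 by rewrite wt_actK vj.
have [E1 E2 E3] := Rrec u v j vj; have hu := height_act j u.
case: (wtP u j) => uj; rewrite uj in hu.
- rewrite (E1 uj) IHn; [|lia|lia].
  by congr (_ * 'X ^+ _.-1); lia.
- rewrite (E2 uj); have [uE|neq_uw] := eqVneq (height u) (height (act j v)).
    by move: uj; rewrite (chain_height_inj uE) wj.
  rewrite IHn; [|lia|lia]; rewrite mulrCA -exprS.
  by congr (_ * 'X ^+ _); lia.
- rewrite (E3 uj); have [uE|neq_uw] := eqVneq (height u) (height (act j v)).
    rewrite {1}(chain_height_inj uE) Ruu Rle ?chain_wle; last by lia.
    have -> : (height v - height u).-1 = 0%N by lia.
    by rewrite expr0 mulr0 addr0.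
  have [uE|neq_uw'] := eqVneq (height (act j u)) (height (act j v)).
    have := wt_actK j u; rewrite (chain_height_inj uE) wj uj.
    by [].
  rewrite IHn; [|lia|lia]; rewrite IHn; [|lia|lia].
  have -> : (height v - height u).-1 = (height (act j v) - height (act j u)).-1.+2.
    by lia.
  have -> : (height (act j v) - height u).-1 = (height (act j v) - height (act j u)).-1.+1.
    by lia.
  by rewrite !exprS; ring.
Qed.

Let N : nat := \max_(x : M) height x.

Lemma chain_height_max x : (height x <= N)%N.
Proof. exact: leq_bigmax. Qed.

Lemma chain_elem_exists r : (r <= N)%N -> exists x, height x = r.
Proof.
have : exists x, height x = N.
  have [|x xE] := @bigop.eq_bigmax M (fun x : M => height x).
    by apply/card_gt0P; exists (top M).
  by exists x.
move: N => b [x <-].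
elim/minuscule_ind: x => [|x i xi IH].
  by rewrite height_top leqn0 => /eqP ->; exists (top M); rewrite height_top.
have := height_act i x; rewrite xi => hx; rewrite leq_eqVlt => /orP[/eqP ->|rx].
  by exists x.
by apply: IH; lia.
Qed.

Definition chain_elem (x : M) (r : nat) : M :=
  odflt x [pick y | height y == r].

Lemma chain_elemE x r : (r <= N)%N -> height (chain_elem x r) = r.
Proof.
move=> /chain_elem_exists[y yr]; rewrite /chain_elem.
by case: pickP => [z /eqP //|/(_ y)]; rewrite yr eqxx.
Qed.

Implicit Types i j : 'I_N.

(** An element of height r plays the weight eps_(r+1) of type A_N. *)
Definition chain_wt x i : int :=
  (height x == i)%:Z - (height x == i.+1)%:Z.
Definition chain_act i x : M :=
  if height x == i then chain_elem x i.+1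
  else if height x == i.+1 then chain_elem x i else x.
Definition chain_dep x i : nat := (i < height x)%N.

Lemma chain_height_act i x :
  (height (chain_act i x))%:Z = (height x)%:Z + chain_wt x i.
Proof.
have lt_i := ltn_ord i; rewrite /chain_act /chain_wt.
have [E|n1] := eqVneq (height x) i; first by rewrite chain_elemE // E; lia.
have [E|n2] := eqVneq (height x) i.+1; last by lia.
by rewrite chain_elemE ?E; [lia | apply: ltnW].
Qed.

Lemma chain_wt_bound x i : -1 <= chain_wt x i <= 1.
Proof. by rewrite /chain_wt; lia. Qed.

Lemma chain_wt_act i x j : chain_wt (chain_act i x) j =
  chain_wt x j - chain_wt x i * cartan (X := TypeA N) i j.
Proof.
have := chain_height_act i x; rewrite cartanA /chain_wt.
move: (height (chain_act i x)) (height x) (nat_of_ord i) (nat_of_ord j).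
move=> h h' a b; have [->|n1] := eqVneq h' a.
  have -> : (a == a.+1) = false by lia.
  by lia.
by have [->|n2] := eqVneq h' a.+1; lia.
Qed.

Lemma chain_dep_act i x j : (chain_dep (chain_act i x) j)%:Z =
  (chain_dep x j)%:Z + (if i == j then chain_wt x i else 0).
Proof.
have := chain_height_act i x; rewrite /chain_dep /chain_wt -val_eqE /=.
move: (height (chain_act i x)) (height x) (nat_of_ord i) (nat_of_ord j).
by move=> h h' a b; have [->|] := eqVneq a b; lia.
Qed.

Lemma chain_dep_inj x y : (forall i, chain_dep x i = chain_dep y i) -> x = y.
Proof.
move=> E; apply: chain_height_inj; have := chain_height_max x.
have := chain_height_max y => hy hx.
have [lt|lt|//] := ltngtP (height x) (height y).
  have lt_N := leq_trans lt hy; have := E (Ordinal lt_N).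
  by rewrite /chain_dep /= ltnn lt.
have lt_N := leq_trans lt hx; have := E (Ordinal lt_N).
by rewrite /chain_dep /= ltnn lt.
Qed.

Lemma chain_dep_top i : chain_dep (top M) i = 0%N.
Proof. by rewrite /chain_dep height_top. Qed.

Lemma chain_descent x : x != top M -> exists i, chain_wt x i = -1.
Proof.
move=> xt; have := chain_height_max x; case hE: (height x) => [|r] lt_r.
  by rewrite (height_eq0 hE) eqxx in xt.
by exists (Ordinal lt_r); rewrite /chain_wt hE /=; lia.
Qed.

Definition chain_minuscule : minuscule (@cartan (TypeA N)) :=
  @Minuscule _ (@cartan (TypeA N)) M chain_wt chain_act chain_dep (top M)
    (@cartan_ii (TypeA N)) (@cartan_le0 (TypeA N)) (@cartan_0C (TypeA N))
    (@cartanA_pos N) chain_wt_bound chain_wt_act chain_dep_act chain_dep_inj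
    chain_dep_top chain_descent.

Lemma chain_minuscule_height x : height (M := chain_minuscule) x = height x.
Proof.
elim/(minuscule_ind (M := chain_minuscule)): x => [|x i xi IH].
  by rewrite height_top [RHS]height_top.
have E1 := height_act (M := chain_minuscule) i x; rewrite {}IH in E1.
have E2 := chain_height_act i x; rewrite E2 in E1.
by case: (addIr _ E1).
Qed.

Lemma chain_minuscule_wle x y : wle (M := chain_minuscule) x y = wle x y.
Proof.
rewrite chain_wle; apply/wleP/idP => [H|hxy i].
  rewrite leqNgt; apply/negP => lt_yx.
  have := H (Ordinal (leq_trans lt_yx (chain_height_max x))).
  by rewrite /= /chain_dep /= lt_yx ltnn.
by rewrite /= /chain_dep; have := hxy; lia.
Qed.

Lemma chain_wtP x i c : chain_wt x i = c ->
  [/\ c = -1 -> height x = i.+1, c = 1 -> height x = i &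
      c = 0 -> (height x < i)%N || (i.+1 < height x)%N].
Proof.
by rewrite /chain_wt => <-; move: (height x) (nat_of_ord i) => h a; split; lia.
Qed.

(** Each label occurs once: pairing -1 forces u = v, pairing 1 forces u to be the coatom of v, and
    pairing 0 is settled by [chain_R] or by vanishing. *)
Lemma chain_R_rule R u v i : R_system R -> chain_wt v i = -1 ->
  [/\ chain_wt u i = -1 -> R u v = R (chain_act i u) (chain_act i v),
      chain_wt u i = 0 -> R u v = 'X * R u (chain_act i v) &
      chain_wt u i = 1 -> R u v = ('X - 1) * R u (chain_act i v) +
                                  'X * R (chain_act i u) (chain_act i v)].
Proof.
move=> RP vi; have [Rle Ruu _] := RP; have [/(_ erefl) hv _ _] := chain_wtP vi.
have hw := chain_height_act i v; have hu := chain_height_act i u.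
rewrite vi hv in hw; have {}hw : height (chain_act i v) = i by lia.
split=> ui; rewrite ui in hu; have [H1 H2 H3] := chain_wtP ui.
- by rewrite (chain_height_inj (x := u) (y := v)) ?Ruu // H1.
- have [lt|lt] := orP (H3 erefl).
    rewrite (chain_R RP) ?hv; last by lia.
    rewrite (chain_R RP) ?hw // mulrCA -exprS.
    by congr (_ * 'X ^+ _); lia.
  by rewrite !Rle ?mulr0 // chain_wle ?hv ?hw; lia.
- have E := H2 erefl; have {}hu : height (chain_act i u) = i.+1 by lia.
  rewrite (chain_height_inj (x := chain_act i v) (y := u)) ?hw //.
  rewrite (chain_height_inj (x := chain_act i u) (y := v)) ?hu //.
  rewrite Ruu (Rle v) ?chain_wle ?hv ?E ?ltnn //.
  rewrite (chain_R RP) hv E //.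
  by rewrite subSnn expr0 mulr0 addr0.
Qed.

Lemma chain_R_system R :
  R_system (M := M) R -> R_system (M := chain_minuscule) R.
Proof.
move=> RP; have [Rle Ruu _] := RP.
split=> [u v|//|u v i vi]; first by rewrite chain_minuscule_wle; apply: Rle.
exact: chain_R_rule.
Qed.

Lemma chain_KL_system R P :
  KL_system (M := M) R P -> KL_system (M := chain_minuscule) R P.
Proof.
case=> [Puu Psz Prec]; split=> [//|u v|u v];
  rewrite chain_minuscule_wle ?chain_minuscule_height; first exact: Psz.
move=> uv; rewrite Prec //; apply: eq_bigl => z.
by rewrite !chain_minuscule_wle.
Qed.
End Chain.

(** * Combinatorial invariance *)

(** The labels of [A] are independent of those of [W], so a pair of type C or B can be realised on
    its relabelled system. *)
Record realization (X : cartan_type) (W : weyl_group X)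
    (J : {set 'I_(rank X)}) (R P : W -> W -> {poly int})
    (I : finType) (A : I -> I -> int) (M : minuscule A) (phi : W -> M)
    (sec : M -> W) : Prop := Realization {
  real_R : R_system (fun x y => R (sec x) (sec y));
  real_KL : KL_system (fun x y => R (sec x) (sec y)) (fun x y => P (sec x) (sec y));
  real_quot : forall x, sec x \in quot W J;
  real_phiK : {in quot W J, cancel phi sec};
  real_secK : cancel sec phi;
  real_le : forall x y, bruhat (sec x) (sec y) = wle x y
}.

Lemma cartan_bondP (X : cartan_type) (i j : 'I_(rank X)) : i != j ->
  cartan_bond (@cartan X) i j (coxeter_matrix i j).
Proof.
case/cartanP => H.
- by constructor 1; case: H.
- by constructor 2.
- by constructor 3.
- by constructor 4.
Qed.

Section Realize.
Variables (X : cartan_type) (W : weyl_group X) (J : {set 'I_(rank X)}).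
Variables (R P : W -> W -> {poly int}).
Hypotheses (hR : relative_R J R) (hP : relative_KL J R P).

Lemma realization_exists (M : minuscule (@cartan X)) p :
  (forall i, wt (top M) i = (val i == p)%:Z) ->
  J = [set i : 'I_(rank X) | i.+1 != p.+1] ->
  exists (phi : W -> M) (sec : M -> W), realization J R P phi sec.
Proof.
move=> Mtop JE.
have {}JE : J = [set i | wt (top M) i == 0].
  by rewrite JE; apply/setP => i; rewrite !inE Mtop eqSS; case: (_ == _).
have [phi [phi1 phi_s]] := orbit_map_exists W M (@cartan_bondP X).
exists phi, (section phi).
have hR1 := hR; have hP1 := hP; rewrite JE in hR1 hP1 *.
split.
- exact: (R_system_section (@cartan_bondP X) phi1 phi_s hR1).
- exact: (KL_system_section (@cartan_bondP X) phi1 phi_s hP1).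
- exact: section_quot.
- by move=> w wq; apply: (section_phi (@cartan_bondP X)).
- exact: phi_section.
- exact: (bruhat_section (@cartan_bondP X)).
Qed.

Definition realizable : Prop :=
  exists (I : finType) (A : I -> I -> int) (M : minuscule A)
    (phi : W -> M) (sec : M -> W),
  simply_laced A /\ realization J R P phi sec.

Lemma realizable_simply_laced (M : minuscule (@cartan X)) p :
  (forall i j : 'I_(rank X), coxeter_matrix i j != 4%N) ->
  (forall i, wt (top M) i = (val i == p)%:Z) ->
  J = [set i : 'I_(rank X) | i.+1 != p.+1] -> realizable.
Proof.
move=> /cartan_simply_laced sl Mtop JE.
have [phi [sec rl]] := realization_exists Mtop JE.
by exists 'I_(rank X), (@cartan X), M, phi, sec.
Qed.
End Realize.

Lemma realizable_pair (H : hermitian_pair) (W : weyl_group (pair_type H))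
    (R P : W -> W -> {poly int}) :
  relative_R (pair_J H) R -> relative_KL (pair_J H) R P ->
  realizable (pair_J H) R P.
Proof.
case: H W R P => [n [//|p] np|[|[|m]] // n2|n n2|n n3|n n3||] W R P hR hP.
- have [M Mtop] := minusculeA (p := p) np.
  apply: (realizable_simply_laced hR hP _ Mtop) => // i j.
  by rewrite /coxeter_matrix /=; do 2?case: ifP.
- have [M [Mtop Mwt Mbits]] := minusculeC n2.
  have [|phi [sec [rR rKL rq rphi rsec rle]]] := realization_exists hR hP Mtop.
    by [].
  exists 'I_m.+3, (@cartan (TypeD m.+3)), (fold_minuscule Mwt Mbits), phi, sec.
  split.
    apply: (@cartan_simply_laced (TypeD m.+3)) => i j.
    by rewrite /coxeter_matrix /=; do 2?case: ifP.
  split=> //.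
  + exact: fold_R_system.
  + exact: fold_KL_system.
  + by move=> x y; rewrite rle fold_wle.
- have [M [Mtop Mchain]] := minusculeB n2.
  have [|phi [sec [rR rKL rq rphi rsec rle]]] := realization_exists hR hP Mtop.
    by [].
  (* The coefficients grow with the distance t, so comparing distances compares weights. *)
  have total (x y : M) : wle x y || wle y x.
    have [t tE] := Mchain x; have [t' t'E] := Mchain y.
    have key (z z' : M) b b' : (b <= b')%N ->
        (forall k, hx (dep z) k = ((0 < k <= n) && (k <= b))%N%:Z +
           ((n.*2 <= k + b) && (k < n))%N%:Z) ->
        (forall k, hx (dep z') k = ((0 < k <= n) && (k <= b'))%N%:Z +
           ((n.*2 <= k + b') && (k < n))%N%:Z) -> wle z z'.
      move=> bb zE z'E; apply/wleP => i; have := zE i.+1; have := z'E i.+1.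
      rewrite !ext_ord; move: (dep z i) (dep z' i) (nat_of_ord i) => c d e.
      by lia.
    apply/orP; have [tt|tt] := leqP t t'; first by left; apply: key tt tE t'E.
    by right; apply: key (ltnW tt) t'E tE.
  exists 'I_(\max_(x : M) height x), (@cartan (TypeA _)), (chain_minuscule total), phi, sec.
  split.
    apply: (@cartan_simply_laced (TypeA _)) => i j.
    by rewrite /coxeter_matrix /=; do 2?case: ifP.
  split=> //.
  + exact: chain_R_system.
  + exact: chain_KL_system.
  + by move=> x y; rewrite rle chain_minuscule_wle.
- have [M Mtop] := minusculeDspin n3.
  apply: (realizable_simply_laced hR hP _ Mtop).
    by move=> i j; rewrite /coxeter_matrix /=; do 2?case: ifP.
  by rewrite /pair_J /= prednK // ltnW // ltnW.
- have [M Mtop] := minusculeDvec n3.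
  apply: (realizable_simply_laced hR hP _ Mtop) => // i j.
  by rewrite /coxeter_matrix /=; do 2?case: ifP.
- have [M Mtop] := minusculeE6.
  apply: (realizable_simply_laced hR hP _ Mtop) => // i j.
  by rewrite /coxeter_matrix /=; do 2?case: ifP.
- have [M Mtop] := minusculeE7.
  apply: (realizable_simply_laced hR hP _ Mtop) => // i j.
  by rewrite /coxeter_matrix /=; do 2?case: ifP.
Qed.

Lemma KL_realizable_eq (X X' : cartan_type) (W : weyl_group X)
    (W' : weyl_group X') (J : {set 'I_(rank X)}) (J' : {set 'I_(rank X')})
    (R P : W -> W -> {poly int}) (R' P' : W' -> W' -> {poly int})
    (u v : W) (u' v' : W') :
  realizable J R P -> realizable J' R' P' ->
  u \in quot W J -> v \in quot W J -> bruhat u v ->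
  u' \in quot W' J' -> v' \in quot W' J' -> bruhat u' v' ->
  interval_iso J u v J' u' v' -> P u v = P' u' v'.
Proof.
case=> [I [A [M [phi [sec [slA [rR rKL rq rphi rsec rle]]]]]]].
case=> [I' [A' [M' [phi' [sec' [slA' [rR' rKL' rq' rphi' rsec' rle']]]]]]].
move=> uq vq uv u'q v'q u'v' [f [_ fI fle]].
have bE a b : a \in quot W J -> b \in quot W J -> bruhat a b = wle (phi a) (phi b).
  by move=> aq bq; rewrite -rle !rphi.
have bE' a b : a \in quot W' J' -> b \in quot W' J' ->
    bruhat a b = wle (phi' a) (phi' b).
  by move=> aq bq; rewrite -rle' !rphi'.
have inI x : wle (phi u) x -> wle x (phi v) -> sec x \in interval J u v.
  by move=> ux xv; rewrite inE rq -[u]rphi // -[v]rphi // !rle ux xv.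
have fI' w : w \in interval J u v -> f w \in interval J' u' v'.
  by move=> wI; rewrite -fI imset_f.
have Iq w : w \in interval J u v -> w \in quot W J by rewrite inE => /andP[].
have Iq' w : w \in interval J' u' v' -> w \in quot W' J' by rewrite inE => /andP[].
have uI : u \in interval J u v by rewrite inE uq uv [bruhat u u]connect0.
have vI : v \in interval J u v by rewrite inE vq uv [bruhat v v]connect0.
have u'I : u' \in interval J' u' v' by rewrite inE u'q u'v' [bruhat u' u']connect0.
have v'I : v' \in interval J' u' v' by rewrite inE v'q u'v' [bruhat v' v']connect0.
have anti a b : a \in quot W J -> b \in quot W J -> bruhat a b -> bruhat b a -> a = b.
  move=> aq bq; rewrite !bE // => ab ba.
  by rewrite -[a]rphi // -[b]rphi // (wle_anti ab ba).
(* An isomorphism matches least elements, by antisymmetry on the quotient; likewise for v. *)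
have fu : f u = u'.
  have := u'I; rewrite -fI => /imsetP[w wI wE]; rewrite wE; congr f.
  have := fI' u uI; rewrite inE => /and3P[_ fuge _].
  rewrite wE fle // in fuge; apply: anti => //; first exact: Iq.
  by move: wI; rewrite inE => /and3P[].
have fv : f v = v'.
  have := v'I; rewrite -fI => /imsetP[w wI wE]; rewrite wE; congr f.
  have := fI' v vI; rewrite inE => /and3P[_ _ fvle].
  rewrite wE fle // in fvle; apply: anti => //; first exact: Iq.
  by move: wI; rewrite inE => /and3P[].
pose g x := phi' (f (sec x)).
have giso : iso_on g (phi u) (phi v).
  split=> [x y ux xv uy yv|z' gz zg].
    have xI := inI x ux xv; have yI := inI y uy yv.
    by rewrite -bE' ?fle ?rle //; apply: Iq'; apply: fI'.
  have : sec' z' \in interval J' u' v'.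
    rewrite inE rq' -fu -fv -[f u]rphi' ?fu // -[f v]rphi' ?fv // !rle'.
    by move: gz zg; rewrite /g !rphi // fu fv => -> ->.
  rewrite -fI => /imsetP[w wI wE]; exists (phi w).
  have wq := Iq w wI; have := wI; rewrite inE => /and3P[_ uw wv].
  by rewrite -!bE // /g rphi // -wE rsec'.
have := KL_iso slA slA' rR rR' rKL rKL' giso.
by rewrite -bE // /g !rphi // fu fv !rphi' // => ->.
Qed.

Theorem mainTheorem3
    (H H' : hermitian_pair)
    (W : weyl_group (pair_type H)) (W' : weyl_group (pair_type H'))
    (R P : W -> W -> {poly int}) (R' P' : W' -> W' -> {poly int})
    (hR : relative_R (pair_J H) R) (hP : relative_KL (pair_J H) R P)
    (hR' : relative_R (pair_J H') R') (hP' : relative_KL (pair_J H') R' P')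
    (u v : W) (u' v' : W')
    (hu : u \in quot W (pair_J H)) (hv : v \in quot W (pair_J H))
    (huv : bruhat u v)
    (hu' : u' \in quot W' (pair_J H')) (hv' : v' \in quot W' (pair_J H'))
    (huv' : bruhat u' v')
    (hiso : interval_iso (pair_J H) u v (pair_J H') u' v') :
  P u v = P' u' v'.
Proof.
exact: KL_realizable_eq (realizable_pair hR hP) (realizable_pair hR' hP')
  hu hv huv hu' hv' huv' hiso.
Qed.
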